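(* Let $(P_t,D_t)_{t\in T}$ be a primal-dual pair of parametric semidefinite programs over an open interval $T=(t_i,t_f)\subseteq\mathbb{R}$, with data $\mathcal{A}(t),b(t),C(t)$. Assume: (1) (LICQ and uniform boundedness) for every $t\in T$ the matrices $A_1(t),\dots,A_m(t)$ are linearly independent in $\mathbb{S}^n$ (so that $\mathcal{A}(t)$ is surjective), and the norms of $\mathcal{A}(t)$ and of its pseudo-inverse $\mathcal{A}^*(t)\big(\mathcal{A}(t)\mathcal{A}^*(t)\big)^{-1}$ are bounded uniformly in $t\in T$; (2) (strict feasibility) for every $t\in T$ both $(P_t)$ and $(D_t)$ are strictly feasible; (3) (data continuity) $\mathcal{A}(t)$, $b(t)$, $C(t)$ depend continuously on $t\in T$. Suppose moreover that there exists a generic non-singular time in $T$ and that $\mathcal{A}(t)$, $b(t)$, $C(t)$ are polynomial functions of $t$. Then: (a) the set of times $t\in T$ at which there is a non-differentiable point or a discontinuous isolated multiple point for $\mathcal{P}^*$ or for $\mathcal{D}^*$ is finite; (b) all other points are regular points for both $\mathcal{P}^*$ and $\mathcal{D}^*$; (c) the number of regular points at which $\mathcal{P}^*$ or $\mathcal{D}^*$ is not continuously differentiable is finite.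
   Context: **Problems.** $\mathbb{S}^n$ is the space of real symmetric $n\times n$ matrices with $\langle X,Y\rangle=\operatorname{trace}(XY)$; $X\succeq0$ (resp. $X\succ0$) means positive semidefinite (resp. definite). For $t\in T$, $A_1(t),\dots,A_m(t),C(t)\in\mathbb{S}^n$, $b(t)\in\mathbb{R}^m$, $\mathcal{A}(t)[X]=(\langle A_i(t),X\rangle)_{i=1}^m\in\mathbb{R}^m$, and $\mathcal{A}^*(t)[y]=\sum_{i=1}^m y_iA_i(t)$. The problems are $(P_t)$: $\min_{X\in\mathbb{S}^n}\langle C(t),X\rangle$ s.t. $\mathcal{A}(t)[X]=b(t)$, $X\succeq0$; $(D_t)$: $\max_{y\in\mathbb{R}^m,Z\in\mathbb{S}^n}\langle b(t),y\rangle$ s.t. $\mathcal{A}^*(t)[y]+Z=C(t)$, $Z\succeq0$. $(P_t)$ is strictly feasible if there is $X\succ0$ with $\mathcal{A}(t)[X]=b(t)$; $(D_t)$ is strictly feasible if there are $y\in\mathbb{R}^m$ and $Z\succ0$ with $\mathcal{A}^*(t)[y]+Z=C(t)$. $\mathcal{P}^*(t)\subseteq\mathbb{S}^n$ is the set of optimal solutions $X$ of $(P_t)$; $\mathcal{D}^*(t)\subseteq\mathbb{S}^n$ is the set of matrices $Z$ such that $(y,Z)$ is optimal for $(D_t)$ for some $y\in\mathbb{R}^m$. **Set-valued maps.** For $F:T\rightrightarrows\mathbb{S}^n$ with non-empty values, $F$ is single-valued at $t$ if $F(t)$ is a singleton, and multi-valued at $t$ if $F(t)$ has more than one element. $F$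 is continuous (Painlevé–Kuratowski) at $\hat t$ if it is inner semi-continuous (for every $\hat x\in F(\hat t)$ and every sequence $t_k\to\hat t$ in $T$ there are $x_k\in F(t_k)$ with $x_k\to\hat x$) and outer semi-continuous (whenever $t_k\to\hat t$ in $T$, $x_k\in F(t_k)$ and $x_k\to\hat x$, one has $\hat x\in F(\hat t)$). **Types of points.** Let $t^*\in T$, $X^*\in\mathcal{P}^*(t^* )$. The pair $(X^*,t^* )$ is - a *regular point* if $\mathcal{P}^*(t^* )=\{X^*\}$ and there is $\varepsilon>0$ such that $\mathcal{P}^*$ is single-valued and continuous at every $t\in(t^*-\varepsilon,t^*+\varepsilon)$, and $\mathcal{P}^*$ is differentiable at $t^*$; - a *non-differentiable point* if $\mathcal{P}^*(t^* )=\{X^*\}$ and there is $\varepsilon>0$ such that $\mathcal{P}^*$ is single-valued and continuous at every $t\in(t^*-\varepsilon,t^*+\varepsilon)$, and $\mathcal{P}^*$ is not differentiable at $t^*$; - a *discontinuous isolated multiple point* if there is $\varepsilon>0$ such that $\mathcal{P}^*$ is single-valued and continuous at every $t\in(t^*-\varepsilon,t^* )\cup(t^*,t^*+\varepsilon)$, and $\mathcal{P}^*$ is multi-valued at $t^*$. The same types for $(Z^*,t^* )$, $Z^*\in\mathcal{D}^*(t^* )$, are defined with $\mathcal{D}^*$ in place of $\mathcal{P}^*$. ''Continuously differentiable at $t^*$'' means single-valued and of class $C^1$ on a neighbourhood of $t^*$. **Singular and generic times.** Let $\operatorname{svec}(X)=(X_{11},\sqrt2X_{12},\dots,\sqrt2X_{1n},X_{22},\sqrt2X_{23},\dots,X_{nn})^T\in\mathbb{R}^{\tau(n)}$,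 $\tau(n)=n(n+1)/2$, let $\tilde{\mathcal{A}}(t)$ be the $m\times\tau(n)$ matrix with rows $\operatorname{svec}(A_i(t))^T$, and let $$F(X,y,Z,t)=\begin{pmatrix}\tilde{\mathcal{A}}(t)\operatorname{svec}(X)-b(t)\\ \tilde{\mathcal{A}}(t)^Ty+\operatorname{svec}(Z)-\operatorname{svec}(C(t))\\ \tfrac12\operatorname{svec}(XZ+ZX)\end{pmatrix}.$$ A point $(X,y,Z)$ is singular at $t$ if the Jacobian of $F$ with respect to $(X,y,Z)$ at $(X,y,Z,t)$, $$\begin{pmatrix}\tilde{\mathcal{A}}(t)&0&0\\0&\tilde{\mathcal{A}}(t)^T&I_{\tau(n)}\\ Z\otimes_sI_n&0&I_n\otimes_sX\end{pmatrix},$$ is not invertible, where $\otimes_s$ is the symmetric Kronecker product, $(A\otimes_sB)\operatorname{svec}(H)=\tfrac12\operatorname{svec}(AHB^T+BHA^T)$ for $H\in\mathbb{S}^n$. A time $\hat t$ is singular if there is a point $(X,y,Z)$, singular at $\hat t$, with $F(X,y,Z,\hat t)=0$; otherwise $\hat t$ is non-singular. A non-singular time $\hat t$ is *generic* if the data tuple $(\mathcal{A}(\hat t),b(\hat t),C(\hat t))$ is generic in the sense that the number of solutions $(X,y,Z)$ of $F(X,y,Z,\hat t)=0$, counted over the complex numbers ($X,Z$ complex symmetric, $y\in\mathbb{C}^m$), equals the generic number of solutions, i.e. the number of complex solutions of the same system for a generic (non-empty Zariski-open set of) data tuple $(\mathcal{A},b,C)$ with the same $n$ and $m$. *)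

(* Defs.v *)
From HB Require Import structures.
From mathcomp Require Import all_boot all_order all_algebra.
From mathcomp Require Import all_classical all_reals all_analysis.
From mathcomp Require Import complex.
From mathcomp Require mpoly.

Set Implicit Arguments.
Unset Strict Implicit.
Unset Printing Implicit Defensive.

Import Order.TTheory GRing.Theory Num.Theory.
Import numFieldNormedType.Exports.

Local Open Scope classical_set_scope.
Local Open Scope ring_scope.

(* The tuple (A_1, ..., A_m, b, C); symmetry of the matrices is the separate
   predicate [sym_data]. *)
Record sdp_data (K : Type) (n m : nat) := SdpData {
  dA : 'I_m -> 'M[K]_n ;
  db : 'cV[K]_m ;
  dC : 'M[K]_n }.

Definition symm (K : Type) (n : nat) (X : 'M[K]_n) : Prop := X^T = X.

Definition sym_data (K : Type) (n m : nat) (D : sdp_data K n m) : Prop :=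
  (forall i, symm (dA D i)) /\ symm (dC D).

Definition map_data (K L : Type) (f : K -> L) (n m : nat) (D : sdp_data K n m) :
    sdp_data L n m :=
  SdpData (fun i => map_mx f (dA D i)) (map_mx f (db D)) (map_mx f (dC D)).

Section Operators.
Variables (K : comNzRingType) (n m : nat).

Definition inner (X Y : 'M[K]_n) : K := \tr (X *m Y).

Definition dotv (u v : 'cV[K]_m) : K := \sum_(i < m) u i 0 * v i 0.

Definition opA (D : sdp_data K n m) (X : 'M[K]_n) : 'cV[K]_m :=
  \col_i inner (dA D i) X.

Definition adjA (D : sdp_data K n m) (y : 'cV[K]_m) : 'M[K]_n :=
  \sum_(i < m) y i 0 *: dA D i.

(* The matrix of y |-> opA D (adjA D y). *)
Definition gram (D : sdp_data K n m) : 'M[K]_m :=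
  \matrix_(i, j) inner (dA D i) (dA D j).

Lemma gramE (D : sdp_data K n m) (y : 'cV[K]_m) :
  gram D *m y = opA D (adjA D y).
Proof.
apply/colP => i; rewrite !mxE /inner /adjA mulmx_sumr raddf_sum /=.
by apply: eq_bigr => j _; rewrite mxE -scalemxAr mxtraceZ mulrC.
Qed.

End Operators.

Definition pinvA (K : comUnitRingType) (n m : nat) (D : sdp_data K n m)
  (v : 'cV[K]_m) : 'M[K]_n := adjA D (invmx (gram D) *m v).

(* Positions (i, j) with i <= j; [enum_val] lists them row by row, which is the
   order of the coordinates of svec. *)
Definition upper (n : nat) : {set 'I_n * 'I_n} :=
  [set ij : 'I_n * 'I_n | (ij.1 <= ij.2)%N].

Definition tau (n : nat) : nat := #|upper n|.

Lemma tauE (n : nat) : tau n = ((n * n.+1)./2)%N.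
Proof.
rewrite /tau /upper -sum1dep_card /=.
rewrite -(pair_big_dep xpredT (fun i j : 'I_n => (i <= j)%N) (fun _ _ => 1%N)) /=.
rewrite (exchange_big_dep xpredT) //= (eq_bigr (fun j : 'I_n => (nat_of_ord j).+1)).
  elim: n => [|n IH]; first by rewrite big_ord0.
  rewrite big_ord_recr IH [nat_of_ord ord_max]/=.
  have -> : (n.+1 * n.+2 = n * n.+1 + n.+1.*2)%N.
    by rewrite -addn2 mulnDr [(n.+1 * n)%N]mulnC muln2.
  by rewrite halfD doubleK odd_double andbF add0n.
move=> j _; rewrite sum1dep_card.
have wI : injective (@widen_ord _ _ (ltn_ord j)).
  by move=> x y /(congr1 val) /= xy; apply: val_inj.
rewrite -[RHS]card_ord -(card_imset _ wI).
apply: eq_card => i; rewrite !inE; apply/idP/imsetP => [ij|[k _ ->]] /=.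
  by exists (Ordinal (ij : (i < j.+1)%N)) => //; apply: val_inj.
by rewrite -ltnS.
Qed.

Section KKT.
(* [s] is a square root of 2: the same formulas are used over R and over R[i]. *)
Variables (K : fieldType) (s : K) (n m : nat).

Definition svec (X : 'M[K]_n) : 'cV[K]_(tau n) :=
  \col_k let ij := enum_val k in
         (if ij.1 == ij.2 then 1 else s) * X ij.1 ij.2.

(* The symmetric matrix whose svec is the k-th unit vector, see [svec_basisE]. *)
Definition svec_basis (k : 'I_(tau n)) : 'M[K]_n :=
  let ij := enum_val k in
  if ij.1 == ij.2 then delta_mx ij.1 ij.1
  else s^-1 *: (delta_mx ij.1 ij.2 + delta_mx ij.2 ij.1).

(* Symmetric Kronecker product, written column by column; [skronP] below is its
   usual definition. *)
Definition skron (A B : 'M[K]_n) : 'M[K]_(tau n) :=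
  \matrix_(r, k)
    (2^-1 *: svec (A *m svec_basis k *m B^T + B *m svec_basis k *m A^T)) r 0.

Definition Atilde (D : sdp_data K n m) : 'M[K]_(m, tau n) :=
  \matrix_(i, k) svec (dA D i) k 0.

Definition kktF (D : sdp_data K n m) (X : 'M[K]_n) (y : 'cV[K]_m) (Z : 'M[K]_n) :
    'cV[K]_(m + (tau n + tau n)) :=
  col_mx (Atilde D *m svec X - db D)
    (col_mx ((Atilde D)^T *m y + svec Z - svec (dC D))
            (2^-1 *: svec (X *m Z + Z *m X))).

Definition kktJ (D : sdp_data K n m) (X Z : 'M[K]_n) :
    'M[K]_(m + (tau n + tau n), tau n + (m + tau n)) :=
  col_mx (row_mx (Atilde D) (row_mx 0 0))
    (col_mx (row_mx 0 (row_mx (Atilde D)^T 1%:M))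
            (row_mx (skron Z 1%:M) (row_mx 0 (skron 1%:M X)))).

(* The cast only identifies the equal numbers of rows and columns. *)
Definition singular_point (D : sdp_data K n m) (X Z : 'M[K]_n) : Prop :=
  ~~ (castmx (erefl _, addnCA (tau n) m (tau n)) (kktJ D X Z) \in unitmx).

Definition kkt_solutions (D : sdp_data K n m) :
    set ('M[K]_n * 'cV[K]_m * 'M[K]_n) :=
  [set p | [/\ symm p.1.1, symm p.2 & kktF D p.1.1 p.1.2 p.2 = 0]].

Lemma svec_basisE (H : 'M[K]_n) : s != 0 -> symm H ->
  H = \sum_k svec H k 0 *: svec_basis k.
Proof.
move=> s0 HT; have Hs i j : H i j = H j i by rewrite -{1}HT mxE.
apply/matrixP => a b; rewrite summxE.
pose G (p : 'I_n * 'I_n) : K :=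
  (if p.1 == p.2 then 1 else s) * H p.1 p.2 *
  (if p.1 == p.2 then delta_mx p.1 p.1
   else s^-1 *: (delta_mx p.1 p.2 + delta_mx p.2 p.1)) a b.
rewrite (eq_bigr (fun k => G (enum_val k))); last by move=> k _; rewrite !mxE.
rewrite -(big_enum_val G) /=.
have G0 p : p != (a, b) -> p != (b, a) -> G p = 0.
  case: p => i j; rewrite !xpair_eqE /G /= => N1 N2.
  case: (eqVneq i j) N1 N2 => [<-|ij] N1 N2; rewrite !mxE.
    by rewrite ![a == _]eq_sym ![b == _]eq_sym (negPf N1) mulr0.
  rewrite [a == i]eq_sym [b == j]eq_sym [a == j]eq_sym [b == i]eq_sym.
  by rewrite (negPf N1) andbC (negPf N2) addr0 !mulr0.
have Gab i j : i != j -> (a, b) = (i, j) \/ (a, b) = (j, i) -> G (i, j) = H a b.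
  move=> ij ab; rewrite /G /= (negPf ij) !mxE.
  case: ab => -[-> ->]; rewrite !eqxx [j == i]eq_sym (negPf ij) /=.
    by rewrite addr0 mulr1 mulrAC divff ?mul1r.
  by rewrite add0r mulr1 mulrAC divff ?mul1r // Hs.
case: (ltngtP a b) => [ab|ba|/val_inj E].
- rewrite (bigD1 (a, b)) /=; last by rewrite inE /= ltnW.
  rewrite big1 ?addr0 => [|p /andP[]]; last first.
    rewrite inE => pu /G0; apply; apply: contraTneq pu => -> /=.
    by rewrite -ltnNge.
  by rewrite Gab //; [apply: contraTneq ab => ->; rewrite ltnn | left].
- rewrite (bigD1 (b, a)) /=; last by rewrite inE /= ltnW.
  rewrite big1 ?addr0 => [|p /andP[]]; last first.
    rewrite inE => pu pba; apply: G0 => //; apply: contraTneq pu => -> /=.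
    by rewrite -ltnNge.
  by rewrite Gab //; [apply: contraTneq ba => ->; rewrite ltnn | right].
- subst b; rewrite (bigD1 (a, a)) /=; last by rewrite inE /=.
  rewrite big1 ?addr0 => [|p /andP[_ pa]].
    by rewrite /G /= eqxx !mxE !eqxx mul1r mulr1.
  by apply: G0.
Qed.

Lemma skronP (A B H : 'M[K]_n) : s != 0 -> symm H ->
  skron A B *m svec H = 2^-1 *: svec (A *m H *m B^T + B *m H *m A^T).
Proof.
move=> s0 HT; have svecD (c : 'I_(tau n) -> K) M :
    svec (\sum_k c k *: M k) = \sum_k c k *: svec (M k).
  apply/colP => r; rewrite summxE !mxE /= summxE mulr_sumr.
  by apply: eq_bigr => k _; rewrite !mxE mulrCA.
have -> : A *m H *m B^T + B *m H *m A^T = \sum_k svec H k 0 *: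
    (A *m svec_basis k *m B^T + B *m svec_basis k *m A^T).
  rewrite {1 2}(svec_basisE s0 HT) !mulmx_sumr !mulmx_suml -big_split /=.
  by apply: eq_bigr => k _; rewrite scalerDr -!scalemxAr -!scalemxAl.
rewrite svecD scaler_sumr; apply/colP => r; rewrite mxE summxE.
apply: eq_bigr => k _.
rewrite scalerA mulrC [2^-1 * _]mulrC -scalerA [RHS]mxE; congr (_ * _).
by rewrite [LHS]mxE.
Qed.

End KKT.

Section Sdp.
Variables (R : realType) (n m : nat).
Implicit Types (D : sdp_data R n m) (d : R -> sdp_data R n m).

Definition psd (X : 'M[R]_n) : Prop :=
  symm X /\ forall v : 'cV[R]_n, 0 <= (v^T *m X *m v) 0 0.

Definition pd (X : 'M[R]_n) : Prop :=
  symm X /\ forall v : 'cV[R]_n, v != 0 -> 0 < (v^T *m X *m v) 0 0.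

Definition primal_feasible D (X : 'M[R]_n) : Prop := opA D X = db D /\ psd X.

Definition dual_feasible D (y : 'cV[R]_m) (Z : 'M[R]_n) : Prop :=
  adjA D y + Z = dC D /\ psd Z.

Definition primal_strictly_feasible D : Prop :=
  exists X, pd X /\ opA D X = db D.

Definition dual_strictly_feasible D : Prop :=
  exists y Z, pd Z /\ adjA D y + Z = dC D.

Definition Pstar d (t : R) : set 'M[R]_n :=
  [set X | primal_feasible (d t) X /\
    forall X', primal_feasible (d t) X' ->
      inner (dC (d t)) X <= inner (dC (d t)) X'].

Definition Dstar d (t : R) : set 'M[R]_n :=
  [set Z | exists y, dual_feasible (d t) y Z /\
    forall y' Z', dual_feasible (d t) y' Z' ->
      dotv (db (d t)) y' <= dotv (db (d t)) y].

Definition licq D : Prop := free [seq dA D i | i : 'I_m].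

(* Euclidean norm of vectors, Frobenius norm (induced by [inner]) of matrices. *)
Definition enorm (p q : nat) (M : 'M[R]_(p, q)) : R :=
  Num.sqrt (\tr (M^T *m M)).

(* Operator norms of A and of its pseudo-inverse at most M. *)
Definition op_norms_le (M : R) D : Prop :=
  (forall X, symm X -> enorm (opA D X) <= M * enorm X) /\
  (forall v, enorm (pinvA D v) <= M * enorm v).

Definition data_continuous_at d (t : R) : Prop :=
  [/\ forall i, {for t, continuous (fun u => dA (d u) i)},
      {for t, continuous (fun u => db (d u))} &
      {for t, continuous (fun u => dC (d u))}].

Definition poly_on (T : set R) (p q : nat) (f : R -> 'M[R]_(p, q)) : Prop :=
  forall i j, exists P : {poly R}, forall t, T t -> f t i j = P.[t].

Definition data_polynomial (T : set R) d : Prop :=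
  [/\ forall i, poly_on T (fun t => dA (d t) i),
      poly_on T (fun t => db (d t)) & poly_on T (fun t => dC (d t))].

Definition sqrt2 : R := Num.sqrt 2.

Definition singular_time d (t : R) : Prop :=
  exists X y Z, kkt_solutions sqrt2 (d t) (X, y, Z) /\
    singular_point sqrt2 (d t) X Z.

(* The KKT system over the complex numbers; distinct solutions are counted. *)
Definition complex_solutions D : set ('M[R[i]]_n * 'cV[R[i]]_m * 'M[R[i]]_n) :=
  kkt_solutions (real_complex R sqrt2) (map_data (real_complex R) D).

(* svec coordinates on the space (S^n)^m x R^m x S^n of data tuples. *)
Definition data_dim : nat := (m * tau n + (m + tau n))%N.

Definition data_coords D (k : 'I_data_dim) : R :=
  row_mx (mxvec (Atilde sqrt2 D)) (row_mx (db D)^T (svec sqrt2 (dC D))^T) 0 k.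

(* U is the complement, in the space of data tuples, of the common zero set of
   the polynomials in S. *)
Definition zariski_open (U : set (sdp_data R n m)) : Prop :=
  exists S : set (mpoly.mpoly data_dim R),
    U = [set D | sym_data D /\
                 exists2 p, S p & mpoly.meval (data_coords D) p != 0].

Definition generic_number (N : nat) : Prop :=
  exists U, [/\ zariski_open U, U !=set0 &
    forall D, U D -> (complex_solutions D #= `I_N)%card].

Definition generic_nonsingular_time d (t : R) : Prop :=
  ~ singular_time d t /\
  exists2 N, generic_number N & (complex_solutions (d t) #= `I_N)%card.

End Sdp.

Section SetValuedMaps.
Variables (R : realType) (V : normedModType R).
(* T is the (open) domain of F; the values of F outside T are irrelevant. *)
Variables (T : set R) (F : R -> set V).

Definition single_valued_at (t : R) : Prop := exists x, F t = [set x].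

Definition multi_valued_at (t : R) : Prop :=
  exists x y, [/\ F t x, F t y & x != y].

Definition inner_semicontinuous_at (t : R) : Prop :=
  forall x, F t x -> forall u : nat -> R, (forall k, T (u k)) ->
    u @ \oo --> t ->
    exists x_ : nat -> V, (forall k, F (u k) (x_ k)) /\ x_ @ \oo --> x.

Definition outer_semicontinuous_at (t : R) : Prop :=
  forall (x : V) (u : nat -> R) (x_ : nat -> V), (forall k, T (u k)) ->
    u @ \oo --> t -> (forall k, F (u k) (x_ k)) -> x_ @ \oo --> x -> F t x.

Definition pk_continuous_at (t : R) : Prop :=
  inner_semicontinuous_at t /\ outer_semicontinuous_at t.

(* F coincides near t with a function differentiable (resp. C^1). *)
Definition differentiable_at (t : R) : Prop :=
  exists f : R -> V, (\forall u \near t, F u = [set f u]) /\ derivable f t 1.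

Definition continuously_differentiable_at (t : R) : Prop :=
  exists f : R -> V, \forall u \near t,
    [/\ F u = [set f u], derivable f u 1 & {for u, continuous (derive1 f)}].

Definition sv_continuous_on (A : set R) : Prop :=
  forall t, A t -> [/\ T t, single_valued_at t & pk_continuous_at t].

Definition regular_point (x : V) (t : R) : Prop :=
  [/\ T t, F t = [set x],
      exists2 e, 0 < e & sv_continuous_on `]t - e, t + e[ &
      differentiable_at t].

Definition nondifferentiable_point (x : V) (t : R) : Prop :=
  [/\ T t, F t = [set x],
      exists2 e, 0 < e & sv_continuous_on `]t - e, t + e[ &
      ~ differentiable_at t].

Definition discontinuous_isolated_multiple_point (x : V) (t : R) : Prop :=
  [/\ T t, F t x,
      exists2 e, 0 < e & sv_continuous_on (`]t - e, t[ `|` `]t, t + e[) &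
      multi_valued_at t].

Definition irregular_point (x : V) (t : R) : Prop :=
  nondifferentiable_point x t \/ discontinuous_isolated_multiple_point x t.

End SetValuedMaps.

Definition open_interval (R : realType) (a b : \bar R) : set R :=
  [set t | (a < t%:E)%E /\ (t%:E < b)%E].

(* Main.v *)
(** Put Z = C(t) - A*(t)y. The KKT conditions of the perturbed data d(t) + s E become a
    square system of quadratic equations F(t, s, z) = 0 in z = (X, y); E is chosen such that
    d(t0) + E is generic, where t0 is the generic non-singular time. At (t0, 0) the complex
    system has exactly as many zeros as for generic (t, s). By a minimum modulus principle
    every zero at (t0, 0) persists nearby, so near (t0, 0) there is no room for further zeros
    and all of them stay bounded. Quantifier elimination spreads two consequences to all times
    off a finite set: limits of zeros as s -> 0+ satisfy nontrivial equations P_i(t, z_i) = 0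
    in each coordinate, and no complex line of zeros passes through such a limit.

    Under strict feasibility the KKT points of d(t) + s E exist for small s and converge to
    KKT points of d(t) as s -> 0+. Two primal or two dual optimal solutions at t would span a
    line of zeros through the limit, so off a finite set the KKT point is unique; its
    coordinates are continuous algebraic functions of t, hence C^1 off a finite set by the
    implicit function theorem. The same compactness gives outer semicontinuity everywhere
    and inner semicontinuity wherever the solution is unique, and the exceptional times are
    isolated. *)
From HB Require Import structures.
Require Import Defs.
From mathcomp Require Import all_boot all_order all_algebra all_field.
From mathcomp Require Import all_classical all_reals all_analysis.
From mathcomp Require Import complex ring lra.
From mathcomp Require mpoly.

Set Implicit Arguments.
Unset Strict Implicit.
Unset Printing Implicit Defensive.

Import Order.TTheory GRing.Theory Num.Theory.
Import numFieldNormedType.Exports.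

Local Open Scope classical_set_scope.
Local Open Scope ring_scope.

(** * Definable sets over an algebraically closed field *)

Section Definable.
Variable F : closedFieldType.
Implicit Types (e : seq F) (f g : seq F -> F) (S : seq F -> Prop).

(** The curve t -> d(t) may lie entirely outside the Zariski-open set of generic data, since
    genericity of t0 only fixes the number of zeros there; hence the second parameter s, which
    leaves the curve towards generic data. Zeros are counted as points, without multiplicity, so
    their persistence cannot be read off a polynomial identity; the minimum modulus principle only
    asks that F(t0, 0, .) have no zero on a small sphere around each of them. Being a limit of zeros
    as s -> 0+ is not a first-order property of t; it is replaced by the relations P_i, obtained
    after division by the largest power of s, which still bound the candidates. The other properties
    are first-order over the closed field R[i], where a definable set of times is finite or
    cofinite, and times tending to t0 rule out the wrong alternative. Compactness is used along
    ultrafilters on nat, where bounded sequences converge without extraction of subsequences; a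
    filter is recovered from the ultrafilters that refine it. *)

Definition polyfun f : Prop :=
  exists2 t : GRing.term F, GRing.rterm t & forall e, GRing.eval e t = f e.

(** An environment lists the parameters first and stores bound variables at later positions.
    Quantifiers are allowed here and eliminated only in [definable_qf]. *)
Definition definable S : Prop :=
  exists f : GRing.formula F, forall e, GRing.holds e f <-> S e.

Lemma polyfun_ext f g : f =1 g -> polyfun f -> polyfun g.
Proof. by move=> fg [t rt tE]; exists t => // e; rewrite tE fg. Qed.

Lemma polyfun_cst c : polyfun (fun=> c).
Proof. by exists (GRing.Const c). Qed.

Lemma polyfun_var i : polyfun (fun e => e`_i).
Proof. by exists (GRing.Var F i). Qed.

Lemma polyfunD f g : polyfun f -> polyfun g -> polyfun (fun e => f e + g e).
Proof.
move=> [t rt tE] [u ru uE]; exists (GRing.Add t u); first by rewrite /= rt.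
by move=> e /=; rewrite tE uE.
Qed.

Lemma polyfunM f g : polyfun f -> polyfun g -> polyfun (fun e => f e * g e).
Proof.
move=> [t rt tE] [u ru uE]; exists (GRing.Mul t u); first by rewrite /= rt.
by move=> e /=; rewrite tE uE.
Qed.

Lemma polyfunN f : polyfun f -> polyfun (fun e => - f e).
Proof. by move=> [t rt tE]; exists (GRing.Opp t) => // e /=; rewrite tE. Qed.

Lemma polyfunB f g : polyfun f -> polyfun g -> polyfun (fun e => f e - g e).
Proof. by move=> pf pg; apply/polyfunD/polyfunN. Qed.

Lemma polyfun_sum (I : Type) (r : seq I) (h : I -> seq F -> F) :
  (forall i, polyfun (h i)) -> polyfun (fun e => \sum_(i <- r) h i e).
Proof.
move=> hP; elim: r => [|i r IH].
  by apply: polyfun_ext (polyfun_cst 0) => e; rewrite big_nil.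
by apply: polyfun_ext (polyfunD (hP i) IH) => e; rewrite big_cons.
Qed.

Lemma polyfun_horner (p : {poly F}) f : polyfun f -> polyfun (fun e => p.[f e]).
Proof.
move=> pf; elim/poly_ind: p => [|p c IH].
  by apply: polyfun_ext (polyfun_cst 0) => e; rewrite horner0.
apply: polyfun_ext (polyfunD (polyfunM IH pf) (polyfun_cst c)) => e.
by rewrite hornerMXaddC.
Qed.

Lemma definable_ext S S' : (forall e, S e <-> S' e) -> definable S -> definable S'.
Proof. by move=> SS' [f fP]; exists f => e; move: (fP e) (SS' e); tauto. Qed.

Lemma definable_eq0 f : polyfun f -> definable (fun e => f e = 0).
Proof. by move=> [t _ tE]; exists (GRing.Equal t (GRing.Const 0)) => e /=; rewrite tE. Qed.

Lemma definable_and S S' :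
  definable S -> definable S' -> definable (fun e => S e /\ S' e).
Proof. by move=> [f fP] [g gP]; exists (GRing.And f g) => e /=; move: (fP e) (gP e); tauto. Qed.

Lemma definable_not S : definable S -> definable (fun e => ~ S e).
Proof. by move=> [f fP]; exists (GRing.Not f) => e /=; move: (fP e); tauto. Qed.

Lemma definable_ex i S :
  definable S -> definable (fun e => exists x, S (set_nth 0 e i x)).
Proof.
move=> [f fP]; exists (GRing.Exists i f) => e /=.
by split=> -[x /fP fx]; exists x.
Qed.

Lemma definable_all i S :
  definable S -> definable (fun e => forall x, S (set_nth 0 e i x)).
Proof.
move=> [f fP]; exists (GRing.Forall i f) => e /=.
by split=> Sx x; [apply/fP/Sx | apply/fP/Sx].
Qed.

Lemma definable_cst (P : Prop) : definable (fun=> P).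
Proof. by have [HP|HP] := pselect P; [exists (GRing.Bool true) | exists (GRing.Bool false)]. Qed.

Lemma definable_bigand (I : finType) (S : I -> seq F -> Prop) :
  (forall i, definable (S i)) -> definable (fun e => forall i, S i e).
Proof.
move=> SP.
suff : definable (fun e => forall i, i \in enum I -> S i e).
  by apply: definable_ext => e; split=> [H i|H i _ //]; apply: H; rewrite mem_enum.
elim: (enum I) => [|i r IH].
  by apply: definable_ext (definable_cst True).
apply: definable_ext (definable_and (SP i) IH) => e; split=> [[Si Sr] j|H].
  by rewrite in_cons => /orP[/eqP->|/Sr].
by split=> [|j jr]; apply: H; rewrite in_cons ?eqxx ?jr ?orbT.
Qed.

Lemma definable_bigor (I : finType) (S : I -> seq F -> Prop) :
  (forall i, definable (S i)) -> definable (fun e => exists i, S i e).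
Proof.
move=> SP; apply: definable_ext (definable_not (definable_bigand (fun i => definable_not (SP i)))).
move=> e; split=> [nS|[i Si] nS]; last exact: nS i Si.
by apply: contrapT => n; apply: nS => i Si; apply: n; exists i.
Qed.

Definition env_row (b p : nat) e : 'rV[F]_p := \row_(j < p) e`_(b + j).

Fixpoint set_block e (b p : nat) (w : nat -> F) : seq F :=
  if p is p'.+1 then set_nth 0 (set_block e b p' w) (b + p') (w p') else e.

Lemma nth_set_block e b p w i :
  (set_block e b p w)`_i = if (b <= i < b + p)%N then w (i - b)%N else e`_i.
Proof.
elim: p => [|p IH] /=; first by rewrite addn0 ltnNge andbN.
rewrite nth_set_nth /= IH addnS ltnS.
case: (eqVneq i (b + p)%N) => [->|ne].
  by rewrite leq_addr leqnn addKn.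
by rewrite [(i <= _)%N]leq_eqVlt (negPf ne).
Qed.

Lemma env_row_set_block e b p (z : 'rV[F]_p) :
  env_row b p (set_block e b p (fun j => if insub j is Some k then z 0 k else 0)) = z.
Proof.
apply/rowP => j; rewrite mxE nth_set_block leq_addr ltn_add2l ltn_ord /= addKn.
by rewrite insubT // => jp; congr (z 0 _); apply: val_inj.
Qed.

Lemma env_row_set_nth e b p i x : (i < b)%N || (b + p <= i)%N ->
  env_row b p (set_nth 0 e i x) = env_row b p e.
Proof.
move=> ib; apply/rowP => j; rewrite !mxE nth_set_nth /=.
case: eqP => // E; move: ib; rewrite -E ltnNge leq_addr /=.
by rewrite leq_add2l leqNgt ltn_ord.
Qed.

(** A vector quantifier becomes [p] scalar ones over the positions [b], ..., [b + p - 1]. The first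
    hypothesis says that [S] reads the environment only below [b], so overwriting these positions
    leaves its parameters alone. *)
Lemma definable_exrow (b p : nat) (S : seq F -> 'rV[F]_p -> Prop) :
  (forall e e' z, (forall i, (i < b)%N -> e`_i = e'`_i) -> S e z -> S e' z) ->
  definable (fun e => S e (env_row b p e)) ->
  definable (fun e => exists z, S e z).
Proof.
move=> Sb Sdef.
have H (q : nat) (S' : seq F -> Prop) : definable S' ->
    definable (fun e => exists w, S' (set_block e b q w)).
  elim: q S' => [|q IH] S' S'def /=.
    apply: definable_ext S'def => e; split=> [Se|[_]//].
    by exists (fun=> 0).
  apply: definable_ext (IH _ (definable_ex (b + q)%N S'def)) => e.
  split=> [[w [x Sx]]|[w Sw]]; last by exists w, (w q).
  exists (fun j => if j == q then x else w j); rewrite eqxx.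
  suff H k : (k <= q)%N -> set_block e b k (fun j => if j == q then x else w j)
      = set_block e b k w by rewrite H.
  elim: k => //= k IHk kq; rewrite IHk 1?ltnW //.
  by rewrite (ltn_eqF kq).
apply: definable_ext (H p _ Sdef) => e; split=> [[w Sw]|[z Sz]].
  exists (env_row b p (set_block e b p w)); apply: Sb Sw => i ib.
  by rewrite nth_set_block leqNgt ib.
exists (fun j => if insub j is Some k then z 0 k else 0).
rewrite env_row_set_block; apply: Sb Sz => i ib.
by rewrite nth_set_block leqNgt ib.
Qed.

(** Algebraic closedness enters here: after quantifier elimination, membership is a boolean
    combination of polynomial equations. *)
Lemma definable_qf S : definable S -> exists f : GRing.formula F,
  GRing.qf_form f && GRing.rformula f /\ forall e, GRing.qf_eval e f <-> S e.
Proof.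
move=> [f fP]; pose g := GRing.to_rform f.
have gr : GRing.rformula g := GRing.to_rform_rformula f.
exists (GRing.quantifier_elim (@ClosedFieldQE.ex_elim F) g); split.
  exact: GRing.quantifier_elim_wf (@ClosedFieldQE.wf_ex_elim F) _ gr.
move=> e; apply: iff_trans (fP e); apply: iff_trans (GRing.to_rformP e f).
apply: iff_sym; apply: rwP; apply: GRing.quantifier_elim_rformP gr.
  exact: ClosedFieldQE.wf_ex_elim.
exact: ClosedFieldQE.holds_ex_elim (@solve_monicpoly F).
Qed.

End Definable.

(** * Truth of quantifier-free formulas at a generic point *)

Section Interpretation.
Variables (F : closedFieldType) (B : idomainType) (c : {rmorphism F -> B}).

(** Terms satisfying [rterm] contain no inverse, so the value 0 given to [Inv] is only a
    placeholder, and such a term makes sense in any polynomial ring that receives the constants. *)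
Fixpoint term_in (v : seq B) (t : GRing.term F) : B :=
  match t with
  | GRing.Var i => v`_i
  | GRing.Const x => c x
  | GRing.NatConst n => n%:R
  | GRing.Add t1 t2 => term_in v t1 + term_in v t2
  | GRing.Opp t1 => - term_in v t1
  | GRing.NatMul t1 n => term_in v t1 *+ n
  | GRing.Mul t1 t2 => term_in v t1 * term_in v t2
  | GRing.Inv _ => 0
  | GRing.Exp t1 n => term_in v t1 ^+ n
  end.

Lemma rmorph_term_in (h : {rmorphism B -> F}) v t : (forall x, h (c x) = x) ->
  GRing.rterm t -> h (term_in v t) = GRing.eval (map h v) t.
Proof.
move=> hc; elim: t => //=.
- move=> i _; have [iv|vi] := ltnP i (size v); first by rewrite (nth_map 0).
  by rewrite !nth_default ?size_map // rmorph0.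
- by move=> n _; rewrite rmorph_nat.
- by move=> t1 IH1 t2 IH2 /andP[r1 r2]; rewrite rmorphD IH1 // IH2.
- by move=> t1 IH1 r1; rewrite rmorphN IH1.
- by move=> t1 IH1 n r1; rewrite rmorphMn /= IH1.
- by move=> t1 IH1 t2 IH2 /andP[r1 r2]; rewrite rmorphM IH1 // IH2.
- by move=> t1 IH1 n r1; rewrite rmorphXn /= IH1.
Qed.

(* The truth value at the generic point of [B] is also the truth value at every
   specialization outside the zero locus of [q]. *)
Lemma qf_eval_generic (v : seq B) (f : GRing.formula F) :
  GRing.qf_form f && GRing.rformula f ->
  exists q : B, exists b : bool, q != 0 /\ forall h : {rmorphism B -> F},
    (forall x, h (c x) = x) -> h q != 0 -> GRing.qf_eval (map h v) f = b.
Proof.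
elim: f => //=.
- by move=> b _; exists 1, b; rewrite oner_neq0.
- move=> t1 t2 /andP[r1 r2].
  have [E|ne] := eqVneq (term_in v t1 - term_in v t2) 0.
    exists 1, true; rewrite oner_neq0; split=> // h hc _.
    by rewrite -!rmorph_term_in // (subr0_eq E) eqxx.
  exists (term_in v t1 - term_in v t2), false; split=> // h hc.
  by rewrite rmorphB subr_eq0 !rmorph_term_in // => /negPf.
- move=> f1 IH1 f2 IH2 /andP[/andP[q1 q2] /andP[r1 r2]].
  have [|p1 [b1 [p1n P1]]] := IH1; first by rewrite q1.
  have [|p2 [b2 [p2n P2]]] := IH2; first by rewrite q2.
  exists (p1 * p2), (b1 && b2); rewrite mulf_neq0 //; split=> // h hc.
  by rewrite rmorphM mulf_eq0 negb_or => /andP[/(P1 _ hc)-> /(P2 _ hc)->].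
- move=> f1 IH1 f2 IH2 /andP[/andP[q1 q2] /andP[r1 r2]].
  have [|p1 [b1 [p1n P1]]] := IH1; first by rewrite q1.
  have [|p2 [b2 [p2n P2]]] := IH2; first by rewrite q2.
  exists (p1 * p2), (b1 || b2); rewrite mulf_neq0 //; split=> // h hc.
  by rewrite rmorphM mulf_eq0 negb_or => /andP[/(P1 _ hc)-> /(P2 _ hc)->].
- move=> f1 IH1 f2 IH2 /andP[/andP[q1 q2] /andP[r1 r2]].
  have [|p1 [b1 [p1n P1]]] := IH1; first by rewrite q1.
  have [|p2 [b2 [p2n P2]]] := IH2; first by rewrite q2.
  exists (p1 * p2), (b1 ==> b2); rewrite mulf_neq0 //; split=> // h hc.
  by rewrite rmorphM mulf_eq0 negb_or => /andP[/(P1 _ hc)-> /(P2 _ hc)->].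
- move=> f1 IH1 /IH1[p1 [b1 [p1n P1]]].
  by exists p1, (~~ b1); split=> // h hc /(P1 _ hc)->.
Qed.

End Interpretation.

(** * Roots of polynomials under specialization of the coefficients *)

Section Specialization.
Variables (F : closedFieldType) (A : idomainType) (c : {rmorphism F -> A}).

Let spec (h : {rmorphism A -> F}) (Q : {poly A}) : {poly F} := map_poly h Q.

(** Division over a domain is exact only up to a nonzero scalar; that scalar is the [q] that the
    specialization must not kill. *)
Lemma dvdp_spec (P Q : {poly A}) : P %| Q -> exists2 q : A, q != 0 &
  forall h : {rmorphism A -> F}, h q != 0 -> forall x,
    root (spec h P) x -> root (spec h Q) x.
Proof.
move=> /Pdiv.Idomain.dvdpP[[k r] /= k0 E]; exists k => // h hk x Px.
have : root (spec h (k *: Q)) x.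
  by rewrite E /spec rmorphM /= rootM Px orbT.
by rewrite /spec map_polyZ rootZ.
Qed.

(** Three scalars must survive: those of the two divisions by the gcd, and that of the Bezout
    relation, which turns a common root of [P] and [Q] into a root of the gcd. *)
Lemma gcdp_spec (P Q : {poly A}) : exists2 q : A, q != 0 &
  forall h : {rmorphism A -> F}, h q != 0 -> forall x,
    root (spec h (gcdp P Q)) x = root (spec h P) x && root (spec h Q) x.
Proof.
have [qP nP hP] := dvdp_spec (dvdp_gcdl P Q).
have [qQ nQ hQ] := dvdp_spec (dvdp_gcdr P Q).
have [[u v] /= /andP[/dvdp_spec[qG nG hG] _]] := Bezoutp P Q.
exists (qP * qQ * qG); first by rewrite !mulf_neq0.
move=> h; rewrite !rmorphM !mulf_eq0 !negb_or => /andP[/andP[h1 h2] h3] x.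
apply/idP/andP => [r|[rP rQ]]; first by split; [apply: hP | apply: hQ].
apply: hG => //; rewrite /spec rmorphD !rmorphM /= rootE hornerD !hornerM.
by rewrite (rootP rP) (rootP rQ) !mulr0 addr0.
Qed.

(** Dividing [P] by its gcd with [Q] lowers multiplicities, so it is repeated until the two are
    coprime; then the gcd is a constant, and where this constant survives no common root is left. *)
Lemma root_diff_spec (P Q : {poly A}) : P != 0 -> exists P' : {poly A}, exists q : A,
  [/\ P' != 0, q != 0 & forall h : {rmorphism A -> F}, h q != 0 -> forall x,
    root (spec h P') x = root (spec h P) x && ~~ root (spec h Q) x].
Proof.
have [k] := ubnP (size P); elim: k P => // k IH P; rewrite ltnS => sP P0.
have [q1 n1 h1] := gcdp_spec P Q.
have [cop|ncop] := boolP (coprimep P Q).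
  have [g gE] : exists g, gcdp P Q = g%:P.
    by exists (gcdp P Q)`_0; apply/size1_polyC; move: cop; rewrite /coprimep => /eqP->.
  have g0 : g != 0 by rewrite -(polyC_eq0 g) -gE gcdp_eq0 (negPf P0).
  exists P, (q1 * g); split=> //; first by rewrite mulf_neq0.
  move=> h; rewrite !rmorphM !mulf_eq0 !negb_or => /andP[hq1 hg] x.
  have := h1 h hq1 x; rewrite gE /spec map_polyC rootC (negPf hg).
  by move=> /esym /nandP[/negPf->|->] //; rewrite andbT.
have [[l r] /= l0 E] := Pdiv.Idomain.dvdpP _ _ (dvdp_gcdl P Q).
have lP0 : l *: P != 0 by rewrite scale_poly_eq0 negb_or l0.
have r0 : r != 0 by apply: contraNneq lP0 => r0; rewrite E r0 mul0r.
have g0 : gcdp P Q != 0 by rewrite gcdp_eq0 (negPf P0).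
have [|//|P' [q [P'0 q0 hP']]] := IH r.
  apply: leq_trans sP; rewrite -(size_scale P l0) E size_mul //.
  have : (1 < size (gcdp P Q))%N.
    rewrite ltn_neqAle lt0n size_poly_eq0 g0 andbT eq_sym.
    by move: ncop; rewrite /coprimep.
  by case: (size (gcdp P Q)) => [|[|j]] // _; rewrite !addnS /= ltnS leq_addr.
exists P', (q * q1 * l); split; rewrite ?mulf_neq0 // => h.
rewrite !rmorphM !mulf_eq0 !negb_or => /andP[/andP[hq hq1] hl] x; rewrite hP' //.
have -> : root (spec h P) x = root (spec h r) x || root (spec h (gcdp P Q)) x.
  have <- : root (spec h (l *: P)) x = root (spec h P) x by rewrite /spec map_polyZ rootZ.
  by rewrite E /spec rmorphM /= rootM.
by rewrite h1 //; case: (root (spec h r) x) => //=; case: (root _ x); case: (root _ x).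
Qed.

Lemma specX (h : {rmorphism A -> F}) (Q : {poly A}) x :
  (horner_eval x \o map_poly h) Q = (spec h Q).[x].
Proof. by []. Qed.

(** Each connective has an operation on polynomials: a gcd with [Q] for an equation, a product for a
    disjunction, [root_diff_spec] for a negation. [Q] stays general in the induction because a
    conjunction filters the roots twice. *)
Lemma cell_spec (v : seq A) (f : GRing.formula F) (Q : {poly A}) :
  GRing.qf_form f && GRing.rformula f -> Q != 0 ->
  exists Q' : {poly A}, exists q : A,
  [/\ Q' != 0, q != 0 & forall h : {rmorphism A -> F},
    (forall x, h (c x) = x) -> h q != 0 -> forall x,
    root (spec h Q') x = root (spec h Q) x && GRing.qf_eval (rcons (map h v) x) f].
Proof.
elim: f Q => //=.
- move=> b Q _ Q0; case: b; last first.
    exists 1, 1; rewrite !oner_neq0; split=> // h hc _ x.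
    by rewrite /spec rmorph1 andbF; apply/negbTE/root1.
  by exists Q, 1; rewrite oner_neq0; split=> // h hc _ x; rewrite andbT.
(* The last variable is interpreted by the indeterminate of [{poly A}], so the equation becomes a
   polynomial [P] in that variable, to be intersected with [Q]. *)
- move=> t1 t2 Q /andP[r1 r2] Q0.
  pose cP := (polyC \o c : {rmorphism F -> {poly A}}).
  pose vP := rcons (map polyC v) 'X.
  pose P := term_in cP vP t1 - term_in cP vP t2.
  have [q q0 hq] := gcdp_spec Q P.
  exists (gcdp Q P), q; split=> //; first by rewrite gcdp_eq0 (negPf Q0).
  move=> h hc hq0 x; rewrite hq //; congr (_ && _).
  rewrite rootE -specX rmorphB subr_eq0 !rmorph_term_in //.
  + suff -> : map (horner_eval x \o map_poly h) vP = rcons (map h v) x by [].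
    rewrite /vP map_rcons /= /horner_eval map_polyX hornerX -map_comp.
    by congr (rcons _ _); apply: eq_map => y /=; rewrite map_polyC hornerC.
  + by move=> y /=; rewrite /horner_eval /= map_polyC hornerC; exact: hc.
  + by move=> y /=; rewrite /horner_eval /= map_polyC hornerC; exact: hc.
- move=> f1 IH1 f2 IH2 Q /andP[/andP[q1 q2] /andP[r1 r2]] Q0.
  have [||Q1 [p1 [Q10 p10 P1]]] := IH1 Q; rewrite ?q1 //.
  have [||Q2 [p2 [Q20 p20 P2]]] := IH2 Q1; rewrite ?q2 //.
  exists Q2, (p1 * p2); rewrite mulf_neq0 //; split=> // h hc.
  rewrite rmorphM mulf_eq0 negb_or => /andP[h1 h2] x.
  by rewrite P2 // P1 // andbA.
- move=> f1 IH1 f2 IH2 Q /andP[/andP[q1 q2] /andP[r1 r2]] Q0.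
  have [||Q1 [p1 [Q10 p10 P1]]] := IH1 Q; rewrite ?q1 //.
  have [||Q2 [p2 [Q20 p20 P2]]] := IH2 Q; rewrite ?q2 //.
  exists (Q1 * Q2), (p1 * p2); rewrite !mulf_neq0 //; split=> // h hc.
  rewrite rmorphM mulf_eq0 negb_or => /andP[h1 h2] x.
  by rewrite /spec rmorphM rootM P1 // P2 // andb_orr.
- move=> f1 IH1 f2 IH2 Q /andP[/andP[q1 q2] /andP[r1 r2]] Q0.
  have [||Q1 [p1 [Q10 p10 P1]]] := IH1 Q; rewrite ?q1 //.
  have [||Q2 [p2 [Q20 p20 P2]]] := IH2 Q; rewrite ?q2 //.
  have [Q3 [p3 [Q30 p30 P3]]] := root_diff_spec Q1 Q0.
  exists (Q3 * Q2), (p1 * p2 * p3); rewrite !mulf_neq0 //; split=> // h hc.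
  rewrite !rmorphM !mulf_eq0 !negb_or => /andP[/andP[h1 h2] h3] x.
  rewrite /spec rmorphM rootM P3 // P1 // P2 //.
  by case: (root _ x) => //=; case: (GRing.qf_eval _ f1).
- move=> f1 IH1 Q qr Q0.
  have [||Q1 [p1 [Q10 p10 P1]]] := IH1 Q; rewrite ?q1 //.
  have [Q3 [p3 [Q30 p30 P3]]] := root_diff_spec Q1 Q0.
  exists Q3, (p1 * p3); rewrite !mulf_neq0 //; split=> // h hc.
  rewrite !rmorphM !mulf_eq0 !negb_or => /andP[h1 h3] x.
  by rewrite P3 // P1 //; case: (root _ x).
Qed.

End Specialization.

Lemma map_poly_lead_neq0 (A B : nzRingType) (h : {rmorphism A -> B}) (Q : {poly A}) :
  h (lead_coef Q) != 0 -> map_poly h Q != 0.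
Proof.
move=> hQ; apply: contraNneq hQ => E.
have := congr1 (fun p : {poly B} => p`_(size Q).-1) E.
by rewrite coef_map coef0 => /= E'; apply/eqP.
Qed.

(** If [H] vanishes when the inner variable is 0, every coefficient is divisible by that variable,
    and dividing lowers the size of the leading coefficient. With s as inner variable, the factor
    has no influence at s <> 0, while [H'] stays nonzero at s = 0, where limits will be taken. *)
Lemma factor_X (A : idomainType) (H : {poly {poly A}}) : H != 0 ->
  exists H' : {poly {poly A}}, exists k, H = 'X^k *: H' /\ map_poly (horner_eval 0) H' != 0.
Proof.
have [k] := ubnP (size (lead_coef H)); elim: k H => // k IH H; rewrite ltnS => sH H0.
have [E|ne] := eqVneq (map_poly (horner_eval 0) H) 0; last by exists H, 0; rewrite scale1r.
have c0 j : H`_j = drop_poly 1 H`_j * 'X.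
  rewrite -{1}(poly_take_drop 1 H`_j) expr1.
  suff -> : take_poly 1 H`_j = 0 by rewrite add0r.
  apply/polyP => i; rewrite coef_take_poly coef0; case: i => //=.
  have := congr1 (fun p : {poly A} => p`_j) E.
  by rewrite coef_map coef0 /= /horner_eval horner_coef0.
pose H1 := \poly_(j < size H) drop_poly 1 H`_j.
have HE : H = 'X *: H1.
  apply/polyP => j; rewrite coefZ coef_poly; case: ltnP => jH; last first.
    by rewrite mulr0 nth_default.
  by rewrite mulrC.
have H10 : H1 != 0 by apply: contraNneq H0 => H10; rewrite HE H10 scaler0.
have lH : lead_coef H = 'X * lead_coef H1.
  by rewrite HE lead_coefZ.
have [|//|H' [j [H1E H'0]]] := IH H1.
  apply: leq_trans sH; rewrite lH mulrC size_mulX ?lead_coef_eq0 //.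
by exists H', j.+1; split=> //; rewrite HE H1E scalerA exprS.
Qed.

(** * Definable sets over the plane of parameters (t, s) *)

Section Bivariate.
Variable F : closedFieldType.
Local Notation A := {poly {poly F}}.

(* The inner variable is t, the outer one is s. *)
Definition ev2 (t s : F) : A -> F := horner_eval t \o horner_eval s%:P.
HB.instance Definition _ t s := GRing.RMorphism.on (ev2 t s).

Lemma ev2E t s q : ev2 t s q = q.[s%:P].[t]. Proof. by []. Qed.

Lemma ev2_swap t s q : ev2 t s q = (map_poly (horner_eval t) q).[s].
Proof.
by rewrite ev2E -/(horner_eval t q.[s%:P]) -horner_map /= /horner_eval hornerC.
Qed.

Lemma ev2_ex (q : A) : q != 0 -> exists t, exists s, ev2 t s q != 0.
Proof.
move=> q0.
have l0 : lead_coef q != 0 by rewrite lead_coef_eq0.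
have [t qt] := closed_nonrootP _ l0.
have [s qs] := closed_nonrootP _ (map_poly_lead_neq0 (h := horner_eval t) qt).
by exists t, s; apply: contraNneq qs; rewrite ev2_swap rootE => <-.
Qed.

(** Truth is decided at the generic point of the plane. A property known at one point off each curve
    therefore holds off one fixed curve. *)
Lemma definable_generic2 S : definable S -> exists2 q : A, q != 0 &
  (forall t s, ev2 t s q != 0 -> S [:: t; s]) \/
  (forall t s, ev2 t s q != 0 -> ~ S [:: t; s]).
Proof.
move=> /definable_qf[f [fqf fS]].
have [q [b [q0 qb]]] := qf_eval_generic (polyC \o polyC : {rmorphism F -> A}) [:: 'X%:P; 'X] fqf.
exists q => //.
have H t s : ev2 t s q != 0 -> GRing.qf_eval [:: t; s] f = b.
  move=> qts; rewrite -(qb (ev2 t s)) //=.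
    by rewrite !ev2E !hornerE.
  by move=> x; rewrite ev2E !hornerE.
case: b H {qb} => H; [left|right] => t s /H E; first exact/fS.
by move/fS; rewrite E.
Qed.

Lemma definable_generic1 S : definable S -> exists2 q : {poly F}, q != 0 &
  (forall t, q.[t] != 0 -> S [:: t]) \/ (forall t, q.[t] != 0 -> ~ S [:: t]).
Proof.
move=> /definable_qf[f [fqf fS]].
have [q [b [q0 qb]]] := qf_eval_generic (polyC : {rmorphism F -> {poly F}}) [:: 'X] fqf.
exists q => //.
have H t : q.[t] != 0 -> GRing.qf_eval [:: t] f = b.
  move=> qt; rewrite -(qb (horner_eval t)) //=.
    by rewrite /horner_eval hornerX.
  by move=> x; rewrite /horner_eval hornerC.
case: b H {qb} => H; [left|right] => t /H E; first exact/fS.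
by move/fS; rewrite E.
Qed.

(** Quantifier elimination provides a [Q] off whose roots membership is constant; finiteness of the
    fibres makes that constant false, so the set is cut out of the roots of [Q] by [cell_spec]. *)
Lemma definable_finite_roots S (q0 : A) : definable S -> q0 != 0 ->
  (forall t s, ev2 t s q0 != 0 -> exists r : seq F, forall x, S [:: t; s; x] -> x \in r) ->
  exists H : {poly A}, exists q : A, [/\ map_poly (horner_eval 0) H != 0, q != 0 &
   forall t s, ev2 t s q != 0 -> forall x,
     S [:: t; s; x] <-> root (map_poly (ev2 t s) H) x].
Proof.
move=> /definable_qf[f [fqf fS]] q00 fin.
pose cA := (polyC \o polyC : {rmorphism F -> A}); pose v : seq A := [:: 'X%:P; 'X].
have ev2c t s x : ev2 t s (cA x) = x by rewrite ev2E !hornerE.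
have ev2v t s : map (ev2 t s) v = [:: t; s] by rewrite /= !ev2E !hornerE.
have [Q [b [Q0 Qb]]] := qf_eval_generic (polyC \o cA : {rmorphism F -> {poly A}})
  [:: 'X%:P%:P; 'X%:P; 'X] fqf.
have {}Qb t s x : ~~ root (map_poly (ev2 t s) Q) x -> GRing.qf_eval [:: t; s; x] f = b.
  move=> Qx; rewrite -(Qb (horner_eval x \o map_poly (ev2 t s))) //=.
    by rewrite /horner_eval !map_polyC map_polyX !hornerE /= !ev2E !hornerE.
  by move=> y; rewrite /= /horner_eval map_polyC hornerC; apply: ev2c.
have bF : b = false.
  case: b Qb => // Qb.
  have lq : lead_coef Q * q0 != 0 by rewrite mulf_neq0 // lead_coef_eq0.
  have [t [s]] := ev2_ex lq; rewrite rmorphM mulf_eq0 negb_or => /andP[lQ /fin[r rP]].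
  have Qts : map_poly (ev2 t s) Q != 0 by exact: map_poly_lead_neq0 lQ.
  have P0 : map_poly (ev2 t s) Q * \prod_(a <- r) ('X - a%:P) != 0.
    by rewrite mulf_neq0 // monic_neq0 // monic_prod_XsubC.
  have [x] := closed_nonrootP _ P0.
  rewrite rootM negb_or root_prod_XsubC => /andP[/Qb/fS/rP xr].
  by rewrite xr.
rewrite {}bF in Qb.
have [H [q [H0 q1 hH]]] := cell_spec cA v fqf Q0.
have [H' [k [HE H'0]]] := factor_X H0.
(* The factor ['X] of the exceptional polynomial forces s <> 0, so that dividing by a power of s
   does not change the roots. *)
exists H', (q * 'X); split=> //; first by rewrite mulf_neq0 // polyX_eq0.
move=> t s; rewrite rmorphM mulf_eq0 negb_or => /andP[qts sn] x.
have E : root (map_poly (ev2 t s) H') x = root (map_poly (ev2 t s) H) x.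
  rewrite HE map_polyZ rootZ // rmorphXn /= expf_neq0 //.
rewrite E; have := hH (ev2 t s) (ev2c t s) qts x.
rewrite (_ : rcons _ x = [:: t; s; x]); last exact: (congr1 (rcons^~ x) (ev2v t s)).
move=> ->; apply: iff_trans (iff_sym (fS _)) _.
split=> [fx|/andP[]//]; rewrite fx andbT.
by apply: contraTT fx => /Qb->.
Qed.

End Bivariate.

(** * Limits along ultrafilters *)

Section ComplexNorm.
Local Open Scope complex_scope.
Variable R : realType.
Local Notation C := R[i].
Implicit Types (x y : C).

(** The squared modulus, with values in [R]: the estimates become polynomial inequalities over [R],
    free of square roots. *)
Definition csq x : R := complex.Re x ^+ 2 + complex.Im x ^+ 2.

Lemma csq_ge0 x : 0 <= csq x.
Proof. by rewrite addr_ge0 ?sqr_ge0. Qed.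

Lemma csq_eq0 x : (csq x == 0) = (x == 0).
Proof.
by case: x => a b; rewrite /csq paddr_eq0 ?sqr_ge0 //= !sqrf_eq0 eq_complex.
Qed.

Lemma csq0 : csq 0 = 0.
Proof. by apply/eqP; rewrite csq_eq0. Qed.

Lemma csqM x y : csq (x * y) = csq x * csq y.
Proof. by case: x => a b; case: y => c d; rewrite /csq /=; ring. Qed.

Lemma csq_real (a : R) : csq a%:C = a ^+ 2.
Proof. by rewrite /csq /= expr0n addr0. Qed.

Lemma Re_mul x y : complex.Re (x * y) =
  complex.Re x * complex.Re y - complex.Im x * complex.Im y.
Proof. by case: x => a b; case: y. Qed.

Lemma Im_mul x y : complex.Im (x * y) =
  complex.Re x * complex.Im y + complex.Im x * complex.Re y.
Proof. by case: x => a b; case: y. Qed.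

Lemma Re_add x y : complex.Re (x + y) = complex.Re x + complex.Re y.
Proof. by case: x => a b; case: y. Qed.

Lemma Im_add x y : complex.Im (x + y) = complex.Im x + complex.Im y.
Proof. by case: x => a b; case: y. Qed.

Lemma Re_opp x : complex.Re (- x) = - complex.Re x. Proof. by case: x. Qed.
Lemma Im_opp x : complex.Im (- x) = - complex.Im x. Proof. by case: x. Qed.

Lemma csqN x : csq (- x) = csq x.
Proof. by rewrite /csq Re_opp Im_opp !sqrrN. Qed.

Lemma csqD_le x y : csq (x + y) <= 2 * csq x + 2 * csq y.
Proof.
case: x => a b; case: y => c d; rewrite /csq /=.
by have := sqr_ge0 (a - c); have := sqr_ge0 (b - d); nra.
Qed.

Lemma csq_parallelogram x y :
  csq (x + y) + csq (x - y) = 2 * csq x + 2 * csq y.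
Proof. by case: x => a b; case: y => c d; rewrite /csq /=; ring. Qed.

Lemma csq_i : csq ('i%C : C) = 1.
Proof. by rewrite /csq /= expr0n expr1n add0r. Qed.

(** Four times a mean over four points of the circle of radius [e]; on squared moduli of polynomials
    of degree at most 3 it agrees with the mean over the whole circle. *)
Definition sum4 (e : R) (f : C -> R) : R :=
  f e%:C + f (- e%:C) + (f (e%:C * 'i%C) + f (- (e%:C * 'i%C))).

(* The characters 1, z, z^2, z^3 are orthogonal on the fourth roots of unity. *)
Lemma csq_four_points (c0 c2 c3 : C) (e : R) :
  sum4 e (fun z => csq (c0 + z ^+ 2 * c2 + z ^+ 3 * c3)) =
  4 * csq c0 + 4 * e ^+ 4 * csq c2 + 4 * e ^+ 6 * csq c3.
Proof.
have par := csq_parallelogram.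
have i2 : 'i%C ^+ 2 = -1 :> C by exact: sqr_i.
have i3 : 'i%C ^+ 3 = - 'i%C :> C by rewrite exprS i2 mulrN1.
have N3 (z : C) : (- z) ^+ 3 = - z ^+ 3 by rewrite exprNn -signr_odd /= expr1 mulN1r.
set x := e%:C ^+ 2 * c2; set y := e%:C ^+ 3 * c3.
have x4 : csq x = e ^+ 4 * csq c2.
  by rewrite csqM -rmorphXn csq_real -exprM.
have y6 : csq y = e ^+ 6 * csq c3.
  by rewrite csqM -rmorphXn csq_real -exprM.
have yi : csq (y * 'i%C) = csq y by rewrite csqM csq_i mulr1.
rewrite /sum4 !sqrrN !N3 !exprMn i2 i3 !mulrN1 !mulNr -/x -/y.
rewrite !mulrN !mulNr !opprK [e%:C ^+ 3 * 'i%C * c3]mulrAC -/y.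
rewrite par [csq (c0 - x - _) + _]addrC par yi y6.
have := par c0 x; rewrite x4 => E.
by rewrite -!mulrA -addrACA -mulrDr E; ring.
Qed.

Lemma csq_four_points1 (c0 c1 : C) (e : R) :
  sum4 e (fun z => csq (c0 + z * c1)) =
  4 * csq c0 + 4 * e ^+ 2 * csq c1.
Proof.
rewrite /sum4 !mulNr !csq_parallelogram !csqM csq_i.
by rewrite csq_real; ring.
Qed.

Definition vsq (p : nat) (z : 'rV[C]_p) : R := \sum_i csq (z 0 i).

Lemma vsq_ge0 p (z : 'rV[C]_p) : 0 <= vsq z.
Proof. by apply: sumr_ge0 => i _; apply: csq_ge0. Qed.

Lemma vsq_eq0 p (z : 'rV[C]_p) : (vsq z == 0) = (z == 0).
Proof.
rewrite psumr_eq0 => [|i _]; last exact: csq_ge0.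
apply/allP/eqP => [z0|-> i _]; last by rewrite /= mxE csq_eq0.
by apply/rowP => i; rewrite mxE; apply/eqP; rewrite -csq_eq0; exact: z0 i (mem_index_enum i).
Qed.

Lemma vsq0 p : vsq (0 : 'rV[C]_p) = 0.
Proof. by apply/eqP; rewrite vsq_eq0. Qed.

Lemma vsq_gt0 p (z : 'rV[C]_p) : z != 0 -> 0 < vsq z.
Proof. by rewrite lt_def vsq_eq0 vsq_ge0 andbT. Qed.

Lemma csq_le_vsq p (z : 'rV[C]_p) i : csq (z 0 i) <= vsq z.
Proof.
rewrite /vsq (bigD1 i) //= lerDl; apply: sumr_ge0 => j _; exact: csq_ge0.
Qed.

Lemma vsqZ p a (z : 'rV[C]_p) : vsq (a *: z) = csq a * vsq z.
Proof. by rewrite /vsq mulr_sumr; apply: eq_bigr => i _; rewrite mxE csqM. Qed.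

Lemma vsqD_le p (x y : 'rV[C]_p) : vsq (x + y) <= 2 * vsq x + 2 * vsq y.
Proof.
rewrite /vsq !mulr_sumr -big_split; apply: ler_sum => i _.
by rewrite mxE csqD_le.
Qed.

Lemma vsqN p (x : 'rV[C]_p) : vsq (- x) = vsq x.
Proof. by apply: eq_bigr => i _; rewrite mxE csqN. Qed.

Lemma sum4_sum (J : finType) (e : R) (f : J -> C -> R) :
  sum4 e (fun z => \sum_j f j z) = \sum_j sum4 e (f j).
Proof. by rewrite /sum4 -!big_split. Qed.

Lemma vsq_four_points p (c0 c2 : 'rV[C]_p) (e : R) :
  sum4 e (fun z => vsq (c0 + z ^+ 2 *: c2)) =
  4 * vsq c0 + 4 * e ^+ 4 * vsq c2.
Proof.
rewrite /vsq sum4_sum !mulr_sumr -!big_split; apply: eq_bigr => i _ /=.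
have := csq_four_points (c0 0 i) (c2 0 i) 0 e.
rewrite csq0 mulr0 addr0 => <-.
have E z : (c0 + z *: c2) 0 i = c0 0 i + z * c2 0 i.
  by rewrite mxE [(z *: c2) _ _]mxE.
by congr (sum4 e _); apply/funext => z; rewrite E mulr0 addr0.
Qed.

Lemma vsq_four_points1 p (c0 c1 : 'rV[C]_p) (e : R) :
  sum4 e (fun z => vsq (c0 + z *: c1)) =
  4 * vsq c0 + 4 * e ^+ 2 * vsq c1.
Proof.
rewrite /vsq sum4_sum !mulr_sumr -!big_split; apply: eq_bigr => i _ /=.
have E z : (c0 + z *: c1) 0 i = c0 0 i + z * c1 0 i.
  by rewrite mxE [(z *: c1) _ _]mxE.
rewrite -csq_four_points1.
by congr (sum4 e _); apply/funext => z; rewrite E.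
Qed.

End ComplexNorm.

(** * Limits of complex numbers and vectors by real coordinates *)

Section Limits.
Variables (R : realType) (I : Type) (U : set_system I).
Local Notation C := R[i].

Definition ccvg (u : I -> C) (l : C) : Prop :=
  (fun j => complex.Re (u j)) @ U --> complex.Re l /\
  (fun j => complex.Im (u j)) @ U --> complex.Im l.

Definition vcvg p (u : I -> 'rV[C]_p) (l : 'rV[C]_p) : Prop :=
  forall i, ccvg (fun j => u j 0 i) (l 0 i).

Context {FU : ProperFilter U}.

Lemma ccvg_cst c : ccvg (fun=> c) c.
Proof. by split; apply: cvg_cst. Qed.

Lemma ccvgD u v a b : ccvg u a -> ccvg v b -> ccvg (fun j => u j + v j) (a + b).
Proof.
move=> [ua ua'] [vb vb']; split; rewrite ?Re_add ?Im_add.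
  by under eq_fun do rewrite Re_add; apply: cvgD.
by under eq_fun do rewrite Im_add; apply: cvgD.
Qed.

Lemma ccvgN u a : ccvg u a -> ccvg (fun j => - u j) (- a).
Proof.
move=> [ua ua']; split; rewrite ?Re_opp ?Im_opp.
  by under eq_fun do rewrite Re_opp; apply: cvgN.
by under eq_fun do rewrite Im_opp; apply: cvgN.
Qed.

Lemma ccvgM u v a b : ccvg u a -> ccvg v b -> ccvg (fun j => u j * v j) (a * b).
Proof.
move=> [ua ua'] [vb vb']; split; rewrite ?Re_mul ?Im_mul.
  by under eq_fun do rewrite Re_mul; apply: cvgB; apply: cvgM.
by under eq_fun do rewrite Im_mul; apply: cvgD; apply: cvgM.
Qed.

Lemma ccvg_sum (K : Type) (r : seq K) (u : K -> I -> C) (a : K -> C) :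
  (forall k, ccvg (u k) (a k)) ->
  ccvg (fun j => \sum_(k <- r) u k j) (\sum_(k <- r) a k).
Proof.
move=> ua; elim: r => [|k r IH].
  under [X in ccvg X]eq_fun do rewrite big_nil; rewrite big_nil; exact: ccvg_cst.
under [X in ccvg X]eq_fun do rewrite big_cons; rewrite big_cons; exact: ccvgD.
Qed.

Lemma ccvg_polyfun (f : seq C -> C) (e : I -> seq C) (l : seq C) :
  polyfun f -> (forall i, ccvg (fun j => (e j)`_i) l`_i) ->
  ccvg (fun j => f (e j)) (f l).
Proof.
move=> [t rt tE] el; rewrite -tE.
under [X in ccvg X]eq_fun do rewrite -tE.
elim: t rt {tE} => //=.
- by move=> x _; apply: ccvg_cst.
- by move=> x _; apply: ccvg_cst.
- by move=> t1 IH1 t2 IH2 /andP[r1 r2]; apply: ccvgD; [apply: IH1 | apply: IH2].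
- by move=> t1 IH1 r1; apply/ccvgN/IH1.
- move=> t1 IH1 n /IH1 H; elim: n => [|n IH].
    by under [X in ccvg X]eq_fun do rewrite mulr0n; apply: ccvg_cst.
  by under [X in ccvg X]eq_fun do rewrite mulrS; rewrite mulrS; apply: ccvgD.
- by move=> t1 IH1 t2 IH2 /andP[r1 r2]; apply: ccvgM; [apply: IH1 | apply: IH2].
- move=> t1 IH1 n /IH1 H; elim: n => [|n IH].
    by under [X in ccvg X]eq_fun do rewrite expr0; apply: ccvg_cst.
  by under [X in ccvg X]eq_fun do rewrite exprS; rewrite exprS; apply: ccvgM.
Qed.

Lemma cvg_csq u a : ccvg u a -> (fun j => csq (u j)) @ U --> csq a.
Proof.
have sqr_cvg (w : I -> R) (b : R) : w @ U --> b -> (fun j => w j ^+ 2) @ U --> b ^+ 2.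
  by move=> wb; rewrite expr2; under eq_fun do rewrite expr2; apply: cvgM.
by move=> [ua ua']; apply: cvgD; apply: sqr_cvg.
Qed.

Lemma cvg_vsq p (u : I -> 'rV[C]_p) a : vcvg u a ->
  (fun j => vsq (u j)) @ U --> vsq a.
Proof.
move=> ua; apply: cvg_big => [|i _]; last exact/cvg_csq/ua.
exact: add_continuous.
Qed.

Lemma vcvgB p (u v : I -> 'rV[C]_p) a b : vcvg u a -> vcvg v b ->
  vcvg (fun j => u j - v j) (a - b).
Proof.
move=> ua vb i; have E (x y : 'rV[C]_p) : (x - y) 0 i = x 0 i - y 0 i by rewrite !mxE.
have -> : (fun j => (u j - v j) 0 i) = (fun j => u j 0 i - v j 0 i).
  by apply/funext => j; exact: E.
by rewrite E; apply: ccvgD (ua i) (ccvgN (vb i)).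
Qed.

Lemma ccvg_unique u a b : ccvg u a -> ccvg u b -> a = b.
Proof.
move=> [ua ua'] [ub ub']; apply/eqP; rewrite eq_complex.
by rewrite (cvg_unique _ ua ub) // (cvg_unique _ ua' ub') ?eqxx.
Qed.

Lemma ccvg_near u v a : (\forall j \near U, u j = v j) -> ccvg v a -> ccvg u a.
Proof.
move=> uv [va va']; split.
  by apply: cvg_trans va; apply: near_eq_cvg; near=> j; rewrite (near uv j).
by apply: cvg_trans va'; apply: near_eq_cvg; near=> j; rewrite (near uv j).
Unshelve. all: by end_near.
Qed.

Lemma ccvg_eq0 u a : (\forall j \near U, u j = 0) -> ccvg u a -> a = 0.
Proof. by move=> u0 ua; apply: (ccvg_unique ua); apply: ccvg_near u0 (ccvg_cst 0). Qed.

End Limits.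

Section UltraLimits.
Local Open Scope complex_scope.
Variables (R : realType) (I : Type) (U : set_system I).
Context {UU : UltraFilter U}.
Local Notation C := R[i].

(** The compact segment provides a cluster point, and a cluster point of an ultrafilter is its
    limit, because each set or its complement belongs to the ultrafilter. *)
Lemma ultra_bounded_cvg (u : I -> R) (M : R) : (\forall j \near U, `|u j| <= M) ->
  exists l : R, u @ U --> l.
Proof.
move=> uM.
have /(_ (u @ U)) := @segment_compact R (- M) M.
case=> [|l [_ lc]].
  by apply: filterS uM => j; rewrite /= in_itv /= ler_norml.
exists l => A /= Al.
have [//|nA] := in_ultra_setVsetC (u @^-1` A) UU.
have [x [xA]] := lc (~` A) A nA Al.
by [].
Qed.

Lemma ultra_bounded_sqr_cvg (u : I -> R) (M : R) : (\forall j \near U, u j ^+ 2 <= M) ->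
  exists l : R, u @ U --> l.
Proof.
move=> uM; apply: (@ultra_bounded_cvg u (M + 1)); move: uM; apply: filterS => j.
by rewrite ler_norml; apply: contraTT; rewrite negb_and -!ltNge; case/orP; nra.
Qed.

Lemma ultra_bounded_ccvg (u : I -> C) (M : R) : (\forall j \near U, csq (u j) <= M) ->
  exists l, ccvg U u l.
Proof.
move=> uM.
have [|a ua] := @ultra_bounded_sqr_cvg (fun j => complex.Re (u j)) M.
  by apply: filterS uM => j; apply: le_trans; rewrite lerDl sqr_ge0.
have [|b ub] := @ultra_bounded_sqr_cvg (fun j => complex.Im (u j)) M.
  by apply: filterS uM => j; apply: le_trans; rewrite lerDr sqr_ge0.
by exists (a +i* b)%C.
Qed.

Lemma ultra_bounded_vcvg p (u : I -> 'rV[C]_p) (M : R) :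
  (\forall j \near U, vsq (u j) <= M) -> exists l, vcvg U u l.
Proof.
move=> uM.
have H i : exists l, ccvg U (fun j => u j 0 i) l.
  apply: (@ultra_bounded_ccvg _ M); apply: filterS uM => j; apply: le_trans.
  exact: csq_le_vsq.
have [f fP] := choice H.
by exists (\row_i f i) => i; rewrite mxE.
Qed.

End UltraLimits.

Lemma nat_ultrafilter : exists2 U : set_system nat, UltraFilter U & \oo `<=` U.
Proof. by have [U [UU sU]] := ultraFilterLemma eventually_filter; exists U. Qed.

Lemma ultra_harmonic (R : realType) (U : set_system nat) : \oo `<=` U ->
  (fun k => k.+1%:R^-1 : R) @ U --> (0 : R).
Proof. by move=> sU B hB; apply: sU; apply: (@cvg_harmonic R). Qed.

(** The extreme value theorem for a set that is sequentially compact along [U]. [lim] is abstract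
    because it serves for complex vectors, for pairs of a vector and a number, and for real
    matrices. *)
Lemma ultra_max (R : realType) (V : Type) (K : V -> Prop) (U : set_system nat)
    (lim : (nat -> V) -> V -> Prop) (f : V -> R) :
  UltraFilter U -> \oo `<=` U -> (exists v, K v) ->
  (forall u : nat -> V, (forall j, K (u j)) -> exists2 l, K l & lim u l) ->
  (forall u l, lim u l -> (fun j => f (u j)) @ U --> f l) ->
  exists2 v, K v & forall w, K w -> f w <= f v.
Proof.
move=> UU sU [v0 Kv0] Kc fc.
pose A := [set f v | v in [set v | K v]].
have A0 : A !=set0 by exists (f v0), v0.
have bA : has_ubound A.
  apply: contrapT => nb.
  have H (j : nat) : exists v, K v /\ j%:R <= f v.
    apply: contrapT => nj; apply: nb; exists j%:R => _ [v Kv <-].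
    by rewrite leNgt; apply/negP => /ltW jv; apply: nj; exists v.
  have [u uP] := choice H.
  have [l Kl /fc ul] := Kc u (fun j => proj1 (uP j)).
  have : \forall j \near U, f (u j) <= f l + 1.
    by apply: (cvgr_le _ ul); rewrite ltrDl.
  have : \forall j \near U, f l + 1 < j%:R.
    by apply: sU; exact: nbhs_infty_gtr.
  move=> H1 H2; have [j [h1 h2]] := filter_ex (filterI H1 H2).
  by have := proj2 (uP j); rewrite leNgt (le_lt_trans h2 h1).
have H (j : nat) : exists v, K v /\ sup A - j.+1%:R^-1 < f v.
  have [|_ [v Kv <-] lt] := @sup_adherent _ A j.+1%:R^-1 _ (conj A0 bA).
    by rewrite invr_gt0.
  by exists v.
have [u uP] := choice H.
have [l Kl /fc ul] := Kc u (fun j => proj1 (uP j)).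
exists l => // w Kw; apply: le_trans (_ : sup A <= _).
  by apply: ub_le_sup => //; exists w.
have c : (fun j : nat => sup A - j.+1%:R^-1) @ U --> sup A - 0.
  by apply: cvgB; [exact: cvg_cst | exact: ultra_harmonic].
rewrite subr0 in c.
by apply: (ler_cvg_to c ul); near=> j; apply/ltW; have [] := uP j.
Unshelve. all: by end_near.
Qed.

(** * A minimum modulus principle for quadratic maps *)

Section MinModulus.
Local Open Scope complex_scope.
Variables (R : realType) (p : nat).
Local Notation C := R[i].
Implicit Types (z v w : 'rV[C]_p).

(** Young's inequality with weight [e]: when [y] has size of order [e], the squared norm grows by a
    term of order [e] only, which keeps a small step inside an open ball. *)
Lemma csqD_eps (x y : C) (e : R) : 0 < e ->
  csq (x + y) <= (1 + e) * csq x + (1 + e^-1) * csq y.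
Proof.
case: x => a b; case: y => c d e0; rewrite /csq /=.
have H u t : (u + t) ^+ 2 <= (1 + e) * u ^+ 2 + (1 + e^-1) * t ^+ 2.
  have : 0 <= e * (u - e^-1 * t) ^+ 2 by rewrite mulr_ge0 ?sqr_ge0 // ltW.
  suff -> : e * (u - e^-1 * t) ^+ 2 = e * u ^+ 2 - 2 * u * t + e^-1 * t ^+ 2 by nra.
  by field; rewrite gt_eqF.
by rewrite !mulrDr addrACA lerD.
Qed.

Lemma vsqD_eps z v (e : R) : 0 < e ->
  vsq (z + v) <= (1 + e) * vsq z + (1 + e^-1) * vsq v.
Proof.
move=> e0; rewrite /vsq !mulr_sumr -big_split; apply: ler_sum => i _.
by rewrite mxE csqD_eps.
Qed.

Lemma csq_circle (e : R) (z : C) :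
  z \in [:: e%:C; - e%:C; e%:C * 'i%C; - (e%:C * 'i%C)] -> csq z = e ^+ 2.
Proof.
by rewrite !inE => /or4P[] /eqP->; rewrite ?csqN ?csqM ?csq_i ?mulr1 csq_real.
Qed.

Lemma sum4_gt (e : R) (f : C -> R) (b : R) :
  4 * b < sum4 e f ->
  exists2 z, z \in [:: e%:C; - e%:C; e%:C * 'i%C; - (e%:C * 'i%C)] & b < f z.
Proof.
rewrite /sum4 => H.
have [H1|H1] := ltP b (f e%:C); first by exists e%:C; rewrite // !inE eqxx.
have [H2|H2] := ltP b (f (- e%:C)); first by exists (- e%:C); rewrite // !inE eqxx ?orbT.
have [H3|H3] := ltP b (f (e%:C * 'i%C)).
  by exists (e%:C * 'i%C); rewrite // !inE eqxx ?orbT.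
have [H4|H4] := ltP b (f (- (e%:C * 'i%C))).
  by exists (- (e%:C * 'i%C)); rewrite // !inE eqxx ?orbT.
by exfalso; lra.
Qed.

Lemma sum4_lin (e d l : R) (f1 f2 f3 f4 : C -> R) :
  sum4 e (fun x => f1 x + d * f2 x - l * (f3 x + f4 x)) =
  sum4 e f1 + d * sum4 e f2 -
  l * (sum4 e f3 + sum4 e f4).
Proof.
rewrite /sum4.
move: (e%:C) (- e%:C) (e%:C * _) (- _ : C) => x1 x2 x3 x4.
move: (f1 x1) (f1 x2) (f1 x3) (f1 x4) (f2 x1) (f2 x2) (f2 x3) (f2 x4).
move: (f3 x1) (f3 x2) (f3 x3) (f3 x4) (f4 x1) (f4 x2) (f4 x3) (f4 x4) => *.
by ring.
Qed.

Variables (G : 'rV[C]_p -> 'rV[C]_p) (J : 'rV[C]_p -> 'M[C]_p)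
  (Q : 'rV[C]_p -> 'rV[C]_p).
Hypothesis Gexp : forall z v (x : C),
  G (z + x *: v) = G z + x *: (v *m J z) + x ^+ 2 *: Q v.
Hypothesis Gcvg : forall (U : set_system nat), UltraFilter U ->
  forall u l, vcvg U u l -> vcvg U (fun j => G (u j)) (G l).

(** * The maximum principle on a complex curve, by penalization *)

Section Penalty.
Variables (z0 : 'rV[C]_p) (g0n : G z0 != 0).
Let g0 := G z0.
Let a := vsq g0.
Let gc : 'cV[C]_p := (map_mx conjc g0)^T.
(** [L] is the coordinate along [g0] and [P] the orthogonal projection off [g0]. With h and Psi, the
    compositions of [L] and [P] with [G] defined below, [G] splits as h g0 + Psi, and Psi = 0 cuts
    out a curve through [z0] on which 1 / h is the function to study. *)
Let L w : C := (a^-1)%:C * (w *m gc) 0 0.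
Let P w := w - L w *: g0.

Let a0 : 0 < a. Proof. exact: vsq_gt0. Qed.

Let LD w w' : L (w + w') = L w + L w'.
Proof. by rewrite /L mulmxDl mxE mulrDr. Qed.

Let LZ x w : L (x *: w) = x * L w.
Proof. by rewrite /L -scalemxAl mxE mulrCA. Qed.

Let gcE w : (w *m gc) 0 0 = \sum_i w 0 i * (g0 0 i)^*%C.
Proof. by rewrite mxE; apply: eq_bigr => i _; rewrite !mxE. Qed.

Let cJ (x : C) : x * x^*%C = (csq x)%:C.
Proof. by case: x => u v; rewrite /csq /=; simpc; rewrite -!expr2 [v * u]mulrC addNr. Qed.

Let Lg0 : L g0 = 1.
Proof.
rewrite /L gcE (eq_bigr (fun i => (csq (g0 0 i))%:C)); last by move=> i _; rewrite cJ.
by rewrite -rmorph_sum /= -rmorphM /= mulVf ?rmorph1 // gt_eqF.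
Qed.

Let PD w w' : P (w + w') = P w + P w'.
Proof. by rewrite /P LD scalerDl opprD addrACA. Qed.

Let PZ x w : P (x *: w) = x *: P w.
Proof. by rewrite /P LZ scalerBr scalerA. Qed.

Let LP w : (P w *m gc) 0 0 = 0.
Proof.
have : L (P w) = 0 by rewrite /P LD -scaleN1r scalerA LZ Lg0 mulr1 mulN1r subrr.
move/eqP; rewrite mulf_eq0 => /orP[|/eqP//].
by rewrite fmorph_eq0 invr_eq0 gt_eqF.
Qed.

Let pythagoras w : vsq w = csq (L w) * a + vsq (P w).
Proof.
have {1}-> : w = L w *: g0 + P w by rewrite /P addrC subrK.
have H (x y : C) : csq (x + y) = csq x + csq y + 2 * complex.Re (y * x^*%C).
  by case: x => u1 u2; case: y => v1 v2; rewrite /csq /=; ring.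
rewrite {1}/vsq.
under eq_bigr do rewrite mxE H [(L w *: g0) _ _]mxE csqM.
rewrite !big_split /= -mulr_sumr -/(vsq (P w)) -/a -mulr_sumr.
suff E0 : \sum_i complex.Re (P w 0 i * (L w * g0 0 i)^*%C) = 0.
  by rewrite E0 mulr0 addr0 -big_split.
have ReS (f : 'I_p -> C) : \sum_i complex.Re (f i) = complex.Re (\sum_i f i).
  by elim/big_rec2: _ => // i x y _ ->; rewrite Re_add.
rewrite ReS; under eq_bigr do rewrite rmorphM mulrCA.
by rewrite -mulr_sumr -gcE LP mulr0.
Qed.

(** The image of [P] lies in a hyperplane: the nonzero column [gc] is annihilated by the matrix [PM]
    of [P], so [J z *m PM] is singular. *)
Let kernel z : exists2 v, v != 0 & P (v *m J z) = 0.
Proof.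
pose PM : 'M[C]_p := 1%:M - (a^-1)%:C *: (gc *m g0).
have PME w : w *m PM = P w.
  rewrite mulmxBr mulmx1 -scalemxAr mulmxA /P /L -scalerA; congr (_ - _ *: _).
  by rewrite {1}[w *m gc]mx11_scalar mul_scalar_mx.
have gcn : gc != 0.
  apply: contraNneq g0n => gc0; apply/eqP/rowP => i; rewrite mxE.
  have := congr1 (fun M : 'cV[C]_p => M i 0) gc0; rewrite !mxE => /eqP.
  by rewrite conjc_eq0 => /eqP.
have PMgc : PM *m gc = 0.
  rewrite mulmxBl mul1mx -scalemxAl -mulmxA [g0 *m gc]mx11_scalar mul_mx_scalar scalerA.
  by move: Lg0; rewrite /L => ->; rewrite scale1r subrr.
have : \det (J z *m PM) == 0.
  apply: contraNT gcn => d0; apply/eqP.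
  have un : J z *m PM \in unitmx by rewrite unitmxE unitfE.
  by rewrite -(mulKmx un gc) -mulmxA PMgc !mulmx0.
by move/det0P => [v v0]; rewrite mulmxA PME => E; exists v.
Qed.

Let h z := L (G z).
Let Psi z := P (G z).

Let hexp z v x : h (z + x *: v) = h z + x * L (v *m J z) + x ^+ 2 * L (Q v).
Proof. by rewrite /h Gexp !LD !LZ. Qed.

Let Psiexp z v x : P (v *m J z) = 0 ->
  Psi (z + x *: v) = Psi z + x ^+ 2 *: P (Q v).
Proof. by move=> v0; rewrite /Psi Gexp !PD !PZ v0 scaler0 addr0. Qed.

(** The penalized form of maximizing |xi|^2 subject to Psi z = 0 and xi h z = 1, that is, |1 / h|^2
    on the curve. The term with [d] covers the directions in which xi does not move. *)
Let goal (d l : R) z (xi : C) : R :=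
  csq xi + d * vsq (z - z0) -
  l * (vsq (Psi z) + csq (xi * h z - 1)).

(* A direction in the kernel of the differential of (Psi, xi h - 1): along it the
   penalty is of order 4 while the first two terms of [goal] are strictly convex on average. *)
Let goal_no_interior_max (d l : R) z xi (r1 r2 : R) : 0 < d -> 0 <= l ->
  vsq (z - z0) < r1 -> csq xi < r2 ->
  exists z', exists xi', [/\ vsq (z' - z0) < r1, csq xi' < r2 &
    goal d l z xi < goal d l z' xi'].
Proof.
move=> d0 l0 zr xr.
have [v [y [vy Pv hy]]] : exists v, exists y, [/\ 0 < csq y + d * vsq v,
    P (v *m J z) = 0 & xi * L (v *m J z) + y * h z = 0].
  have [v v0 Pv] := kernel z.
  (* Where h vanishes the linearized constraint does not involve [y], so moving xi alone is a kernel
     direction. *)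
  have [hz|hz] := eqVneq (h z) 0.
    exists 0, 1; split; rewrite ?mul0mx.
    - by rewrite -[1]/(1%:C) csq_real expr1n ltr_pwDl // mulr_ge0 ?vsq_ge0 // ltW.
    - by rewrite /P /L mul0mx mxE mulr0 scale0r subr0.
    - by rewrite /L mul0mx mxE mulr0 hz !mulr0 addr0.
  exists v, (- (xi * L (v *m J z) / h z)); split=> //.
    by rewrite ltr_wpDl ?csq_ge0 // mulr_gt0 // vsq_gt0.
  by rewrite mulNr divfK // subrr.
pose k := csq y + d * vsq v.
pose c2 := xi * L (Q v) + y * L (v *m J z); pose c3 := y * L (Q v).
pose K := l * (vsq (P (Q v)) + csq c2 + csq c3).
have K0 : 0 <= K by rewrite mulr_ge0 // addr_ge0 ?csq_ge0 // addr_ge0 ?vsq_ge0 ?csq_ge0.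
pose A1 := vsq (z - z0) + 2 * vsq v; pose A2 := csq xi + 2 * csq y.
have A10 : 0 <= A1 by rewrite addr_ge0 ?mulr_ge0 ?vsq_ge0.
have A20 : 0 <= A2 by rewrite addr_ge0 ?mulr_ge0 ?csq_ge0.
pose B1 := r1 - vsq (z - z0); pose B2 := r2 - csq xi.
have B10 : 0 < B1 by rewrite subr_gt0.
have B20 : 0 < B2 by rewrite subr_gt0.
(* The step [e] is 1 / w: the quotients by [B1] and [B2] keep the four points in the two open balls,
   and K / k makes the fourth-order loss smaller than the second-order gain. *)
pose w := 1 + A1 / B1 + A2 / B2 + K / k.
have := divr_ge0 K0 (ltW vy); have := divr_ge0 A20 (ltW B20); have := divr_ge0 A10 (ltW B10).
move=> q1 q2 q3; have w1 : 1 <= w by rewrite /w /k; lra.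
have w0 : 0 < w by lra.
pose e := w^-1; have e0 : 0 < e by rewrite invr_gt0.
have e1 : e <= 1 by rewrite invf_le1.
have eP A0 B0 : 0 < B0 -> 1 + A0 / B0 <= w -> e * A0 < B0.
  move=> b0 le; rewrite mulrC ltr_pdivrMr //; apply: lt_le_trans (_ : B0 * (1 + A0 / B0) <= _).
    by rewrite mulrDr mulr1 mulrCA divff ?gt_eqF // mulr1 ltrDr.
  by rewrite ler_pM2l.
have e1P : e * A1 < B1 by apply: eP; rewrite // /w /k; lra.
have e2P : e * A2 < B2 by apply: eP; rewrite // /w /k; lra.
have e3P : e * K < k by apply: eP; rewrite // /w /k; lra.
have S : 4 * goal d l z xi < sum4 e (fun x => goal d l (z + x *: v) (xi + x * y)).
  have -> : sum4 e (fun x => goal d l (z + x *: v) (xi + x * y)) =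
    sum4 e (fun x => csq (xi + x * y)) +
    d * sum4 e (fun x => vsq ((z - z0) + x *: v)) -
    l * (sum4 e (fun x => vsq (Psi z + x ^+ 2 *: P (Q v))) +
         sum4 e (fun x => csq (xi * h z - 1 + x ^+ 2 * c2 + x ^+ 3 * c3))).
    have E x : goal d l (z + x *: v) (xi + x * y) =
       csq (xi + x * y) + d * vsq ((z - z0) + x *: v) -
       l * (vsq (Psi z + x ^+ 2 *: P (Q v)) +
            csq (xi * h z - 1 + x ^+ 2 * c2 + x ^+ 3 * c3)).
      rewrite /goal Psiexp // [z + _ - z0]addrAC hexp; congr (_ - _ * (_ + csq _)).
      rewrite (_ : xi * h z - 1 + x ^+ 2 * c2 + x ^+ 3 * c3 =
        xi * h z - 1 + x * (xi * L (v *m J z) + y * h z) + x ^+ 2 * c2 + x ^+ 3 * c3).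
        by rewrite /c2 /c3; ring.
      by rewrite hy mulr0 addr0.
    by rewrite -sum4_lin; congr (sum4 e _); apply/funext.
  rewrite !csq_four_points1 vsq_four_points1 vsq_four_points csq_four_points.
  rewrite /goal -subr_gt0.
  rewrite (_ : _ - _ = 4 * (e ^+ 2 * (k - e ^+ 2 * (l * (vsq (P (Q v)) + csq c2 + e ^+ 2 * csq c3))))).
    rewrite mulr_gt0 // mulr_gt0 ?exprn_gt0 // subr_gt0.
    apply: le_lt_trans e3P; rewrite expr2 -mulrA ler_pM2l //.
    apply: le_trans (_ : l * (vsq (P (Q v)) + csq c2 + e ^+ 2 * csq c3) <= _).
      rewrite ler_piMl ?(ltW e0) // mulr_ge0 // addr_ge0 //.
        by rewrite addr_ge0 ?vsq_ge0 ?csq_ge0.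
      by rewrite mulr_ge0 ?sqr_ge0 ?csq_ge0.
    rewrite ler_wpM2l // lerD2l ler_piMl ?csq_ge0 //.
    by rewrite expr_le1 // ltW.
  rewrite /k; move: (vsq (P (Q v))) (csq c2) (csq c3) (csq xi) (vsq (z - z0)).
  move: (vsq (Psi z)) (csq (xi * h z - 1)) (csq y) (vsq v) => *.
  by ring.
have [x xc xgt] := sum4_gt S.
have xe := csq_circle xc.
have bound (N t : R) : 0 <= N -> 0 <= t ->
   (1 + e) * N + (1 + e^-1) * (e ^+ 2 * t) <= N + e * (N + 2 * t).
  move=> N0 t0.
  have -> : (1 + e^-1) * (e ^+ 2 * t) = (e ^+ 2 + e) * t by field; rewrite gt_eqF.
  have : e ^+ 2 * t <= e * t by rewrite ler_wpM2r // expr2 ler_piMl // ltW.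
  by lra.
exists (z + x *: v), (xi + x * y); split=> //.
  rewrite [z + _ - z0]addrAC; apply: le_lt_trans (vsqD_eps _ _ e0) _; rewrite vsqZ xe.
  by apply: le_lt_trans (bound _ _ (vsq_ge0 _) (vsq_ge0 _)) _; move: e1P; rewrite /A1 /B1; lra.
apply: le_lt_trans (csqD_eps _ _ e0) _; rewrite csqM xe.
by apply: le_lt_trans (bound _ _ (csq_ge0 _) (csq_ge0 _)) _; move: e2P; rewrite /A2 /B2; lra.
Qed.

Section Cvg.
Variable U : set_system nat.
Hypothesis UU : UltraFilter U.

Let h_cvg (u : nat -> 'rV[C]_p) l : vcvg U u l -> ccvg U (fun j => h (u j)) (h l).
Proof.
move=> /Gcvg ul; rewrite /h /L.
apply: ccvgM; first exact: ccvg_cst.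
rewrite gcE; under [X in ccvg _ X]eq_fun do rewrite gcE.
by apply: ccvg_sum => i; apply: ccvgM; [exact: ul | exact: ccvg_cst].
Qed.

Let Psi_cvg (u : nat -> 'rV[C]_p) l : vcvg U u l -> vcvg U (fun j => Psi (u j)) (Psi l).
Proof.
move=> ul i; have E z : Psi z 0 i = G z 0 i - h z * g0 0 i by rewrite /Psi /P !mxE.
have -> : (fun j => Psi (u j) 0 i) = (fun j => G (u j) 0 i - h (u j) * g0 0 i).
  by apply/funext => j; exact: E.
have -> : Psi l 0 i = G l 0 i - h l * g0 0 i by exact: E.
apply: ccvgD; first exact: Gcvg.
by apply: ccvgN; apply: ccvgM; [exact: h_cvg | exact: ccvg_cst].
Qed.

Let pen_cvg (u : nat -> 'rV[C]_p) (x : nat -> C) l y : vcvg U u l -> ccvg U x y ->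
  (fun j => vsq (Psi (u j)) + csq (x j * h (u j) - 1)) @ U -->
  vsq (Psi l) + csq (y * h l - 1).
Proof.
move=> ul xy; apply: cvgD.
  by apply: (@cvg_vsq _ _ _ _ _ (fun j => Psi (u j))); apply: Psi_cvg.
apply: (@cvg_csq _ _ _ _ (fun j => x j * h (u j) - 1)).
apply: ccvgD; last exact: ccvg_cst.
by apply: ccvgM => //; apply: h_cvg.
Qed.

Let sub_cvg (u : nat -> 'rV[C]_p) l : vcvg U u l ->
  (fun j => vsq (u j - z0)) @ U --> vsq (l - z0).
Proof.
move=> ul; apply: (@cvg_vsq _ _ _ _ _ (fun j => u j - z0)).
by apply: vcvgB => // i; apply: ccvg_cst.
Qed.

Let ball_compact (r : R) (u : nat -> 'rV[C]_p) :
  (forall j, vsq (u j - z0) <= r) ->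
  exists2 l, vsq (l - z0) <= r & vcvg U u l.
Proof.
move=> ur.
have [|l ul] := @ultra_bounded_vcvg R nat U UU p u (2 * r + 2 * vsq z0).
  apply: nearW => j; rewrite -[u j](subrK z0); apply: le_trans (vsqD_le _ _) _.
  by rewrite lerD2r ler_pM2l.
exists l => //; apply: (ler_cvg_to (sub_cvg ul) (cvg_cst r)).
by apply: nearW.
Qed.

Hypothesis sU : \oo `<=` U.

(** On the curve Psi = 0 one has |G|^2 = |h|^2 |g0|^2. If [G] had no zero in the ball, 1 / h would
    be defined on the curve there, equal to 1 at [z0] and of squared modulus at most 1 / c on the
    sphere, against the maximum principle. Maximizers of [goal] for growing penalty weights carry
    this out without any structure on the curve. *)
Lemma min_modulus_aux (r c : R) : 0 < r -> 1 < c ->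
  (forall z, vsq (z - z0) = r -> c * vsq (G z0) <= vsq (G z)) ->
  exists2 z, vsq (z - z0) <= r & G z = 0.
Proof.
move=> r0 c1 sphere; apply: contrapT => noz.
have z0r : vsq (z0 - z0) <= r by rewrite subrr vsq0 ltW.
have [zm zmr zmP] : exists2 v, vsq (v - z0) <= r & forall w, vsq (w - z0) <= r ->
    - vsq (G w) <= - vsq (G v).
  refine (@ultra_max R _ (fun w => vsq (w - z0) <= r) U (@vcvg R nat U p)
    (fun z => - vsq (G z)) UU sU _ _ _).
  - by exists z0.
  - by move=> u ur; apply: ball_compact.
  - move=> u l ul; apply: cvgN; apply: (@cvg_vsq _ _ _ _ _ (fun j => G (u j))).
    exact: Gcvg.
pose mu := vsq (G zm).
have mu0 : 0 < mu.
  by apply: vsq_gt0; apply/eqP => E; apply: noz; exists zm.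
have muP w : vsq (w - z0) <= r -> mu <= vsq (G w).
  by move=> /zmP; rewrite lerN2.
(* [M] exceeds |1 / h|^2 on the curve because |G|^2 >= mu in the ball; [d] is so small that d r is
   half of the gap 1 - 1 / c. *)
pose M := a / mu + 1; pose d := (1 - c^-1) / (2 * r).
have am0 : 0 <= a / mu by rewrite divr_ge0 ?ltW.
have c0 : 0 < c by apply: lt_trans c1.
have cV : c^-1 < 1 by rewrite invf_lt1.
have d0 : 0 < d by rewrite divr_gt0 ?subr_gt0 // mulr_gt0.
have dr : d * r = (1 - c^-1) / 2 by rewrite /d; field; rewrite !gt_eqF.
pose K (x : 'rV[C]_p * C) := vsq (x.1 - z0) <= r /\ csq x.2 <= M.
have Kc (u : nat -> 'rV[C]_p * C) : (forall j, K (u j)) ->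
    exists2 l, K l & vcvg U (fun j => (u j).1) l.1 /\ ccvg U (fun j => (u j).2) l.2.
  move=> uK.
  have [|l lr ul] := @ball_compact r (fun j => (u j).1); first by move=> j; have [] := uK j.
  have [|y uy] := @ultra_bounded_ccvg R nat U UU (fun j => (u j).2) M.
    by apply: nearW => j; have [] := uK j.
  exists (l, y) => //; split=> //=; apply: (ler_cvg_to (cvg_csq uy) (cvg_cst M)).
  by apply: nearW => j; have [] := uK j.
have cn1 : csq (1 : C) = 1 by rewrite /csq /= expr0n expr1n addr0.
have Pg0 : Psi z0 = 0 by rewrite /Psi /P Lg0 scale1r subrr.
have hz0 : h z0 = 1 by exact: Lg0.
have Kz0 : K (z0, 1).
  by split=> //=; rewrite cn1 /M lerDr.
(* A maximizer for the weight [j.+1] lies on the boundary by [goal_no_interior_max]. Comparison with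
   (z0, 1), where the penalty vanishes, bounds its penalty from above and the rest of the objective
   from below. *)
have H (j : nat) : exists x : 'rV[C]_p * C, [/\ K x,
    (vsq (x.1 - z0) - r) * (csq x.2 - M) = 0,
    1 <= csq x.2 + d * vsq (x.1 - z0) &
    j.+1%:R * (vsq (Psi x.1) + csq (x.2 * h x.1 - 1)) <= M + d * r].
  have [x Kx xP] : exists2 x, K x & forall w : 'rV[C]_p * C, K w ->
      goal d j.+1%:R w.1 w.2 <= goal d j.+1%:R x.1 x.2.
    refine (@ultra_max R _ K U (fun u l => vcvg U (fun j => (u j).1) l.1 /\
      ccvg U (fun j => (u j).2) l.2) (fun x => goal d j.+1%:R x.1 x.2) UU sU _ _ _).
    - by exists (z0, 1).
    - exact: Kc.
    - move=> u l [ul uy]; rewrite /goal; apply: cvgB.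
        apply: cvgD; first exact: cvg_csq.
        by apply: cvgM; [exact: cvg_cst | exact: sub_cvg].
      by apply: cvgM; [exact: cvg_cst | exact: pen_cvg].
  have g1 : 1 <= goal d j.+1%:R x.1 x.2.
    apply: le_trans (xP _ Kz0); rewrite /goal /= Pg0 hz0 !subrr mulr1 subrr vsq0 csq0.
    by rewrite addr0 !mulr0 addr0 subr0 cn1.
  have pen0 : 0 <= j.+1%:R * (vsq (Psi x.1) + csq (x.2 * h x.1 - 1)).
    by rewrite mulr_ge0 // addr_ge0 ?vsq_ge0 ?csq_ge0.
  have [Kx1 Kx2] := Kx.
  have dKx1 : d * vsq (x.1 - z0) <= d * r by rewrite ler_pM2l.
  move: g1; rewrite /goal => g1.
  exists x; split=> //; [|lra|lra].
  apply/eqP; rewrite mulf_eq0 !subr_eq0; apply/negPn/negP; rewrite negb_or => /andP[n1 n2].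
  have [|||z' [y' [zr yM]]] := @goal_no_interior_max d j.+1%:R x.1 x.2 r M d0 _ _ _ => //.
  - by rewrite lt_neqAle n1.
  - by rewrite lt_neqAle n2.
  by rewrite ltNge => /negP; apply; apply: (xP (z', y')); split=> /=; apply: ltW.
have [u uP] := choice H.
have [[l y] /= [lr yM] [ul uy]] := Kc u (fun j => let: And4 k _ _ _ := uP j in k).
(* The penalty is at most a constant over [j.+1], so the limit satisfies both constraints
   exactly. *)
have zP : vsq (Psi l) + csq (y * h l - 1) = 0.
  apply/eqP; rewrite eq_le addr_ge0 ?vsq_ge0 ?csq_ge0 // andbT.
  have c' : (fun j : nat => (M + d * r) * j.+1%:R^-1) @ U --> (M + d * r) * 0.
    apply: cvgM; first exact: cvg_cst.
    exact: ultra_harmonic.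
  rewrite mulr0 in c'; apply: (ler_cvg_to (pen_cvg ul uy) c').
  apply: nearW => j; rewrite ler_pdivlMr // mulrC.
  by have [] := uP j.
move/eqP: zP; rewrite paddr_eq0 ?vsq_ge0 ?csq_ge0 // vsq_eq0 csq_eq0.
move=> /andP[/eqP Pl]; rewrite subr_eq0 => /eqP yh.
have Gl : vsq (G l) = csq (h l) * a by rewrite pythagoras -/(Psi l) Pl vsq0 addr0.
have yh1 : csq y * csq (h l) = 1.
  by rewrite -csqM yh.
have prod0 : (vsq (l - z0) - r) * (csq y - M) = 0.
  have cc1 : (fun j => (vsq ((u j).1 - z0) - r) * (csq (u j).2 - M)) @ U -->
      (vsq (l - z0) - r) * (csq y - M).
    apply: cvgM; apply: cvgB; try exact: cvg_cst; first exact: sub_cvg.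
    exact: cvg_csq.
  have E : (fun j => (vsq ((u j).1 - z0) - r) * (csq (u j).2 - M)) = (fun=> 0).
    by apply/funext => j; have [_ ->] := uP j.
  by rewrite E in cc1; apply: (cvg_unique (@Rhausdorff R) cc1); apply: cvg_cst.
have sum1 : 1 <= csq y + d * vsq (l - z0).
  have cc1 : (fun j => csq (u j).2 + d * vsq ((u j).1 - z0)) @ U -->
      csq y + d * vsq (l - z0).
    apply: cvgD; first exact: cvg_csq.
    by apply: cvgM; [exact: cvg_cst | exact: sub_cvg].
  by apply: (ler_cvg_to (cvg_cst (1 : R)) cc1); apply: nearW => j; have [] := uP j.
have h0 : 0 < csq (h l).
  rewrite lt_def csq_ge0 andbT; apply/eqP => E; move: yh1; rewrite E mulr0.
  by move/eqP; rewrite eq_sym oner_eq0.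
have yE : csq y = (csq (h l))^-1.
  by apply: (mulIf (lt0r_neq0 h0)); rewrite yh1 mulVf // gt_eqF.
have yaM : csq y < M.
  rewrite yE /M -[a / mu]invrK invf_div; apply: le_lt_trans (_ : (mu / a)^-1 < _).
    rewrite lef_pV2 ?posrE ?divr_gt0 // ler_pdivrMr // -Gl; exact: muP.
  by rewrite ltrDl.
(* The bound [M] is not attained, so the limit lies on the sphere, where |y|^2 <= 1 / c contradicts
   [sum1]. *)
have lr' : vsq (l - z0) = r.
  move/eqP: prod0; rewrite mulf_eq0 !subr_eq0 (lt_eqF yaM) orbF => /eqP//.
have := sphere l lr'; rewrite Gl -/g0 -/a ler_pM2r // => ch.
have yc : csq y <= c^-1 by rewrite yE lef_pV2 ?posrE.
by move: sum1; rewrite lr' dr; lra.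
Qed.

End Cvg.
End Penalty.

Lemma min_modulus z0 (r c : R) : 0 < r -> 1 < c ->
  (forall z, vsq (z - z0) = r -> c * vsq (G z0) <= vsq (G z)) ->
  exists2 z, vsq (z - z0) <= r & G z = 0.
Proof.
move=> r0 c1 sphere; have [G0|G0] := eqVneq (G z0) 0.
  by exists z0; rewrite // subrr vsq0 ltW.
have [U UU sU] := nat_ultrafilter.
exact: (min_modulus_aux G0 UU sU r0 c1 sphere).
Qed.

End MinModulus.

(** * Limits of zeros of quadratic families *)

Lemma finite_of_pigeonhole (T : eqType) (S : T -> Prop) (N : nat) :
  (forall w : 'I_N.+1 -> T, (forall j, S (w j)) -> exists j, exists l, j != l /\ w j = w l) ->
  exists r : seq T, forall x, S x -> x \in r.
Proof.
move=> H; apply: contrapT => nfin.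
suff [r [sr ur rS]] : exists r : seq T, [/\ size r = N.+1, uniq r & forall x, x \in r -> S x].
  have [x0 x0r] : exists x0, x0 \in r by case: r sr {ur rS} => // x r _; exists x; rewrite mem_head.
  have rn (j : 'I_N.+1) : nth x0 r j \in r by rewrite mem_nth // sr.
  have [j [l [jl E]]] := H (fun j => nth x0 r j) (fun j => rS _ (rn j)).
  by move/eqP: E; rewrite nth_uniq ?sr // => /eqP/val_inj E; rewrite E eqxx in jl.
move: (N.+1) => k {H}; elim: k => [|k [r [sr ur rS]]]; first by exists [::].
have [x [Sx xr]] : exists x, S x /\ x \notin r.
  apply: contrapT => nx; apply: nfin; exists r => x Sx.
  by apply: contrapT => xr; apply: nx; exists x; split=> //; apply/negP.
exists (x :: r); split=> /=; [by rewrite sr | by rewrite xr|].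
by move=> y; rewrite in_cons => /orP[/eqP->|/rS].
Qed.

Section Polynomial.
Variable F : closedFieldType.

Lemma polyfun_ev2 (c : {poly {poly F}}) (f g : seq F -> F) : polyfun f -> polyfun g ->
  polyfun (fun e => ev2 (f e) (g e) c).
Proof.
move=> pf pg; elim/poly_ind: c => [|c d IH].
  by apply: polyfun_ext (polyfun_cst 0) => e; rewrite ev2E !horner0.
apply: polyfun_ext (polyfunD (polyfunM IH pg) (polyfun_horner d pf)) => e.
by rewrite !ev2E hornerMXaddC hornerD hornerM hornerC.
Qed.

Lemma polyfun_ev3 (Q : {poly {poly {poly F}}}) (f g h : seq F -> F) :
  polyfun f -> polyfun g -> polyfun h ->
  polyfun (fun e => (map_poly (ev2 (f e) (g e)) Q).[h e]).
Proof.
move=> pf pg ph; elim/poly_ind: Q => [|Q d IH].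
  by apply: polyfun_ext (polyfun_cst 0) => e; rewrite rmorph0 horner0.
apply: polyfun_ext (polyfunD (polyfunM IH ph) (polyfun_ev2 d pf pg)) => e.
by rewrite rmorphD rmorphM /= map_polyX map_polyC hornerMXaddC.
Qed.

End Polynomial.

(** * The perturbation parameters s = 1 / (k + 1) *)

Section Harmonic.
Variable R : realType.
Local Open Scope complex_scope.
Local Notation C := R[i].

Definition hseq (k : nat) : C := (k.+1%:R^-1)%:C.

Lemma hseq_inj : injective hseq.
Proof. by move=> j k [/invr_inj/eqP]; rewrite eqr_nat => /eqP[]. Qed.

Lemma hseq_cvg (U : set_system nat) : ProperFilter U -> \oo `<=` U -> ccvg U hseq 0.
Proof.
move=> UU sU; split=> /=; last exact: cvg_cst.
exact: ultra_harmonic.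
Qed.

Lemma poly_hseq_near (p : {poly C}) : p != 0 -> \forall k \near \oo, p.[hseq k] != 0.
Proof.
move=> p0; have [r pE] := closed_field_poly_normal p.
have H : \forall k \near \oo, hseq k \notin r.
  elim: r {pE} => [|a r IH]; first by apply: nearW.
  have : \forall k \near \oo, hseq k != a.
    have [[k0 E]|n] := pselect (exists k, hseq k = a).
      near=> k; rewrite -E (inj_eq hseq_inj) gt_eqF //.
      by near: k; apply: nbhs_infty_gt.
    by apply: nearW => k; apply/eqP => E; apply: n; exists k.
  by move=> H; near=> k; rewrite in_cons negb_or; apply/andP; split; near: k.
near=> k; have : hseq k \notin r by near: k.
rewrite -root_prod_XsubC rootE pE hornerZ mulf_eq0 lead_coef_eq0 (negPf p0) /=.
by [].
Unshelve. all: by end_near.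
Qed.

Lemma poly_shift_near (p : {poly C}) (t : C) : p != 0 ->
  \forall k \near \oo, p.[t + hseq k] != 0.
Proof.
move=> p0.
have q0 : p \Po ('X + t%:P) != 0 by rewrite comp_poly2_eq0 // size_XaddC.
have := poly_hseq_near q0; apply: filterS => k.
by rewrite horner_comp !hornerE addrC.
Qed.

End Harmonic.

Section RootBound.
Local Open Scope complex_scope.
Variable R : realType.
Local Notation C := R[i].
Local Notation A := {poly {poly C}}.

Lemma ev3_cvg (U : set_system nat) (FU : ProperFilter U) (H : {poly A})
    (t s x : nat -> C) t' s' x' : ccvg U t t' -> ccvg U s s' -> ccvg U x x' ->
  ccvg U (fun k => (map_poly (ev2 (t k) (s k)) H).[x k]) (map_poly (ev2 t' s') H).[x'].
Proof.
move=> tt' ss' xx'.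
have H3 := polyfun_ev3 H (polyfun_var _ 0) (polyfun_var _ 1) (polyfun_var _ 2).
have := @ccvg_polyfun R nat U FU _ (fun k => [:: t k; s k; x k]) [:: t'; s'; x'] H3.
apply=> -[|[|[|i]]] //=.
by rewrite nth_nil; apply: ccvg_cst.
Qed.

(** A limit root [x0] with |x0|^2 > 2 M + 2 stays at distance at least 1 from all roots for s =
    [hseq R k]. Comparing linear factors gives |P(y)|^2 <= |P(x0)|^2 K^(size H), and as P(x0) tends
    to 0 the limit polynomial would vanish at [y], chosen off its roots. The degree is allowed to
    drop at s = 0. *)
Lemma root_bound_limit (U : set_system nat) (H : {poly A}) (t : C) (M : R) :
  UltraFilter U -> \oo `<=` U -> 0 <= M -> map_poly (ev2 t 0) H != 0 ->
  (\forall k \near U, forall x, root (map_poly (ev2 t (hseq R k)) H) x -> csq x <= M) ->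
  forall x, root (map_poly (ev2 t 0) H) x -> csq x <= 2 * M + 2.
Proof.
move=> UU sU M0 H0 bM x0 rx0; rewrite leNgt; apply/negP => x0M.
have [y /negP[]] := closed_nonrootP _ H0.
(* [K] bounds |y - a|^2 for each root [a]; the summand 1 makes [K] at least 1, so that the number of
   factors can be replaced by [size H]. *)
pose K := 2 * csq y + 2 * M + 1.
have K1 : 1 <= K by have := csq_ge0 y; rewrite /K; lra.
have ev_lim z : (fun k => csq (map_poly (ev2 t (hseq R k)) H).[z]) @ U -->
    csq (map_poly (ev2 t 0) H).[z].
  have hc := @hseq_cvg R U _ sU.
  apply: (@cvg_csq _ _ _ _ (fun k => (map_poly (ev2 t (hseq R k)) H).[z])).
  apply: (@ev3_cvg U _ H (fun=> t) _ (fun=> z)); [exact: ccvg_cst | | exact: ccvg_cst].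
  exact: hc.
have le k : (forall x, root (map_poly (ev2 t (hseq R k)) H) x -> csq x <= M) ->
   csq (map_poly (ev2 t (hseq R k)) H).[y] <=
   csq (map_poly (ev2 t (hseq R k)) H).[x0] * K ^+ size H.
  move=> bk; set P := map_poly _ _.
  have sP : (size P <= size H)%N by apply: size_poly.
  have [P0|P0] := eqVneq P 0.
    by rewrite P0 !horner0 csq0 mul0r.
  have [rs PE] := closed_field_poly_normal P.
  have srs : (size rs <= size H)%N.
    apply: leq_trans sP; rewrite PE size_scale ?lead_coef_eq0 //.
    by rewrite size_prod_XsubC.
  have rsM x : x \in rs -> csq x <= M.
    move=> xr; apply: bk; rewrite -/P PE rootZ ?lead_coef_eq0 //.
    by rewrite root_prod_XsubC.
  apply: le_trans (_ : csq P.[x0] * K ^+ size rs <= _); last first.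
    by rewrite ler_wpM2l ?csq_ge0 // ler_weXn2l.
  rewrite PE !hornerZ !csqM -mulrA ler_wpM2l ?csq_ge0 //.
  elim: rs rsM {PE srs} => [|a rs IH] rsM.
    by rewrite !big_nil !hornerC expr0 mulr1.
  rewrite !big_cons !hornerM !hornerXsubC !csqM.
  rewrite /= exprS mulrACA ler_pM ?csq_ge0 //; last first.
    by apply: IH => x xr; apply: rsM; rewrite in_cons xr orbT.
  have aM := rsM a (mem_head _ _).
  have h1 : csq (y - a) <= K.
    by have := csqD_le y (- a); rewrite csqN /K; lra.
  have h2 : 1 <= csq (x0 - a).
    have := csqD_le (x0 - a) a; rewrite subrK; lra.
  by apply: le_trans h1 _; rewrite ler_peMl // (le_trans _ K1).
rewrite rootE -csq_eq0 eq_le csq_ge0 andbT.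
have l2 : (fun k => csq (map_poly (ev2 t (hseq R k)) H).[x0] * K ^+ size H) @ U -->
    csq (map_poly (ev2 t 0) H).[x0] * K ^+ size H.
  by apply: cvgM; [exact: ev_lim | exact: cvg_cst].
have e0 : csq (map_poly (ev2 t 0) H).[x0] = 0.
  by apply/eqP; rewrite csq_eq0 -rootE.
rewrite e0 mul0r in l2.
apply: (ler_cvg_to (ev_lim y) l2); apply: filterS bM => k; exact: le.
Qed.

End RootBound.

Lemma common_radius (R : realFieldType) (T : eqType) (l : seq T) (S : T -> R -> Prop) :
  (forall x a b, 0 < a -> a <= b -> S x b -> S x a) ->
  (forall x, x \in l -> exists2 a, 0 < a & S x a) ->
  exists2 a, 0 < a & forall x, x \in l -> S x a.
Proof.
move=> anti; elim: l => [|x l IH] lP; first by exists 1.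
have [|a a0 aP] := IH; first by move=> y yl; apply: lP; rewrite in_cons yl orbT.
have [b b0 Sb] := lP x (mem_head _ _).
have c0 : 0 < Num.min a b by rewrite lt_min a0.
exists (Num.min a b) => // y; rewrite in_cons => /orP[/eqP->|/aP].
  by apply: anti Sb; rewrite // ge_min lexx orbT.
by apply: anti; rewrite // ge_min lexx.
Qed.

(** * Quadratic systems depending polynomially on two parameters *)

Section QuadraticFamily.
Local Open Scope complex_scope.
Variables (R : realType) (p : nat).
Local Notation C := R[i].
Local Notation A := {poly {poly C}}.
Implicit Types (t s : C) (z v : 'rV[C]_p).

Variable F : C -> C -> 'rV[C]_p -> 'rV[C]_p.
Variables (J : C -> C -> 'rV[C]_p -> 'M[C]_p) (Q : C -> C -> 'rV[C]_p -> 'rV[C]_p).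
Hypothesis Fexp : forall t s z v (x : C),
  F t s (z + x *: v) = F t s z + x *: (v *m J t s z) + x ^+ 2 *: Q t s v.
Hypothesis Fpoly : forall (f g : seq C -> C) (h : seq C -> 'rV[C]_p),
  polyfun f -> polyfun g -> (forall j, polyfun (fun e => h e 0 j)) ->
  forall i, polyfun (fun e => F (f e) (g e) (h e) 0 i).

Lemma family_cvg (U : set_system nat) {FU : ProperFilter U}
    (t s : nat -> C) (z : nat -> 'rV[C]_p) t' s' z' :
  ccvg U t t' -> ccvg U s s' -> vcvg U z z' ->
  vcvg U (fun k => F (t k) (s k) (z k)) (F t' s' z').
Proof.
move=> tt' ss' zz' i.
have H : polyfun (fun e : seq C => F e`_0 e`_1 (env_row 2 p e) 0 i).
  apply: Fpoly; try exact: polyfun_var.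
  by move=> j; apply: polyfun_ext (polyfun_var _ (2 + j)) => e; rewrite mxE.
pose e a b (w : 'rV[C]_p) :=
  set_block [:: a; b] 2 p (fun j => if insub j is Some k then w 0 k else 0).
have E a b w : F (e a b w)`_0 (e a b w)`_1 (env_row 2 p (e a b w)) 0 i = F a b w 0 i.
  by rewrite env_row_set_block !nth_set_block.
rewrite -E; have -> : (fun k => F (t k) (s k) (z k) 0 i) =
    (fun k => F (e (t k) (s k) (z k))`_0 (e (t k) (s k) (z k))`_1
      (env_row 2 p (e (t k) (s k) (z k))) 0 i).
  by apply/funext => k; rewrite E.
apply: (ccvg_polyfun (e := fun k => e (t k) (s k) (z k)) H) => j.
rewrite nth_set_block; under [X in ccvg _ X _]eq_fun do rewrite nth_set_block.
case: ifP => _; last by case: j => [|[|j]] //=; rewrite nth_nil; apply: ccvg_cst.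
by case: insubP => [k _ _|_]; [exact: zz' | exact: ccvg_cst].
Qed.

(** In pigeonhole form, with [N.+1] zeros quantified, the bound on the number of zeros is a
    first-order formula in t and s. *)
Definition at_most (N : nat) t s : Prop := forall w : 'I_N.+1 -> 'rV[C]_p,
  (forall j, F t s (w j) = 0) -> exists j, exists l, j != l /\ w j = w l.

Lemma definable_eq_row (q : nat) (f g : seq C -> 'rV[C]_q) :
  (forall j, polyfun (fun e => f e 0 j)) -> (forall j, polyfun (fun e => g e 0 j)) ->
  definable (fun e => f e = g e).
Proof.
move=> pf pg.
apply: (@definable_ext _ (fun e => forall j : 'I_q, f e 0 j - g e 0 j = 0)).
  move=> e; split=> [H|-> j]; last by rewrite subrr.
  by apply/rowP => j; apply/eqP; rewrite -subr_eq0; apply/eqP.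
by apply: definable_bigand => j; apply: definable_eq0; apply: polyfunB.
Qed.

Lemma polyfun_row0 (q : nat) (j : 'I_q) : polyfun (fun e : seq C => (0 : 'rV[C]_q) 0 j).
Proof. by apply: polyfun_ext (polyfun_cst 0) => e; rewrite mxE. Qed.

Lemma definable_zero (f g : seq C -> C) (h : seq C -> 'rV[C]_p) :
  polyfun f -> polyfun g -> (forall j, polyfun (fun e => h e 0 j)) ->
  definable (fun e => F (f e) (g e) (h e) = 0).
Proof.
by move=> pf pg ph; apply: definable_eq_row (@polyfun_row0 p) => j; apply: Fpoly.
Qed.

Lemma definable_at_most N : definable (fun e : seq C => at_most N e`_0 e`_1).
Proof.
pose S (e : seq C) (W : 'rV[C]_(N.+1 * p)) :=
  (forall j : 'I_N.+1, F e`_0 e`_1 (row j (vec_mx W)) = 0) /\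
  ~ (exists j : 'I_N.+1, exists l : 'I_N.+1,
       j != l /\ row j (vec_mx W) = row l (vec_mx W)).
have Sdef : definable (fun e => S e (env_row 2 (N.+1 * p) e)).
  have rowP' j i : polyfun (fun e : seq C => row j (vec_mx (env_row 2 (N.+1 * p) e)) 0 i).
    apply: polyfun_ext (polyfun_var _ (2 + mxvec_index j i)) => e.
    by rewrite !mxE.
  apply: definable_and.
    apply: definable_bigand => j; apply: definable_zero; try exact: polyfun_var.
    exact: rowP'.
  apply: definable_not; apply: definable_bigor => j; apply: definable_bigor => l.
  apply: definable_and; first exact: definable_cst.
  by apply: definable_eq_row; apply: rowP'.
have := definable_not (@definable_exrow _ 2 _ S _ Sdef).
move=> H; apply: (definable_ext _ (H _)) => [e|e e' z ee' [S1 S2]]; last first.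
  by split=> // j; rewrite -!ee'.
split=> [nS w w0|H' [W [W0 W1]]].
  apply: contrapT => nw; apply: nS; exists (mxvec (\matrix_j w j)); rewrite /S mxvecK.
  split=> [j|[j [l []]]]; first by rewrite rowK.
  by rewrite !rowK => jl E; apply: nw; exists j, l.
have [j [l [jl E]]] := H' (fun j => row j (vec_mx W)) W0.
by apply: W1; exists j, l.
Qed.

Variables (t0 : C) (r : seq 'rV[C]_p).
Hypothesis r_uniq : uniq r.
Hypothesis r_zeros : forall z, F t0 0 z = 0 <-> z \in r.
Hypothesis generic : forall q : A, q != 0 ->
  exists t, exists s, ev2 t s q != 0 /\ at_most (size r) t s.

Let at_most_generic : exists2 q : A, q != 0 &
  forall t s, ev2 t s q != 0 -> at_most (size r) t s.
Proof.
have [q q0 [H|H]] := definable_generic2 (definable_at_most (size r)).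
  by exists q.
by have [t [s [/H]]] := generic q0.
Qed.

(** If it failed, the minimum modulus principle with c = 2 would yield parameters tending to (t0, 0)
    and points of the sphere where |F|^2 is at most twice its value at [z0]. That value tends to 0,
    so a limit point would be a zero on the sphere. *)
Let persist z0 (rho : R) : 0 < rho -> F t0 0 z0 = 0 ->
  (forall z, vsq (z - z0) = rho -> F t0 0 z <> 0) ->
  exists2 d : R, 0 < d & forall t s, csq (t - t0) < d -> csq s < d ->
    exists2 z, vsq (z - z0) <= rho & F t s z = 0.
Proof.
move=> rho0 F0 sphere; apply: contrapT => nd.
have H (k : nat) : exists x : C * C * 'rV[C]_p,
    [/\ csq (x.1.1 - t0) <= k.+1%:R^-1, csq x.1.2 <= k.+1%:R^-1,
        vsq (x.2 - z0) = rho &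
        vsq (F x.1.1 x.1.2 x.2) <= 2 * vsq (F x.1.1 x.1.2 z0)].
  apply: contrapT => nk; apply: nd; exists k.+1%:R^-1; first by rewrite invr_gt0.
  move=> t s td sd.
  apply: (min_modulus (Fexp t s) _ rho0 (c := 2)); rewrite ?ltr1n //.
    move=> U UU u l ul.
    by apply: (@family_cvg U _ (fun=> t) (fun=> s)) => //; exact: ccvg_cst.
  move=> z zrho; rewrite leNgt; apply/negP => /ltW zs; apply: nk.
  by exists (t, s, z); split=> //=; apply: ltW.
have [u uP] := choice H.
have [U UU sU] := nat_ultrafilter.
have hcvg := @ultra_harmonic R _ sU.
have c0 (a : nat -> C) : (forall k, csq (a k) <= k.+1%:R^-1) -> ccvg U a 0.
  move=> ak.
  have [|l al] := @ultra_bounded_ccvg R nat U UU a 1.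
    by apply: nearW => k; apply: le_trans (ak k) _; rewrite invf_le1 // ler1n.
  suff <- : l = 0 by [].
  apply/eqP; rewrite -csq_eq0 eq_le csq_ge0 andbT.
  by apply: (ler_cvg_to (cvg_csq al) hcvg); apply: nearW.
have sc : ccvg U (fun k => (u k).1.2) 0 by apply: c0 => k; have [] := uP k.
have tc : ccvg U (fun k => (u k).1.1) t0.
  have -> : (fun k => (u k).1.1) = (fun k => ((u k).1.1 - t0) + t0).
    by apply/funext => k; rewrite subrK.
  rewrite -[X in ccvg _ _ X]add0r; apply: ccvgD; last exact: ccvg_cst.
  by apply: c0 => k; have [] := uP k.
have [|z zc] := @ultra_bounded_vcvg R nat U UU p (fun k => (u k).2) (2 * rho + 2 * vsq z0).
  apply: nearW => k; have [_ _ zr _] := uP k.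
  by rewrite -[(u k).2](subrK z0); apply: le_trans (vsqD_le _ _) _; rewrite zr.
have zrho : vsq (z - z0) = rho.
  have : (fun k => vsq ((u k).2 - z0)) @ U --> vsq (z - z0).
    apply: (@cvg_vsq _ _ _ _ _ (fun k => (u k).2 - z0)).
    by apply: vcvgB => // i; apply: ccvg_cst.
  have -> : (fun k => vsq ((u k).2 - z0)) = (fun=> rho).
    by apply/funext => k; have [] := uP k.
  by move=> H'; apply: (cvg_unique (@Rhausdorff R) H'); apply: cvg_cst.
apply: (sphere z zrho); apply/eqP; rewrite -vsq_eq0 eq_le vsq_ge0 andbT.
have l1 := cvg_vsq (family_cvg tc sc zc).
have l2 := cvg_vsq (@family_cvg U _ _ _ (fun=> z0) _ _ z0 tc sc (fun i => ccvg_cst _)).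
have l3 : (fun k => 2 * vsq (F (u k).1.1 (u k).1.2 z0)) @ U --> 2 * vsq (F t0 0 z0).
  by apply: cvgM; [exact: cvg_cst | exact: l2].
rewrite F0 vsq0 mulr0 in l3.
by apply: (ler_cvg_to (l1 _ _) l3); apply: nearW => k; have [] := uP k.
Qed.

(** Each of the [size r] zeros at (t0, 0) has a zero nearby, in disjoint balls; as there are at most
    [size r] zeros altogether, every zero lies in one of these balls. *)
Let zeros_bounded (q : A) : (forall t s, ev2 t s q != 0 -> at_most (size r) t s) ->
  exists d : R, exists M : R, [/\ 0 < d, 0 <= M & forall t s z,
    csq (t - t0) < d -> csq s < d -> ev2 t s q != 0 -> F t s z = 0 -> vsq z <= M].
Proof.
move=> qP.
(* The factor 4 makes the balls of squared radius [rho] disjoint: a common point would give |z -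
   z'|^2 <= 2 rho + 2 rho. *)
have [rho rho0 rhoP] : exists2 rho : R, 0 < rho & forall z z', z \in r -> z' \in r ->
    z != z' -> 4 * rho < vsq (z - z').
  have [x a b _ ab H ne||rho rho0 rhoP] := @common_radius _ _ [seq (z, z') | z <- r, z' <- r]
      (fun x rho => x.1 != x.2 -> 4 * rho < vsq (x.1 - x.2)).
  - by apply: le_lt_trans (H ne); rewrite ler_pM2l.
  - move=> x _; have [E|ne] := eqVneq x.1 x.2; first by exists 1.
    have x0 : 0 < vsq (x.1 - x.2) by rewrite vsq_gt0 // subr_eq0.
    by exists (vsq (x.1 - x.2) / 5) => [|_]; [rewrite divr_gt0 | lra].
  - exists rho => // z z' zr zr' ne.
    exact: rhoP (z, z') (allpairs_f _ zr zr') ne.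
have [d d0 dP] : exists2 d : R, 0 < d & forall z0, z0 \in r -> forall t s,
    csq (t - t0) < d -> csq s < d -> exists2 z, vsq (z - z0) <= rho & F t s z = 0.
  apply: common_radius => [z0 a b _ ab H t s ta sa|z0 zr].
    by apply: H; [exact: lt_le_trans ta ab | exact: lt_le_trans sa ab].
  apply: persist => //; first exact/r_zeros.
  move=> z zrho /r_zeros zr'.
  have ne : z != z0 by apply: contraTneq rho0 => E; rewrite -zrho E subrr vsq0 ltxx.
  by have := rhoP _ _ zr' zr ne; rewrite zrho; lra.
exists d, (2 * rho + 2 * \sum_(z <- r) vsq z).
have S0 (l : seq 'rV[C]_p) : 0 <= \sum_(z <- l) vsq z.
  by apply: sumr_ge0 => z _; apply: vsq_ge0.
split=> // [|t s z td sd qts Fz].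
  by rewrite addr_ge0 // mulr_ge0 // ltW.
have HZ (j : 'I_(size r)) : exists x, vsq (x - nth 0 r j) <= rho /\ F t s x = 0.
  by have [x] := dP _ (mem_nth 0 (ltn_ord j)) t s td sd; exists x.
have [w wP] := choice HZ.
(* The zero [z] is put at index 0 in front of the zeros from the balls; the latter are distinct, so
   a coincidence involves [z]. *)
have [j [l [jl wE]]] := qP t s qts (fun j => if unlift ord0 j is Some i then w i else z)
  (fun j => match unlift ord0 j as o return F t s (if o is Some i then w i else z) = 0 with
     Some i => proj2 (wP i) | None => Fz end).
have disj (i i' : 'I_(size r)) : i != i' -> w i <> w i'.
  move=> ii E.
  have ne : nth 0 r i != nth 0 r i' by rewrite nth_uniq.
  have := rhoP _ _ (mem_nth 0 (ltn_ord i)) (mem_nth 0 (ltn_ord i')) ne.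
  have -> : nth 0 r i - nth 0 r i' = (w i' - nth 0 r i') - (w i - nth 0 r i).
    by rewrite E opprB [in RHS]addrC addrA subrK.
  have := vsqD_le (w i' - nth 0 r i') (- (w i - nth 0 r i)); rewrite vsqN.
  by have := proj1 (wP i); have := proj1 (wP i'); lra.
have [i zE] : exists i, z = w i.
  move: jl wE; case: unliftP => [i|] ->; case: unliftP => [i'|] -> //.
  - rewrite (inj_eq lift_inj) => ii E; by case: (disj _ _ ii).
  - by move=> _ E; exists i.
  - by move=> _ E; exists i'.
have zi := proj1 (wP i); rewrite -zE in zi.
rewrite -[z](subrK (nth 0 r i)); apply: le_trans (vsqD_le _ _) _.
rewrite lerD // ler_pM2l //.
rewrite (big_rem (nth 0 r i)) /=; last exact: mem_nth.
by rewrite lerDl S0.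
Qed.

(** Generic finiteness of the zeros passes to their [i]-th coordinates, which form a definable set
    of triples (t, s, a). *)
Let coord_poly (i : 'I_p) : exists x : {poly A} * A,
  [/\ map_poly (horner_eval 0) x.1 != 0, x.2 != 0 & forall t s, ev2 t s x.2 != 0 ->
    forall a, (exists2 z, F t s z = 0 & z 0 i = a) <-> root (map_poly (ev2 t s) x.1) a].
Proof.
have [q1 q10 q1P] := at_most_generic.
pose S (e : seq C) := exists z, F e`_0 e`_1 z = 0 /\ z 0 i = e`_2.
have Sdef : definable S.
  apply: (@definable_exrow _ 3 p (fun e z => F e`_0 e`_1 z = 0 /\ z 0 i = e`_2)).
    by move=> e e' z ee'; rewrite !ee'.
  apply: definable_and.
    apply: definable_zero; try exact: polyfun_var.
    by move=> j; apply: polyfun_ext (polyfun_var _ (3 + j)) => e; rewrite mxE.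
  apply: (@definable_ext _ (fun e => e`_(3 + i) - e`_2 = 0)).
    move=> e; rewrite mxE; split=> [/eqP|->]; last by rewrite subrr.
    by rewrite subr_eq0 => /eqP.
  by apply: definable_eq0; apply: polyfunB; apply: polyfun_var.
have [|H [q [H0 q0 HP]]] := definable_finite_roots Sdef q10.
  move=> t s /q1P most; apply: (finite_of_pigeonhole (N := size r)) => w wS.
  have [z zP] := choice wS.
  have [j [l [jl E]]] := most z (fun j => proj1 (zP j)).
  exists j, l; split=> //.
  have [_ /= <-] := zP j; have [_ /= <-] := zP l; by rewrite E.
exists (H, q); split=> //= t s /HP{}HP a; apply: iff_trans (HP a).
by split=> [[z h1 h2]|[z [h1 h2]]]; exists z.
Qed.

(** The relations [P i] are those of [coord_poly] at s = 0 and pass to limits by continuity. For the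
    lines, the offending times form a definable set; were it cofinite, times tending to t0 would
    carry lines of zeros through bounded points, and suitable points of these lines would converge
    to two zeros at (t0, 0) that are too far apart. *)
Lemma limits_of_zeros : exists P : 'I_p -> {poly {poly C}}, exists g : {poly C},
  [/\ g != 0, forall i, P i != 0 & forall t, g.[t] != 0 ->
   forall (U : set_system nat), UltraFilter U -> \oo `<=` U -> forall u z,
   (\forall k \near U, F t (hseq R k) (u k) = 0) -> vcvg U u z ->
   (forall i, root (map_poly (horner_eval t) (P i)) (z 0 i)) /\
   forall v, v != 0 -> ~ (forall x : C, F t 0 (z + x *: v) = 0)].
Proof.
have [q1 q10 q1P] := at_most_generic.
have [d [M [d0 M0 bM]]] := zeros_bounded q1P.
have [f fP] := choice coord_poly.
pose q := q1 * \prod_i (f i).2.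
have q0 : q != 0.
  by rewrite mulf_neq0 //; apply/prodf_neq0 => i _; have [] := fP i.
have q_q1 t s : ev2 t s q != 0 -> ev2 t s q1 != 0.
  by rewrite rmorphM mulf_eq0 negb_or => /andP[].
have q_f t s i : ev2 t s q != 0 -> ev2 t s (f i).2 != 0.
  rewrite rmorphM mulf_eq0 negb_or => /andP[_]; rewrite rmorph_prod => /prodf_neq0.
  exact.
pose P i := map_poly (horner_eval 0) (f i).1.
have P0 i : P i != 0 by have [] := fP i.
have evP t i : map_poly (ev2 t 0) (f i).1 = map_poly (horner_eval t) (P i).
  by rewrite /P -map_poly_comp /=; apply: eq_map_poly => c; rewrite /= ev2E.
(* Where [g1] does not vanish, q(t, .) is not the zero polynomial, so [hseq R k] eventually avoids
   its roots, and each [P i] remains nonzero at t. *)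
pose g1 := lead_coef q * \prod_i lead_coef (P i).
have g10 : g1 != 0.
  by rewrite mulf_neq0 ?lead_coef_eq0 //; apply/prodf_neq0 => i _; rewrite lead_coef_eq0.
have g1q t : g1.[t] != 0 -> \forall k \near \oo, ev2 t (hseq R k) q != 0.
  rewrite hornerM mulf_eq0 negb_or => /andP[lq _].
  have := poly_hseq_near (map_poly_lead_neq0 (h := horner_eval t) lq).
  by apply: filterS => k; rewrite ev2_swap.
have g1P t i : g1.[t] != 0 -> map_poly (horner_eval t) (P i) != 0.
  rewrite hornerM mulf_eq0 negb_or => /andP[_ lP]; apply: map_poly_lead_neq0.
  move: lP; rewrite horner_prod => /prodf_neq0; exact.
(* The relations [P i] stand in for being a limit of zeros; they suffice to bound [z] by
   [root_bound_limit]. *)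
pose Psi t z v := [/\ F t 0 z = 0,
   forall i, root (map_poly (horner_eval t) (P i)) (z 0 i), v != 0 &
   forall x : C, F t 0 (z + x *: v) = 0].
pose S (e : seq C) := exists w : 'rV[C]_(p + p), Psi e`_0 (lsubmx w) (rsubmx w).
have Sdef : definable S.
  apply: (@definable_exrow _ 1 (p + p) (fun e w => Psi e`_0 (lsubmx w) (rsubmx w))).
    by move=> e e' w ee'; rewrite ee'.
  have pl b (j : 'I_p) : polyfun (fun e : seq C => lsubmx (env_row b (p + p) e) 0 j).
    by apply: polyfun_ext (polyfun_var _ (b + lshift p j)) => e; rewrite !mxE.
  have pr b (j : 'I_p) : polyfun (fun e : seq C => rsubmx (env_row b (p + p) e) 0 j).
    by apply: polyfun_ext (polyfun_var _ (b + rshift p j)) => e; rewrite !mxE.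
  apply: (@definable_ext _ (fun e => (F e`_0 0 (lsubmx (env_row 1 (p + p) e)) = 0 /\
     forall i, (map_poly (ev2 e`_0 0) (f i).1).[lsubmx (env_row 1 (p + p) e) 0 i] = 0) /\
     (~ (rsubmx (env_row 1 (p + p) e) = 0) /\
      forall x : C, F e`_0 0 (lsubmx (env_row 1 (p + p) e) + x *: rsubmx (env_row 1 (p + p) e)) = 0))).
    move=> e; split=> [[[h1 h2] [h3 h4]]|[h1 h2 h3 h4]].
      have h2' i : root (map_poly (horner_eval e`_0) (P i)) (lsubmx (env_row 1 (p + p) e) 0 i).
        by rewrite rootE -evP h2.
      have h3' : rsubmx (env_row 1 (p + p) e) != 0 by exact/eqP.
      exact: And4 h1 h2' h3' h4.
    have h2' i : (map_poly (ev2 e`_0 0) (f i).1).[lsubmx (env_row 1 (p + p) e) 0 i] = 0.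
      by rewrite evP; apply/eqP; exact: h2.
    by have h3' := elimN eqP h3.
  apply: definable_and; apply: definable_and.
  - by apply: definable_zero; [exact: polyfun_var | exact: polyfun_cst | exact: pl].
  - apply: definable_bigand => i; apply: definable_eq0; apply: polyfun_ev3.
    + exact: polyfun_var.
    + exact: polyfun_cst.
    + exact: pl.
  - apply: definable_not; apply: definable_eq_row; [exact: pr | exact: polyfun_row0].
  (* The universal variable [x] gets the first free position, right after the block that holds z and
     v. *)
  pose S' (e : seq C) := F e`_0 0 (lsubmx (env_row 1 (p + p) e) +
     e`_(1 + (p + p)) *: rsubmx (env_row 1 (p + p) e)) = 0.
  apply: (@definable_ext _ (fun e => forall x, S' (set_nth 0 e (1 + (p + p))%N x))).
    move=> e; split=> H x; have := H x; rewrite /S' env_row_set_nth ?leqnn ?orbT //.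
      by rewrite !nth_set_nth /= eqxx.
    by rewrite !nth_set_nth /= eqxx.
  apply: definable_all; apply: definable_zero; [exact: polyfun_var | exact: polyfun_cst|].
  move=> j; apply: polyfun_ext (polyfunD (pl 1 j) (polyfunM (polyfun_var _ (1 + (p + p))) (pr 1 j))).
  by move=> e; rewrite [RHS]mxE; congr (_ + _); rewrite [RHS]mxE.
have [g2 g20 g2P] := definable_generic1 Sdef.
have {g2P} g2P : forall t, g2.[t] != 0 -> ~ S [:: t].
  case: g2P => // g2P; exfalso.
  have [U UU sU] := nat_ultrafilter.
  pose t_ k := t0 + hseq R k.
  have tgood : \forall k \near U, g1.[t_ k] != 0 /\ g2.[t_ k] != 0.
    by apply: sU; apply: filterS2 (poly_shift_near t0 g10) (poly_shift_near t0 g20).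
  have hsmall : \forall k \near U, csq (hseq R k) < d.
    have hc : (fun k => csq (hseq R k)) @ U --> csq (0 : C).
      by apply: (@cvg_csq _ _ _ _ (hseq R)); exact: hseq_cvg.
    by apply: (cvgr_lt _ hc); rewrite csq0.
  have H k : exists zv : 'rV[C]_p * 'rV[C]_p,
      g1.[t_ k] != 0 /\ g2.[t_ k] != 0 -> Psi (t_ k) zv.1 zv.2.
    have [[n1 n2]|n] := pselect (g1.[t_ k] != 0 /\ g2.[t_ k] != 0).
      by have [w wP] := g2P _ n2; exists (lsubmx w, rsubmx w).
    by exists (0, 0).
  have [zv zvP] := choice H.
  (* The roots of [(f i).1] at (t_ k, hseq R j) are coordinates of zeros, bounded through [M] near
     (t0, 0); the roots of [P i] at [t_ k] inherit the bound as j grows. *)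
  have zb : \forall k \near U, vsq (zv k).1 <= p%:R * (2 * M + 2).
    have := hsmall; have := tgood; apply: filterS2 => k gk hk; have [_ rz _ _] := zvP k gk.
    have -> : p%:R * (2 * M + 2) = \sum_(i < p) (2 * M + 2).
      by rewrite sumr_const card_ord mulr_natl.
    apply: ler_sum => i _.
    apply: (root_bound_limit UU sU M0 (H := (f i).1) (t := t_ k)).
    - by rewrite evP; apply: g1P; case: gk.
    - have := sU _ (g1q _ (proj1 gk)) => gq.
      have := hsmall; have := gq; apply: filterS2 => j qj hj x.
      have [_ _ fP'] := fP i; move/(fP' _ _ (q_f _ _ i qj)) => [z Fz <-].
      apply: le_trans (csq_le_vsq z i) _.
      apply: (bM (t_ k) (hseq R j)) => //; last exact: q_q1.
      by rewrite /t_ addrC addKr.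
    - by rewrite evP; apply: rz.
  (* [D] exceeds every squared distance between zeros at (t0, 0); the points [w_] below lie on the
     lines, at squared distance [D] from the base points. *)
  pose D : R := 1 + \sum_(z <- r) \sum_(z' <- r) vsq (z - z').
  have S0 (l : seq 'rV[C]_p) z : 0 <= \sum_(z' <- l) vsq (z - z').
    by apply: sumr_ge0 => z' _; apply: vsq_ge0.
  have DP z z' : z \in r -> z' \in r -> vsq (z - z') < D.
    move=> zr zr'; rewrite /D (big_rem z) //= (big_rem z') //=.
    have h1 := S0 (rem z' r) z.
    have : 0 <= \sum_(y <- rem z r) \sum_(z'0 <- r) vsq (y - z'0).
      by apply: sumr_ge0 => y _; apply: S0.
    lra.
  have D0 : 0 < D.
    rewrite ltr_pwDl //; apply: sumr_ge0 => y _; exact: S0.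
  pose w_ k := (zv k).1 + (Num.sqrt (D / vsq (zv k).2))%:C *: (zv k).2.
  have wD k : g1.[t_ k] != 0 /\ g2.[t_ k] != 0 -> vsq (w_ k - (zv k).1) = D.
    move=> /zvP[_ _ v0 _]; rewrite /w_ addrC addKr vsqZ csq_real.
    have vv := vsq_gt0 v0.
    by rewrite sqr_sqrtr ?divfK ?gt_eqF // divr_ge0 // ltW.
  have tc : ccvg U t_ t0.
    rewrite -[X in ccvg _ _ X]addr0; apply: ccvgD; first exact: ccvg_cst.
    exact: hseq_cvg.
  have [z zc] := ultra_bounded_vcvg zb.
  have [|w wc] := @ultra_bounded_vcvg R nat U UU p w_ (2 * D + 2 * (p%:R * (2 * M + 2))).
    have := zb; have := tgood; apply: filterS2 => k gk zk; rewrite -[w_ k](subrK (zv k).1).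
    apply: le_trans (vsqD_le _ _) _; rewrite wD // lerD2l ler_pM2l //.
  have lim0 (x : nat -> 'rV[C]_p) l : vcvg U x l ->
     (\forall k \near U, F (t_ k) 0 (x k) = 0) -> l \in r.
    move=> xl x0; apply/r_zeros; apply/rowP => i; rewrite mxE.
    have Fl : vcvg U (fun k => F (t_ k) 0 (x k)) (F t0 0 l).
      exact: family_cvg tc (ccvg_cst 0) xl.
    by apply: (ccvg_eq0 _ (Fl i)); apply: filterS x0 => k ->; rewrite mxE.
  have zr : z \in r.
    by apply: (lim0 _ _ zc); have := tgood; apply: filterS => k /zvP[].
  have wr : w \in r.
    by apply: (lim0 _ _ wc); have := tgood; apply: filterS => k /zvP[_ _ _]; apply.
  have wz : (fun k => vsq (w_ k - (zv k).1)) @ U --> vsq (w - z).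
    by apply: (@cvg_vsq _ _ _ _ _ (fun k => w_ k - (zv k).1)); exact: vcvgB.
  have : D <= vsq (w - z).
    apply: (ler_cvg_to (cvg_cst D) wz).
    by have := tgood; apply: filterS => k /wD->.
  by rewrite leNgt DP.
exists P, (g1 * g2); split=> //; first by rewrite mulf_neq0.
move=> t; rewrite hornerM mulf_eq0 negb_or => /andP[n1 n2] U UU sU u z u0 uz.
have sc : ccvg U (hseq R) 0 by exact: hseq_cvg.
have rz i : root (map_poly (horner_eval t) (P i)) (z 0 i).
  rewrite -evP rootE; apply/eqP.
  have c3 : ccvg U (fun k => (map_poly (ev2 t (hseq R k)) (f i).1).[u k 0 i])
      (map_poly (ev2 t 0) (f i).1).[z 0 i].
    by apply: ev3_cvg (uz i); [exact: ccvg_cst | exact: sc].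
  apply: (ccvg_eq0 _ c3); apply: filterS2 (sU _ (g1q t n1)) u0 => k qk uk.
  have [_ _ fP'] := fP i; apply/eqP; apply/(fP' _ _ (q_f _ _ i qk)).
  by exists (u k).
split=> // v v0 vl; apply: (g2P t n2); exists (row_mx z v).
rewrite row_mxKl row_mxKr; split=> //.
by have := vl 0; rewrite scale0r addr0.
Qed.

End QuadraticFamily.

(** * Optimality conditions under strict feasibility *)

Section Psd.
Variable R : realType.

Definition qform n (X : 'M[R]_n) (v : 'cV[R]_n) : R := (v^T *m X *m v) 0 0.

Lemma qformD n (X Y : 'M[R]_n) v : qform (X + Y) v = qform X v + qform Y v.
Proof. by rewrite /qform mulmxDr mulmxDl mxE. Qed.

Lemma qformZ n a (X : 'M[R]_n) v : qform (a *: X) v = a * qform X v.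
Proof. by rewrite /qform -scalemxAr -scalemxAl mxE. Qed.

Lemma psdD n (X Y : 'M[R]_n) : psd X -> psd Y -> psd (X + Y).
Proof.
move=> [sX pX] [sY pY]; split; first by rewrite /symm linearD /= sX sY.
by move=> v; rewrite -/(qform _ _) qformD addr_ge0 //; [apply: pX | apply: pY].
Qed.

Lemma psdZ n a (X : 'M[R]_n) : 0 <= a -> psd X -> psd (a *: X).
Proof.
move=> a0 [sX pX]; split; first by rewrite /symm linearZ /= sX.
by move=> v; rewrite -/(qform _ _) qformZ mulr_ge0 //; apply: pX.
Qed.

Lemma psd0 n : psd (0 : 'M[R]_n).
Proof. by split=> [|v]; [rewrite /symm trmx0 | rewrite mulmx0 mul0mx mxE]. Qed.

Lemma pd_psd n (X : 'M[R]_n) : pd X -> psd X.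
Proof.
move=> [sX pX]; split=> // v; have [->|v0] := eqVneq v 0; last exact/ltW/pX.
by rewrite mulmx0 mxE.
Qed.

Lemma psd_outer n (v : 'cV[R]_n) : psd (v *m v^T).
Proof.
split=> [|w]; first by rewrite /symm trmx_mul trmxK.
rewrite mulmxA -mulmxA -[w^T *m v]trmxK trmx_mul trmxK.
by rewrite mxE big_ord1 mxE -expr2 sqr_ge0.
Qed.

(** Block elimination in the style of Cholesky: the Schur complement M - r^T r / a is again positive
    semidefinite. A zero pivot forces its row to vanish, so the convention 0^-1 = 0 lets one formula
    cover both cases. *)
Lemma psd_factor n (X : 'M[R]_n) : psd X -> exists L : 'M[R]_n, X = L *m L^T.
Proof.
elim: n X => [|n IH] X [sX pX]; first by exists 0; rewrite [LHS]flatmx0 [RHS]flatmx0.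
rewrite -[n.+1]/(1 + n)%N in X sX pX *.
pose a := ulsubmx X 0 0; pose r : 'rV[R]_n := ursubmx X; pose M := drsubmx X.
have ulE : ulsubmx X = a%:M by exact: mx11_scalar.
have dlE : dlsubmx X = r^T by rewrite /r trmx_ursub sX.
have XE : X = block_mx a%:M r r^T M by rewrite -ulE -dlE submxK.
have sM : M^T = M by rewrite /M trmx_drsub sX.
have q x (w : 'cV[R]_n) : 0 <= a * x ^+ 2 + 2 * x * (r *m w) 0 0 + qform M w.
  have := pX (col_mx x%:M w); rewrite {1}XE tr_col_mx mul_row_block mul_row_col.
  have mD (A B : 'M[R]_1) : (A + B) 0 0 = A 0 0 + B 0 0 by rewrite mxE.
  rewrite tr_scalar_mx !mulmxDl !mD -/(qform M w).
  have -> : (x%:M *m a%:M *m x%:M : 'M[R]_1) 0 0 = a * x ^+ 2.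
    by rewrite -!scalar_mxM mxE eqxx mulr1n; ring.
  have -> : (w^T *m r^T *m x%:M : 'M[R]_1) 0 0 = x * (r *m w) 0 0.
    by rewrite mul_mx_scalar mxE -trmx_mul mxE.
  have -> : (x%:M *m r *m w : 'M[R]_1) 0 0 = x * (r *m w) 0 0.
    by rewrite mul_scalar_mx -scalemxAl mxE.
  by move=> H; apply: le_trans H _; rewrite /qform; lra.
have a0 : 0 <= a.
  have := q 1 0; rewrite mulmx0 mxE /qform mulmx0 mxE; lra.
have r0 : a = 0 -> r = 0.
  move=> E; apply/rowP => i; rewrite [RHS]mxE.
  have ri : (r *m (delta_mx i 0 : 'cV[R]_n)) 0 0 = r 0 i by rewrite -colE mxE.
  have H x := q x (delta_mx i 0).
  apply/eqP; apply: contraT => rn.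
  (* For a = 0 the form is affine in [x], and this [x] gives it the value -1. *)
  have := H (- (qform M (delta_mx i 0) + 1) / (2 * r 0 i)); rewrite E ri.
  set Q := qform _ _.
  have -> : 2 * (- (Q + 1) / (2 * r 0 i)) * r 0 i = - (Q + 1) by field.
  lra.
have [L' L'E] : exists L' : 'M[R]_n, M - a^-1 *: (r^T *m r) = L' *m L'^T.
  apply: IH; split=> [|w].
    by rewrite /symm linearB linearZ /= trmx_mul trmxK sM.
  rewrite -/(qform _ _) -scaleN1r qformD !qformZ.
  have -> : qform (r^T *m r) w = (r *m w) 0 0 ^+ 2.
    rewrite /qform mulmxA -trmx_mul -mulmxA mxE big_ord1 mxE expr2 //.
  have [E|an] := eqVneq a 0.
    by rewrite r0 // mul0mx mxE; have := q 0 w; lra.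
  (* The minimum of the form over [x] is the Schur complement evaluated at [w]. *)
  have := q (- a^-1 * (r *m w) 0 0) w.
  set t := (r *m w) 0 0; set Q := qform _ _.
  have -> : a * (- a^-1 * t) ^+ 2 + 2 * (- a^-1 * t) * t + Q = Q + -1 * (a^-1 * t ^+ 2).
    by field.
  by [].
pose s := Num.sqrt a; have s2 : s * s = a by rewrite -expr2 sqr_sqrtr.
exists (block_mx s%:M 0 (s^-1 *: r^T) L' : 'M[R]_(1 + n)).
rewrite tr_block_mx mulmx_block !trmx0 !mulmx0 !mul0mx !addr0 tr_scalar_mx.
rewrite linearZ /= trmxK -scalar_mxM s2 mul_scalar_mx mul_mx_scalar -scalemxAl -scalemxAr.
rewrite !scalerA -L'E {1}XE.
have [E|an] := eqVneq a 0.
  by rewrite r0 // trmx0 mul0mx !scaler0 !subr0 add0r.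
have sn : s != 0 by apply: contraNneq an => E; rewrite -s2 E mul0r.
by rewrite mulfV // !scale1r -invfM s2 addrC subrK.
Qed.

Lemma qform_gram n p (L : 'M[R]_(n, p)) v : qform (L *m L^T) v = \sum_i ((L^T *m v) i 0) ^+ 2.
Proof.
rewrite /qform mulmxA -mulmxA -[v^T *m L]trmxK trmx_mul trmxK mxE.
by apply: eq_bigr => i _; rewrite mxE expr2.
Qed.

Lemma psd_qform0 n (X : 'M[R]_n) (v : 'cV[R]_n) : psd X -> qform X v = 0 -> X *m v = 0.
Proof.
move=> /psd_factor[L ->]; rewrite qform_gram => /eqP.
rewrite psumr_eq0 => [/allP H|i _]; last exact: sqr_ge0.
rewrite -mulmxA; suff -> : L^T *m v = 0 by rewrite mulmx0.
apply/colP => i; rewrite [RHS]mxE; apply/eqP; rewrite -sqrf_eq0.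
exact: H i (mem_index_enum i).
Qed.

Lemma innerC n (X Y : 'M[R]_n) : inner X Y = inner Y X.
Proof. exact: mxtrace_mulC. Qed.

Lemma innerDr n (X Y Z : 'M[R]_n) : inner X (Y + Z) = inner X Y + inner X Z.
Proof. by rewrite /inner mulmxDr mxtraceD. Qed.

Lemma innerZr n a (X Y : 'M[R]_n) : inner X (a *: Y) = a * inner X Y.
Proof. by rewrite /inner -scalemxAr mxtraceZ. Qed.

Lemma innerBr n (X Y Z : 'M[R]_n) : inner X (Y - Z) = inner X Y - inner X Z.
Proof. by rewrite innerDr -scaleN1r innerZr mulN1r. Qed.

Lemma inner_outer n (X : 'M[R]_n) (v : 'cV[R]_n) : inner X (v *m v^T) = qform X v.
Proof.
by rewrite /inner mulmxA mxtrace_mulC mulmxA /qform /mxtrace big_ord1.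
Qed.

Lemma inner_gram n p (X : 'M[R]_n) (L : 'M[R]_(n, p)) :
  inner X (L *m L^T) = \sum_i qform X (col i L).
Proof.
rewrite /inner mulmxA mxtrace_mulC mulmxA /mxtrace; apply: eq_bigr => i _.
by rewrite /qform tr_col -row_mul mxE [RHS]mxE; apply: eq_bigr => j _; rewrite !mxE.
Qed.

Lemma psd_inner_ge0 n (X Z : 'M[R]_n) : psd X -> psd Z -> 0 <= inner X Z.
Proof.
move=> pX /psd_factor[L ->]; rewrite inner_gram; apply: sumr_ge0 => i _.
by case: pX => _; apply.
Qed.

Lemma psd_inner_eq0 n (X Z : 'M[R]_n) : psd X -> psd Z -> inner X Z = 0 -> X *m Z = 0.
Proof.
move=> pX /psd_factor[L ->]; rewrite inner_gram => /eqP.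
rewrite psumr_eq0 => [/allP H|i _]; last by case: pX => _; apply.
rewrite mulmxA; suff -> : X *m L = 0 by rewrite mul0mx.
apply/matrixP => i j; rewrite [RHS]mxE.
have /(psd_qform0 pX) : qform X (col j L) = 0 by apply/eqP; exact: H j (mem_index_enum j).
by rewrite colE mulmxA -colE => /colP/(_ i); rewrite !mxE.
Qed.

Lemma pd_inner_le0 n (X Z : 'M[R]_n) : pd X -> psd Z -> inner X Z <= 0 -> Z = 0.
Proof.
move=> pX pZ le0; have pX' := pd_psd pX.
have E : inner X Z = 0 by apply/eqP; rewrite eq_le le0 psd_inner_ge0.
have XZ := psd_inner_eq0 pX' pZ E.
apply/matrixP => i j; rewrite [RHS]mxE.
have [c0|cn] := eqVneq (col j Z) 0.
  by have /colP/(_ i) := c0; rewrite !mxE.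
case: pX => _ /(_ _ cn); by rewrite [col j Z]colE -mulmxA [X *m _]mulmxA XZ mul0mx mulmx0 mxE ltxx.
Qed.

Lemma psd_of_inner n (Z : 'M[R]_n) : symm Z -> (forall P, psd P -> 0 <= inner Z P) -> psd Z.
Proof.
move=> sZ H; split=> // v; rewrite -/(qform Z v) -inner_outer.
exact/H/psd_outer.
Qed.

End Psd.

Definition slack (K : comNzRingType) (n m : nat) (D : sdp_data K n m) (y : 'cV[K]_m) : 'M[K]_n :=
  dC D - adjA D y.

Section Linearity.
Variables (K : comNzRingType) (n m : nat) (D : sdp_data K n m).
Implicit Types (X : 'M[K]_n) (y : 'cV[K]_m).

Lemma adjAD y y' : adjA D (y + y') = adjA D y + adjA D y'.
Proof. by rewrite -big_split; apply: eq_bigr => i _; rewrite mxE scalerDl. Qed.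

Lemma adjAZ a y : adjA D (a *: y) = a *: adjA D y.
Proof. by rewrite /adjA scaler_sumr; apply: eq_bigr => i _; rewrite mxE scalerA. Qed.

Lemma opAD X X' : opA D (X + X') = opA D X + opA D X'.
Proof. by apply/colP => i; rewrite !mxE /inner mulmxDr mxtraceD. Qed.

Lemma opAZ a X : opA D (a *: X) = a *: opA D X.
Proof. by apply/colP => i; rewrite !mxE /inner -scalemxAr mxtraceZ. Qed.

End Linearity.

Section Duality.
Variables (R : realType) (n m : nat).
Implicit Types (D : sdp_data R n m) (X Z : 'M[R]_n) (y : 'cV[R]_m).

Lemma dotvC y y' : dotv y y' = dotv y' y.
Proof. by apply: eq_bigr => i _; rewrite mulrC. Qed.

Lemma dotvDr y y1 y2 : dotv y (y1 + y2) = dotv y y1 + dotv y y2.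
Proof. by rewrite -big_split; apply: eq_bigr => i _; rewrite mxE mulrDr. Qed.

Lemma dotvZr a y y' : dotv y (a *: y') = a * dotv y y'.
Proof. by rewrite /dotv mulr_sumr; apply: eq_bigr => i _; rewrite mxE mulrCA. Qed.

Lemma dotvBr y y1 y2 : dotv y (y1 - y2) = dotv y y1 - dotv y y2.
Proof. by rewrite dotvDr -scaleN1r dotvZr mulN1r. Qed.

Lemma dotv_ge0 y : 0 <= dotv y y.
Proof. by apply: sumr_ge0 => i _; rewrite -expr2 sqr_ge0. Qed.

Lemma inner_adjA D y X : inner X (adjA D y) = dotv (opA D X) y.
Proof.
rewrite innerC /inner /adjA mulmx_suml raddf_sum /=; apply: eq_bigr => i _.
by rewrite -scalemxAl mxtraceZ mulrC mxE.
Qed.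

Lemma licq_adjA_inj D y : licq D -> adjA D y = 0 -> y = 0.
Proof.
move=> fr y0; pose A := [seq dA D i | i <- enum 'I_m].
have sA : size A == m by rewrite size_map size_enum_ord.
have /freeP frA : free (Tuple sA) by exact: fr.
apply/colP => i; rewrite [RHS]mxE; apply: (frA (fun j => y j 0)).
rewrite -[RHS]y0; apply: eq_bigr => j _; congr (_ *: _).
by rewrite /= (nth_map j) ?size_enum_ord // nth_ord_enum.
Qed.

Definition kkt D X y : Prop :=
  [/\ opA D X = db D, psd X, psd (slack D y) & inner X (slack D y) = 0].

End Duality.

(** * Entrywise limits of real matrices and of data *)

Section Limit.
Variables (R : realType) (U : set_system nat).
Context {FU : ProperFilter U}.

Definition mcvg a b (X : nat -> 'M[R]_(a, b)) (L : 'M[R]_(a, b)) : Prop :=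
  forall i j, (fun k => X k i j) @ U --> L i j.

Lemma cvg_fin_sum (K : Type) (r : seq K) (f : K -> nat -> R) (l : K -> R) :
  (forall k, f k @ U --> l k) -> (fun j => \sum_(k <- r) f k j) @ U --> \sum_(k <- r) l k.
Proof. by move=> fl; apply: cvg_big => [|k _]; [exact: add_continuous | exact: fl]. Qed.

Lemma mcvg_cst a b (L : 'M[R]_(a, b)) : mcvg (fun=> L) L.
Proof. by move=> i j; apply: cvg_cst. Qed.

Lemma mcvg_ext a b (X X' : nat -> 'M[R]_(a, b)) L : X =1 X' -> mcvg X L -> mcvg X' L.
Proof. by move=> /funext<-. Qed.

Lemma mcvgD a b (X Y : nat -> 'M[R]_(a, b)) L M : mcvg X L -> mcvg Y M ->
  mcvg (fun k => X k + Y k) (L + M).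
Proof.
move=> XL YM i j; rewrite mxE.
have -> : (fun k => (X k + Y k) i j) = (fun k => X k i j + Y k i j).
  by apply/funext => k; rewrite mxE.
by apply: cvgD; [exact: XL | exact: YM].
Qed.

Lemma mcvgZ a b (x : nat -> R) (X : nat -> 'M[R]_(a, b)) (l : R) L : x @ U --> l -> mcvg X L ->
  mcvg (fun k => x k *: X k) (l *: L).
Proof.
move=> xl XL i j; rewrite mxE.
have -> : (fun k => (x k *: X k) i j) = (fun k => x k * X k i j) by apply/funext => k; rewrite mxE.
by apply: cvgM => //; exact: XL.
Qed.

Lemma mcvgB a b (X Y : nat -> 'M[R]_(a, b)) L M : mcvg X L -> mcvg Y M ->
  mcvg (fun k => X k - Y k) (L - M).
Proof.
move=> XL YM; apply: mcvgD => //; rewrite -scaleN1r.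
apply: (@mcvg_ext _ _ (fun k => -1 *: Y k)); first by move=> k; rewrite scaleN1r.
by apply: (mcvgZ (x := fun=> -1)) => //; apply: cvg_cst.
Qed.

Lemma mcvgM a b c (X : nat -> 'M[R]_(a, b)) (Y : nat -> 'M[R]_(b, c)) L M :
  mcvg X L -> mcvg Y M -> mcvg (fun k => X k *m Y k) (L *m M).
Proof.
move=> XL YM i j; rewrite mxE.
have -> : (fun k => (X k *m Y k) i j) = (fun k => \sum_l X k i l * Y k l j).
  by apply/funext => k; rewrite mxE.
by apply: cvg_fin_sum => l; apply: cvgM; [exact: XL | exact: YM].
Qed.

Lemma cvg_inner n (X Y : nat -> 'M[R]_n) L M : mcvg X L -> mcvg Y M ->
  (fun k => inner (X k) (Y k)) @ U --> inner L M.
Proof. by move=> XL YM; apply: cvg_fin_sum => l; apply: mcvgM. Qed.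

Lemma cvg_dotv m (X Y : nat -> 'cV[R]_m) L M : mcvg X L -> mcvg Y M ->
  (fun k => dotv (X k) (Y k)) @ U --> dotv L M.
Proof.
by move=> XL YM; apply: cvg_fin_sum => l; apply: cvgM; [exact: XL | exact: YM].
Qed.

Lemma mcvg_unique a b (X : nat -> 'M[R]_(a, b)) L M : mcvg X L -> mcvg X M -> L = M.
Proof.
move=> XL XM; apply/matrixP => i j.
exact: (cvg_unique (@Rhausdorff R) (XL i j) (XM i j)).
Qed.

Lemma cvg_near (f g : nat -> R) (l : R) :
  (\forall k \near U, f k = g k) -> f @ U --> l -> g @ U --> l.
Proof. by move=> fg fl; apply: cvg_trans fl; apply: near_eq_cvg; apply: filterS fg => k ->. Qed.

Lemma mcvg_near a b (X Y : nat -> 'M[R]_(a, b)) L :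
  (\forall k \near U, X k = Y k) -> mcvg X L -> mcvg Y L.
Proof.
move=> XY XL i j; apply: cvg_trans (XL i j); apply: near_eq_cvg.
by apply: filterS XY => k ->.
Qed.

Lemma psd_closed n (X : nat -> 'M[R]_n) L : (\forall k \near U, psd (X k)) ->
  mcvg X L -> psd L.
Proof.
move=> pX XL; split.
  apply/matrixP => i j; rewrite mxE.
  apply: (cvg_unique (@Rhausdorff R) _ (XL i j)).
  apply: cvg_trans (XL j i); apply: near_eq_cvg; apply: filterS pX => k [sX _].
  by rewrite -{1}sX mxE.
move=> v.
have c : (fun k => (v^T *m X k *m v) 0 0) @ U --> (v^T *m L *m v) 0 0.
  by apply: mcvgM; [apply: mcvgM => //|]; apply: mcvg_cst.
have H : \forall k \near U, (0 : R) <= (v^T *m X k *m v) 0 0.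
  by move: pX; apply: filterS => k [_ pXk]; exact: pXk.
exact: (ler_cvg_to (cvg_cst (0 : R)) c H).
Qed.

Variables (n m : nat).

Definition dcvg (D : nat -> sdp_data R n m) (L : sdp_data R n m) : Prop :=
  [/\ forall i, mcvg (fun k => dA (D k) i) (dA L i), mcvg (fun k => db (D k)) (db L)
    & mcvg (fun k => dC (D k)) (dC L)].

Lemma dcvg_cst L : dcvg (fun=> L) L.
Proof. by split=> [i||]; apply: mcvg_cst. Qed.

Lemma mcvg_opA D L (X : nat -> 'M[R]_n) X' : dcvg D L -> mcvg X X' ->
  mcvg (fun k => opA (D k) (X k)) (opA L X').
Proof.
move=> [DA _ _] XX i j; rewrite mxE.
have -> : (fun k => opA (D k) (X k) i j) = (fun k => inner (dA (D k) i) (X k)).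
  by apply/funext => k; rewrite mxE.
exact: cvg_inner.
Qed.

Lemma mcvg_adjA D L (y : nat -> 'cV[R]_m) y' : dcvg D L -> mcvg y y' ->
  mcvg (fun k => adjA (D k) (y k)) (adjA L y').
Proof.
move=> [DA _ _] yy i j; rewrite /adjA summxE; under eq_fun do rewrite summxE.
apply: cvg_fin_sum => l; rewrite mxE; under eq_fun do rewrite mxE.
by apply: cvgM; [exact: yy | exact: DA].
Qed.

Lemma mcvg_slack D L (y : nat -> 'cV[R]_m) y' : dcvg D L -> mcvg y y' ->
  mcvg (fun k => slack (D k) (y k)) (slack L y').
Proof. by move=> DL yy; have [_ _ DC] := DL; apply: mcvgB => //; exact: mcvg_adjA. Qed.

End Limit.

(** * Compactness of KKT points under strict feasibility *)

Section Compactness.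
Variables (R : realType) (U : set_system nat).
Context {UU : UltraFilter U}.
Variables (n m : nat).
Implicit Types (D : sdp_data R n m).

Definition msq a b (X : 'M[R]_(a, b)) : R := \sum_i \sum_j X i j ^+ 2.

Lemma msq_ge0 a b (X : 'M[R]_(a, b)) : 0 <= msq X.
Proof. by apply: sumr_ge0 => i _; apply: sumr_ge0 => j _; apply: sqr_ge0. Qed.

Lemma msq0 a b : msq (0 : 'M[R]_(a, b)) = 0.
Proof. by rewrite /msq big1 // => i _; rewrite big1 // => j _; rewrite mxE expr0n. Qed.

Lemma sqr_le_msq a b (X : 'M[R]_(a, b)) i j : X i j ^+ 2 <= msq X.
Proof.
rewrite /msq (bigD1 i) //= (bigD1 j) //= -addrA lerDl addr_ge0 //.
  by apply: sumr_ge0 => k _; apply: sqr_ge0.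
by apply: sumr_ge0 => k _; apply: sumr_ge0 => l _; apply: sqr_ge0.
Qed.

Lemma msqZ a b t (X : 'M[R]_(a, b)) : msq (t *: X) = t ^+ 2 * msq X.
Proof.
rewrite /msq mulr_sumr; apply: eq_bigr => i _; rewrite mulr_sumr.
by apply: eq_bigr => j _; rewrite mxE exprMn.
Qed.

Lemma cvg_msq a b (X : nat -> 'M[R]_(a, b)) L : mcvg U X L ->
  (fun k => msq (X k)) @ U --> msq L.
Proof.
move=> XL; apply: cvg_fin_sum => i; apply: cvg_fin_sum => j.
by rewrite expr2; under eq_fun do rewrite expr2; apply: cvgM; exact: XL.
Qed.

Lemma mcvg_bounded a b (X : nat -> 'M[R]_(a, b)) (M : R) :
  (\forall k \near U, msq (X k) <= M) -> exists L, mcvg U X L.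
Proof.
move=> XM.
have H (ij : 'I_a * 'I_b) : exists l : R, (fun k => X k ij.1 ij.2) @ U --> l.
  apply: (@ultra_bounded_sqr_cvg R nat U UU _ M); move: XM; apply: filterS => k.
  by apply: le_trans; exact: sqr_le_msq.
have [f fP] := choice H.
by exists (\matrix_(i, j) f (i, j)) => i j; rewrite mxE; exact: (fP (i, j)).
Qed.

(** The triple (1, X, y) is scaled to the unit sphere, where limits exist. A limit with th' = 0 is a
    nonzero recession direction; otherwise the sequence itself converges. *)
Lemma scale_limit (X : nat -> 'M[R]_n) (y : nat -> 'cV[R]_m) :
  exists th : nat -> R, exists th' : R, exists X' y', [/\ forall k, 0 < th k, th @ U --> th',
    mcvg U (fun k => th k *: X k) X', mcvg U (fun k => th k *: y k) y' &
    th' ^+ 2 + msq X' + msq y' = 1].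
Proof.
pose N k := 1 + msq (X k) + msq (y k).
have N1 k : 1 <= N k by rewrite /N -addrA lerDl addr_ge0 ?msq_ge0.
have N0 k : 0 < N k by apply: lt_le_trans (N1 k).
pose th k := (Num.sqrt (N k))^-1.
have th0 k : 0 < th k by rewrite invr_gt0 sqrtr_gt0.
have th2 k : th k ^+ 2 * N k = 1.
  by rewrite exprVn sqr_sqrtr ?mulVf ?gt_eqF // ltW.
have E k : th k ^+ 2 + msq (th k *: X k) + msq (th k *: y k) = 1.
  by rewrite !msqZ -(th2 k) /N; ring.
have [|th' thc] := @ultra_bounded_cvg R nat U UU th 1.
  apply: nearW => k; rewrite ger0_norm; last exact/ltW/th0.
  by rewrite /th invf_le1 ?sqrtr_gt0 // -[1 in X in X <= _]sqrtr1 ler_wsqrtr.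
have [|X' Xc] := @mcvg_bounded _ _ (fun k => th k *: X k) 1.
  apply: nearW => k; rewrite -(E k) addrAC lerDr addr_ge0 ?sqr_ge0 ?msq_ge0 //.
have [|y' yc] := @mcvg_bounded _ _ (fun k => th k *: y k) 1.
  by apply: nearW => k; rewrite -(E k) lerDr addr_ge0 ?sqr_ge0 ?msq_ge0.
exists th, th', X', y'; split=> //.
have c : (fun k => th k ^+ 2 + msq (th k *: X k) + msq (th k *: y k)) @ U -->
    th' ^+ 2 + msq X' + msq y'.
  apply: cvgD; first apply: cvgD.
  - by rewrite expr2; under eq_fun do rewrite expr2; apply: cvgM.
  - exact: cvg_msq.
  - exact: cvg_msq.
apply: (cvg_unique (@Rhausdorff R) c).
have -> : (fun k => th k ^+ 2 + msq (th k *: X k) + msq (th k *: y k)) = (fun=> 1).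
  exact/funext.
exact: cvg_cst.
Qed.

Lemma mcvg_unscale a b (X : nat -> 'M[R]_(a, b)) X' (th : nat -> R) th' :
  (forall k, 0 < th k) -> th' != 0 -> th @ U --> th' -> mcvg U (fun k => th k *: X k) X' ->
  mcvg U X (th'^-1 *: X').
Proof.
move=> th0 thn thc Xc; apply: (mcvg_ext (X := fun k => (th k)^-1 *: (th k *: X k))).
  by move=> k; rewrite scalerA mulVf ?scale1r // gt_eqF.
by apply: mcvgZ => //; apply: cvgV.
Qed.

Definition strictly_feasible D : Prop :=
  (exists X, pd X /\ opA D X = db D) /\ (exists y, pd (slack D y)).

(* The perturbation [mu] covers both exact KKT points ([mu = 0]) and the
   minimizers of the quadratic penalty problem. *)
Definition perturbed_kkt D (mu : R) (X : 'M[R]_n) (y : 'cV[R]_m) : Prop :=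
  [/\ opA D X + mu *: y = db D, psd X, psd (slack D y) & inner X (slack D y) = 0].

Lemma kkt_perturbed D X y : kkt D X y <-> perturbed_kkt D 0 X y.
Proof. by rewrite /kkt /perturbed_kkt scale0r addr0. Qed.

Lemma kkt_closed (Ds : nat -> sdp_data R n m) D (X : nat -> 'M[R]_n)
    (y : nat -> 'cV[R]_m) (mu : nat -> R) X' y' :
  dcvg U Ds D -> mu @ U --> (0 : R) -> mcvg U X X' -> mcvg U y y' ->
  (\forall k \near U, perturbed_kkt (Ds k) (mu k) (X k) (y k)) -> kkt D X' y'.
Proof.
move=> DD mu0 XX yy H.
have Sc : mcvg U (fun k => slack (Ds k) (y k)) (slack D y') by exact: mcvg_slack.
split.
- have c1 : mcvg U (fun k => opA (Ds k) (X k) + mu k *: y k) (opA D X' + 0 *: y').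
    by apply: mcvgD; [apply: (mcvg_opA DD) | apply: mcvgZ].
  rewrite scale0r addr0 in c1; apply: (mcvg_unique c1).
  apply: (mcvg_near (X := fun k => db (Ds k))); last by case: DD.
  by move: H; apply: filterS => k [<-].
- by apply: (psd_closed _ XX); move: H; apply: filterS => k [].
- by apply: (psd_closed _ Sc); move: H; apply: filterS => k [].
have c1 : (fun k => inner (X k) (slack (Ds k) (y k))) @ U --> inner X' (slack D y').
  exact: cvg_inner.
apply: (cvg_unique (@Rhausdorff R) c1); apply: (@cvg_near _ _ _ (fun=> 0)).
  by move: H; apply: filterS => k [_ _ _ ->].
exact: cvg_cst.
Qed.

(** A recession direction (X', y') would have X' and Z' = - [adjA D y'] positive semidefinite.
    Pairing with strictly feasible points gives <X0, Z'> + <X', Z0> <= 0, so X' = 0 and Z' = 0, then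
    y' = 0 by injectivity, although the triple has norm 1. *)
Lemma kkt_compact (Ds : nat -> sdp_data R n m) D (X : nat -> 'M[R]_n)
    (y : nat -> 'cV[R]_m) (mu : nat -> R) :
  dcvg U Ds D -> (forall w, adjA D w = 0 -> w = 0) -> strictly_feasible D ->
  mu @ U --> (0 : R) ->
  (\forall k \near U, 0 <= mu k /\ perturbed_kkt (Ds k) (mu k) (X k) (y k)) ->
  exists X' y', [/\ mcvg U X X', mcvg U y y' & kkt D X' y'].
Proof.
move=> DD inj [[X0 [pX0 X0b]] [y0 pZ0]] mu0 H.
have [th [th' [X' [y' [th0 thc Xc yc E]]]]] := scale_limit X y.
pose Zs k := th k *: slack (Ds k) (y k).
pose Z' := th' *: dC D - adjA D y'.
have ZsE k : Zs k = th k *: dC (Ds k) - adjA (Ds k) (th k *: y k).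
  by rewrite /Zs /slack scalerBr adjAZ.
have [_ Db DC] := DD.
have Zc : mcvg U Zs Z'.
  apply: (mcvg_ext (X := fun k => th k *: dC (Ds k) - adjA (Ds k) (th k *: y k))) => [k|].
    by rewrite ZsE.
  by apply: mcvgB; [exact: mcvgZ | exact: mcvg_adjA].
have th'0 : 0 <= th'.
  by apply: (ler_cvg_to (cvg_cst (0 : R)) thc); apply: nearW => k; apply: ltW.
have pX' : psd X'.
  apply: psd_closed Xc; move: H; apply: filterS => k [_ [_ pX _ _]].
  by apply: psdZ => //; apply: ltW.
have pZ' : psd Z'.
  apply: psd_closed Zc; move: H; apply: filterS => k [_ [_ _ pZ _]].
  by apply: psdZ => //; apply: ltW.
have [th0'|thn] := eqVneq th' 0; last first.
  exists (th'^-1 *: X'), (th'^-1 *: y').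
  have XX : mcvg U X (th'^-1 *: X') by exact: mcvg_unscale Xc.
  have yy : mcvg U y (th'^-1 *: y') by exact: mcvg_unscale yc.
  split=> //; apply: (kkt_closed DD mu0 XX yy).
  by move: H; apply: filterS => k [].
exfalso.
(* Expanding both inner products below with the perturbed conditions gives [K k] minus th mu |y|^2,
   a nonnegative term that is dropped. [X0] satisfies the constraint for the limit data [D] only,
   whence the second summand. *)
pose K k := th k * (inner X0 (dC (Ds k)) - dotv (db (Ds k)) y0) +
  dotv (db (Ds k) - opA (Ds k) X0) (th k *: y k) + mu k * dotv y0 (th k *: y k).
have le k : 0 <= mu k /\ perturbed_kkt (Ds k) (mu k) (X k) (y k) ->
   inner X0 (Zs k) + inner (th k *: X k) (slack (Ds k) y0) <= K k.
  move=> [mk [AX _ _ XZ]].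
  have {}AX : opA (Ds k) (X k) = db (Ds k) - mu k *: y k by rewrite -AX addrK.
  have XC : inner (X k) (dC (Ds k)) = dotv (db (Ds k) - mu k *: y k) (y k).
    move: XZ; rewrite /slack innerBr inner_adjA AX => /eqP.
    by rewrite subr_eq0 => /eqP.
  rewrite [inner (th k *: _) _]innerC innerZr [inner (slack _ _) _]innerC.
  rewrite /slack innerBr inner_adjA AX XC /Zs innerZr /slack innerBr inner_adjA /K.
  rewrite !dotvZr ![dotv (_ - _) _]dotvC !dotvBr !dotvZr.
  rewrite [dotv (y k) (db _)]dotvC [dotv y0 (db _)]dotvC [dotv (y k) (opA _ _)]dotvC.
  rewrite -subr_ge0.
  have : 0 <= th k * (mu k * dotv (y k) (y k)) by rewrite !mulr_ge0 ?dotv_ge0 // ltW.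
  move: (inner X0 (dC (Ds k))) (dotv (opA (Ds k) X0) (y k)) (dotv (db (Ds k)) (y k)).
  move: (dotv (db (Ds k)) y0) (dotv y0 (y k)) (dotv (y k) (y k)) => *.
  by lra.
have Kc : K @ U --> th' * (inner X0 (dC D) - dotv (db D) y0) +
    dotv (db D - opA D X0) y' + 0 * dotv y0 y'.
  apply: cvgD; first apply: cvgD.
  - apply: cvgM => //; apply: cvgB; first by apply: cvg_inner => //; apply: mcvg_cst.
    by apply: cvg_dotv => //; apply: mcvg_cst.
  - apply: cvg_dotv => //; apply: mcvgB => //; apply: mcvg_opA => //; exact: mcvg_cst.
  - by apply: cvgM => //; apply: cvg_dotv => //; apply: mcvg_cst.
have Lc : (fun k => inner X0 (Zs k) + inner (th k *: X k) (slack (Ds k) y0)) @ U -->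
    inner X0 Z' + inner X' (slack D y0).
  apply: cvgD; first by apply: cvg_inner => //; apply: mcvg_cst.
  by apply: cvg_inner => //; apply: mcvg_slack => //; apply: mcvg_cst.
have : inner X0 Z' + inner X' (slack D y0) <= 0.
  have : inner X0 Z' + inner X' (slack D y0) <= th' * (inner X0 (dC D) - dotv (db D) y0) +
    dotv (db D - opA D X0) y' + 0 * dotv y0 y'.
    by apply: (ler_cvg_to Lc Kc); move: H; apply: filterS => k; apply: le.
  rewrite th0' X0b subrr !mul0r add0r addr0 (_ : dotv 0 y' = 0) //.
  by rewrite /dotv big1 // => i _; rewrite mxE mul0r.
have h1 := psd_inner_ge0 (pd_psd pX0) pZ'.
have h2 := psd_inner_ge0 pX' (pd_psd pZ0).
move=> h3.
have Z'0 : Z' = 0 by apply: (pd_inner_le0 pX0) => //; lra.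
have X'0 : X' = 0 by apply: (pd_inner_le0 pZ0) => //; rewrite innerC; lra.
have y'0 : y' = 0.
  by apply: inj; move: Z'0; rewrite /Z' th0' scale0r sub0r => /eqP; rewrite oppr_eq0 => /eqP.
by move: E; rewrite X'0 y'0 th0' !msq0 expr0n !addr0 => /eqP; rewrite eq_sym oner_eq0.
Qed.

End Compactness.

(** * Minimizers of the quadratic penalty *)

Section Existence.
Variables (R : realType) (n m : nat).
Implicit Types (D : sdp_data R n m).

Lemma first_order_ge0 (a q : R) : 0 <= q ->
  (forall e, 0 < e -> e <= 1 -> 0 <= e * a + e ^+ 2 * q) -> 0 <= a.
Proof.
move=> q0 H; rewrite leNgt; apply/negP => a0.
have d0 : 0 < - a + q + 1 by lra.
have := H (- a / (- a + q + 1)); rewrite divr_gt0 ?oppr_gt0 //.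
rewrite ler_pdivrMr // mul1r => /(_ isT); have -> : - a <= - a + q + 1 by lra.
move=> /(_ isT); set e := - a / _.
have e0 : 0 < e by rewrite divr_gt0 ?oppr_gt0.
rewrite expr2 -mulrA -mulrDr pmulr_rge0 //.
have : e * q < - a.
  rewrite /e mulrAC ltr_pdivrMr // ltr_pM2l ?oppr_gt0 //; lra.
lra.
Qed.

(** Minimizers over the positive semidefinite cone satisfy [perturbed_kkt] with multiplier y = -(A X
    - b) / mu, which gives approximate KKT points without a feasible X at hand. *)
Definition penalty D (mu : R) (X : 'M[R]_n) : R :=
  inner (dC D) X + (2 * mu)^-1 * dotv (opA D X - db D) (opA D X - db D).

Lemma dotv_sqD (a b : 'cV[R]_m) (c : R) : dotv (a + c *: b) (a + c *: b) =
  dotv a a + 2 * c * dotv a b + c ^+ 2 * dotv b b.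
Proof.
rewrite dotvDr dotvZr ![dotv (a + _) _]dotvC !dotvDr !dotvZr [dotv b a]dotvC.
by ring.
Qed.

Lemma dotvNr (a b : 'cV[R]_m) : dotv a (- b) = - dotv a b.
Proof. by rewrite -scaleN1r dotvZr mulN1r. Qed.

(** This completes the square in |A X - b + mu y0|^2. When the slack at [y0] is positive definite,
    it bounds the sublevel sets of the penalty in the cone. *)
Lemma penalty_coercive D mu y0 X : 0 < mu ->
  inner (slack D y0) X <= penalty D mu X - dotv (db D) y0 + mu / 2 * dotv y0 y0.
Proof.
move=> mu0; rewrite /penalty innerC /slack innerBr inner_adjA innerC.
have [r ->] : exists r, opA D X = r + db D by exists (opA D X - db D); rewrite subrK.
rewrite addrK.
have : 0 <= (2 * mu)^-1 * dotv (r + mu *: y0) (r + mu *: y0).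
  by rewrite mulr_ge0 ?dotv_ge0 // invr_ge0 mulr_ge0 // ltW.
rewrite dotv_sqD [dotv (r + _) _]dotvC dotvDr [dotv y0 r]dotvC [dotv y0 (db D)]dotvC.
move: (dotv r y0) (dotv r r) (dotv y0 y0) (dotv (db D) y0) (inner (dC D) X) => a b c d e.
have -> : (2 * mu)^-1 * (b + 2 * mu * a + mu ^+ 2 * c) = (2 * mu)^-1 * b + a + mu / 2 * c.
  by field; rewrite gt_eqF.
lra.
Qed.

Lemma penalty_cvg (U : set_system nat) (UU : UltraFilter U) D mu (X : nat -> 'M[R]_n) L :
  mcvg U X L -> (fun k => penalty D mu (X k)) @ U --> penalty D mu L.
Proof.
move=> XL; have DD : dcvg U (fun=> D) D by exact: dcvg_cst.
have AX : mcvg U (fun k => opA D (X k) - db D) (opA D L - db D).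
  by apply: mcvgB; [apply: (mcvg_opA DD) | apply: mcvg_cst].
apply: cvgD; first by apply: cvg_inner => //; apply: mcvg_cst.
by apply: cvgM; [apply: cvg_cst | apply: cvg_dotv].
Qed.

Lemma penalty_min D mu y0 : 0 < mu -> pd (slack D y0) ->
  exists2 X, psd X & forall X', psd X' -> penalty D mu X <= penalty D mu X'.
Proof.
move=> mu0 pZ; have [U UU sU] := nat_ultrafilter.
pose K X := psd X /\ penalty D mu X <= penalty D mu 0.
have K0 : K 0 by split=> //; exact: psd0.
have [X [pX _] XP] : exists2 X, K X & forall X', K X' -> - penalty D mu X' <= - penalty D mu X.
  refine (@ultra_max R _ K U (@mcvg R U n n) (fun X => - penalty D mu X) UU sU _ _ _).
  - by exists 0.
  - move=> X XK; pose B := penalty D mu 0 - dotv (db D) y0 + mu / 2 * dotv y0 y0.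
    have XB k : inner (slack D y0) (X k) <= B.
      apply: le_trans (penalty_coercive D y0 (X k) mu0) _.
      by rewrite lerD2r lerD2r; case: (XK k).
    (* The dual part is set to 0, so th' = 0 would leave a nonzero X' with <Z0, X'> <= 0, where Z0
       is the slack at [y0]. *)
    have [th [th' [X' [y' [th0 thc Xc yc E]]]]] := @scale_limit R U UU n m X (fun=> 0).
    have y'0 : y' = 0.
      apply: (mcvg_unique yc); apply: (mcvg_ext (X := fun=> 0)); last exact: mcvg_cst.
      by move=> k; rewrite scaler0.
    have [th0'|thn] := eqVneq th' 0; last first.
      have XcX : mcvg U X (th'^-1 *: X') by exact: mcvg_unscale Xc.
      exists (th'^-1 *: X') => //; split.
        by apply: (psd_closed _ XcX); apply: nearW => k; case: (XK k).
      have cP : (fun k => penalty D mu (X k)) @ U --> penalty D mu (th'^-1 *: X').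
        exact: penalty_cvg.
      apply: (ler_cvg_to cP (cvg_cst (penalty D mu 0))).
      by apply: nearW => k; case: (XK k).
    exfalso.
    have pX' : psd X'.
      apply: (psd_closed _ Xc); apply: nearW => k.
      by apply: psdZ; [exact: ltW | case: (XK k)].
    have : inner (slack D y0) X' <= th' * B.
      have c1 : (fun k => inner (slack D y0) (th k *: X k)) @ U --> inner (slack D y0) X'.
        by apply: cvg_inner => //; apply: mcvg_cst.
      have c2 : (fun k => th k * B) @ U --> th' * B by apply: cvgM => //; apply: cvg_cst.
      apply: (ler_cvg_to c1 c2); apply: nearW => k.
      by rewrite innerZr ler_pM2l.
    rewrite th0' mul0r => /(pd_inner_le0 pZ pX') X'0.
    by move: E; rewrite X'0 y'0 th0' !msq0 expr0n !addr0 => /eqP; rewrite eq_sym oner_eq0.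
  - by move=> X L XL; apply: cvgN; apply: penalty_cvg.
exists X => // X' pX'; have [h|h] := leP (penalty D mu X') (penalty D mu 0).
  by have := XP X' (conj pX' h); rewrite lerN2.
by have := XP 0 K0; rewrite lerN2 => h'; apply: le_trans h' (ltW h).
Qed.

Lemma slack_sym D y : sym_data D -> symm (slack D y).
Proof.
move=> [sA sC]; rewrite /symm /slack linearB /= sC; congr (_ - _).
by rewrite raddf_sum /=; apply: eq_bigr => i _; rewrite linearZ /= sA.
Qed.

(** First-order conditions at the minimizer: directions [P] in the cone make the slack positive
    semidefinite, and the direction -X, admissible since X - e X stays in the cone for e <= 1, gives
    complementarity. *)
Lemma penalty_kkt D mu y0 : sym_data D -> 0 < mu -> pd (slack D y0) ->
  exists X y, perturbed_kkt D mu X y.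
Proof.
move=> sD mu0 pZ; have [X pX XP] := penalty_min mu0 pZ.
pose y := - (mu^-1 *: (opA D X - db D)); exists X, y.
have exp e P : penalty D mu (X + e *: P) = penalty D mu X + e * inner (slack D y) P +
    e ^+ 2 * ((2 * mu)^-1 * dotv (opA D P) (opA D P)).
  rewrite /penalty innerDr innerZr opAD opAZ [opA D X + _ - _]addrAC.
  rewrite /slack [inner (_ - _) P]innerC innerBr inner_adjA /y dotvNr dotvZr.
  rewrite [inner P _]innerC; move: (opA D X - db D) (opA D P) => r q.
  rewrite dotv_sqD [dotv q r]dotvC.
  move: (dotv r q) (dotv r r) (dotv q q) (inner (dC D) X) (inner (dC D) P) => a b c d f.
  by field; rewrite gt_eqF.
have q0 P : 0 <= (2 * mu)^-1 * dotv (opA D P) (opA D P).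
  by rewrite mulr_ge0 ?dotv_ge0 // invr_ge0 mulr_ge0 // ltW.
have ge0 P : psd P -> 0 <= inner (slack D y) P.
  move=> pP; apply: (first_order_ge0 (q0 P)) => e e0 e1.
  have := XP (X + e *: P) (psdD pX (psdZ (ltW e0) pP)).
  by rewrite exp -addrA lerDl.
have pS : psd (slack D y) by apply: psd_of_inner => //; exact: slack_sym.
split=> //.
  by rewrite /y scalerN scalerA mulfV ?gt_eqF // scale1r opprB addrCA subrr addr0.
apply/eqP; rewrite eq_le psd_inner_ge0 // andbT innerC -oppr_ge0.
apply: (first_order_ge0 (q0 (- X))) => e e0 e1.
have pX' : psd (X + e *: - X).
  have -> : X + e *: - X = (1 - e) *: X by rewrite scalerN scalerBl scale1r.
  by apply: psdZ => //; rewrite subr_ge0.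
have := XP _ pX'; rewrite exp -addrA lerDl.
by rewrite -scaleN1r innerZr mulN1r.
Qed.

End Existence.

(** * Optimal solutions and KKT points *)

Section Optimal.
Variables (R : realType) (n m : nat) (d : R -> sdp_data R n m) (t : R).

Lemma feasible_gap (X : 'M[R]_n) y : opA (d t) X = db (d t) ->
  inner (dC (d t)) X = dotv (db (d t)) y + inner X (slack (d t) y).
Proof. by move=> AX; rewrite /slack innerBr inner_adjA AX innerC addrCA subrr addr0. Qed.

Lemma kkt_Pstar X y : kkt (d t) X y -> Pstar d t X.
Proof.
move=> [AX pX pZ XZ]; split; first by split.
move=> X' [AX' pX']; rewrite (feasible_gap y AX) XZ (feasible_gap y AX') addr0.
by rewrite lerDl psd_inner_ge0.
Qed.

Lemma dual_feasible_slack y Z : adjA (d t) y + Z = dC (d t) -> Z = slack (d t) y.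
Proof. by move=> E; rewrite /slack -E addrAC subrr add0r. Qed.

Lemma kkt_Dstar X y : kkt (d t) X y -> Dstar d t (slack (d t) y).
Proof.
move=> [AX pX pZ XZ]; exists y; split.
  by split=> //; rewrite /slack addrCA subrr addr0.
move=> y' Z' [/dual_feasible_slack-> pZ'].
have := feasible_gap y AX; rewrite XZ addr0 => <-.
by rewrite (feasible_gap y' AX) lerDl psd_inner_ge0.
Qed.

(** KKT points form a product: the duality gap of an optimal X is zero against the dual part of any
    given KKT point. *)
Lemma Pstar_kkt X0 y0 X : kkt (d t) X0 y0 -> Pstar d t X -> kkt (d t) X y0.
Proof.
move=> [AX0 pX0 pZ XZ0] [[AX pX] Xopt]; split=> //.
have := Xopt X0 (conj AX0 pX0).
rewrite (feasible_gap y0 AX0) (feasible_gap y0 AX) XZ0 addr0 gerDl => h.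
by apply/eqP; rewrite eq_le h psd_inner_ge0.
Qed.

Lemma Dstar_kkt X0 y0 Z : kkt (d t) X0 y0 -> Dstar d t Z ->
  exists2 y, Z = slack (d t) y & kkt (d t) X0 y.
Proof.
move=> [AX0 pX0 pZ0 XZ0] [y [[/dual_feasible_slack ZE pZ] yopt]].
exists y => //; rewrite ZE in pZ *; split=> //.
have := yopt y0 (slack (d t) y0).
have f0 : dual_feasible (d t) y0 (slack (d t) y0).
  by split=> //; rewrite /slack addrCA subrr addr0.
move=> /(_ f0) h.
have := feasible_gap y AX0; rewrite (feasible_gap y0 AX0) XZ0 addr0 => E.
by apply/eqP; rewrite eq_le psd_inner_ge0 // andbT; lra.
Qed.

End Optimal.

(** * Existence of KKT points for nearby data *)

Section Perturbation.
Variables (R : realType) (U : set_system nat).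
Context {UU : UltraFilter U}.
Hypothesis sU : \oo `<=` U.
Variables (n m : nat).

(** Otherwise unit vectors on which the forms are nonpositive converge along [U], against positivity
    of the limit form. *)
Lemma pd_open (X : nat -> 'M[R]_n) L : (forall k, symm (X k)) -> mcvg U X L -> pd L ->
  \forall k \near U, pd (X k).
Proof.
move=> sX XL [_ pL].
have [//|nU] := in_ultra_setVsetC [set k | pd (X k)] UU.
exfalso.
have H k : exists v : 'cV[R]_n, ~ pd (X k) -> msq v = 1 /\ (v^T *m X k *m v) 0 0 <= 0.
  have [pk|npk] := pselect (pd (X k)); first by exists 0.
  have [v [v0 qv]] : exists v : 'cV[R]_n, v != 0 /\ (v^T *m X k *m v) 0 0 <= 0.
    apply: contrapT => nv; apply: npk; split=> // v v0.
    by rewrite ltNge; apply/negP => qv; apply: nv; exists v.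
  have mv : 0 < msq v.
    rewrite lt_def msq_ge0 andbT; apply: contra v0 => /eqP m0; apply/eqP/colP => i.
    rewrite [RHS]mxE; apply/eqP; rewrite -sqrf_eq0 eq_le sqr_ge0 andbT -m0.
    exact: sqr_le_msq.
  pose c := (Num.sqrt (msq v))^-1; exists (c *: v) => _.
  have c2 : c ^+ 2 * msq v = 1 by rewrite exprVn sqr_sqrtr ?mulVf ?gt_eqF // ltW.
  split; first by rewrite msqZ.
  have -> : (c *: v)^T = c *: v^T by apply/matrixP => i j; rewrite !mxE.
  rewrite -!scalemxAl -scalemxAr scalerA mxE.
  by rewrite pmulr_rle0 // -expr2 exprn_gt0 // invr_gt0 sqrtr_gt0.
have [v vP] := choice H.
have [|w vw] := @mcvg_bounded R U UU _ _ v 1.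
  by move: nU; apply: filterS => k /vP[->].
have m1 : msq w = 1.
  have c1 : (fun k => msq (v k)) @ U --> msq w by exact: cvg_msq.
  apply: (cvg_unique (@Rhausdorff R) c1); apply: (@cvg_near _ _ _ (fun=> 1)).
    by move: nU; apply: filterS => k /vP[->].
  exact: cvg_cst.
have w0 : w != 0.
  by apply/eqP => w0; move: m1; rewrite w0 msq0 => /eqP; rewrite eq_sym oner_eq0.
have := pL w w0; rewrite ltNge => /negP; apply.
have c : (fun k => ((v k)^T *m X k *m v k) 0 0) @ U --> (w^T *m L *m w) 0 0.
  apply: mcvgM => //; apply: mcvgM => // i j; rewrite mxE.
  have -> : (fun k => (v k)^T i j) = (fun k => v k j i) by apply/funext => k; rewrite mxE.
  exact: vw.
apply: (ler_cvg_to c (cvg_cst (0 : R))).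
by move: nU; apply: filterS => k /vP[].
Qed.

(* If the perturbed problems had no KKT points, their penalty minimizers would be unbounded,
   contradicting the compactness at the limit problem. *)
Lemma kkt_near (Ds : nat -> sdp_data R n m) D :
  (forall k, sym_data (Ds k)) -> dcvg U Ds D -> (forall w, adjA D w = 0 -> w = 0) ->
  strictly_feasible D -> \forall k \near U, exists X y, kkt (Ds k) X y.
Proof.
move=> sD DD inj sf; have [_ [y0 pZ0]] := sf.
have [//|nU] := in_ultra_setVsetC [set k | exists X y, kkt (Ds k) X y] UU.
exfalso.
have pZk : \forall k \near U, pd (slack (Ds k) y0).
  apply: (@pd_open _ (slack D y0)) => // [k|]; first exact: slack_sym.
  by apply: mcvg_slack => //; exact: mcvg_cst.
pose good k := pd (slack (Ds k) y0) /\ ~ (exists X y, kkt (Ds k) X y).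
have goodU : \forall k \near U, good k by move: pZk nU; apply: filterS2.
(* If the perturbed points for mu = 1 / ((k + 1) (j + 1)) were bounded by [k] for all j, their limit
   as j grows would be a KKT point of [Ds k]. *)
have H k : exists x : 'M[R]_n * 'cV[R]_m * R, good k -> [/\ 0 < x.2, x.2 <= k.+1%:R^-1,
    k%:R <= msq x.1.1 + msq x.1.2 & perturbed_kkt (Ds k) x.2 x.1.1 x.1.2].
  have [gk|ngk] := pselect (good k); last by exists (0, 0, 0).
  apply: contrapT => nx; case: (gk) => pk; apply.
  pose mu (j : nat) : R := k.+1%:R^-1 * j.+1%:R^-1.
  have muj j : 0 < mu j by rewrite mulr_gt0 ?invr_gt0.
  have Hj j : exists x : 'M[R]_n * 'cV[R]_m, perturbed_kkt (Ds k) (mu j) x.1 x.2.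
    by have [X [y Xy]] := penalty_kkt (sD k) (muj j) pk; exists (X, y).
  have [u uP] := choice Hj.
  have ub j : msq (u j).1 + msq (u j).2 <= k%:R.
    rewrite leNgt; apply/negP => /ltW kl; apply: nx.
    exists ((u j).1, (u j).2, mu j) => _; split=> //=.
    by rewrite /mu ler_piMr ?invr_ge0 // invf_le1 // ler1n.
  have [|X' XX] := @mcvg_bounded R U UU _ _ (fun j => (u j).1) k%:R.
    by apply: nearW => j; apply: le_trans (ub j); rewrite lerDl msq_ge0.
  have [|y' yy] := @mcvg_bounded R U UU _ _ (fun j => (u j).2) k%:R.
    by apply: nearW => j; apply: le_trans (ub j); rewrite lerDr msq_ge0.
  have mu0 : mu @ U --> (0 : R).
    rewrite -[X in _ --> X](mulr0 (k.+1%:R^-1 : R)); apply: cvgM; first exact: cvg_cst.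
    exact: ultra_harmonic.
  exists X', y'; apply: kkt_closed (dcvg_cst (U := U) (Ds k)) mu0 XX yy _.
  by apply: nearW => j; exact: uP.
have [u uP] := choice H.
have mu0 : (fun k => (u k).2) @ U --> (0 : R).
  have hc := @ultra_harmonic R _ sU.
  apply: (@squeeze_cvgr _ _ _ _ (fun=> 0) (fun k : nat => k.+1%:R^-1)) => //; last exact: cvg_cst.
  by move: goodU; apply: filterS => k /uP[h1 h2 _ _]; rewrite h2 ltW.
have [|X' [y' [XX yy _]]] := kkt_compact (X := fun k => (u k).1.1) (y := fun k => (u k).1.2)
   DD inj sf mu0.
  by move: goodU; apply: filterS => k /uP[h1 _ _ h2]; split=> //; exact: ltW.
have c : (fun k => msq (u k).1.1 + msq (u k).1.2) @ U --> msq X' + msq y'.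
  by apply: cvgD; apply: cvg_msq.
have h1 : \forall k \near U, msq (u k).1.1 + msq (u k).1.2 <= msq X' + msq y' + 1.
  by apply: (cvgr_le _ c); rewrite ltrDl.
have h2 : \forall k \near U, msq X' + msq y' + 1 < k%:R.
  by apply: sU; exact: nbhs_infty_gtr.
have [k [/uP[_ _ h3 _] [h4 h5]]] := filter_ex (filterI goodU (filterI h1 h2)).
by have := le_lt_trans (le_trans h3 h4) h5; rewrite ltxx.
Qed.

End Perturbation.

Lemma kkt_exists (R : realType) n m (D : sdp_data R n m) : sym_data D ->
  (forall w, adjA D w = 0 -> w = 0) -> strictly_feasible D -> exists X y, kkt D X y.
Proof.
move=> sD inj sf; have [U UU sU] := nat_ultrafilter.
have H : \forall k \near U, exists X y, kkt D X y.
  exact: (kkt_near sU (fun=> sD) (dcvg_cst (U := U) D) inj sf).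
by have [] := filter_ex H.
Qed.

(** * The KKT conditions as a square quadratic system *)

Section KktSystem.
Variables (K : fieldType) (s : K) (n m : nat).
Hypotheses (s2 : s ^+ 2 = 2) (two0 : (2 : K) != 0).
Implicit Types (D : sdp_data K n m) (X Z : 'M[K]_n) (y : 'cV[K]_m).

Let s0 : s != 0.
Proof. by apply: contraNneq two0 => s0; rewrite -s2 s0 expr0n. Qed.

Lemma svec_eq0 X : symm X -> svec s X = 0 -> X = 0.
Proof.
move=> sX X0; rewrite (svec_basisE s0 sX) big1 // => k _.
by rewrite X0 mxE scale0r.
Qed.

(** An off-diagonal pair counts twice in the trace, and s^2 = 2 accounts for it. *)
Lemma svec_inner X Y : symm X -> symm Y -> \sum_k svec s X k 0 * svec s Y k 0 = inner X Y.
Proof.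
move=> sX sY; have dE i j : inner (delta_mx i j) Y = Y j i.
  rewrite /inner -(mul_delta_mx (0 : 'I_1)) -mulmxA mxtrace_mulC -rowE -colE.
  by rewrite /mxtrace big_ord1 !mxE.
rewrite [in RHS](svec_basisE s0 sX) /inner mulmx_suml raddf_sum; apply: eq_bigr => k _ /=.
rewrite -scalemxAl mxtraceZ; congr (_ * _); rewrite -/(inner _ _) /svec_basis [LHS]mxE /=.
case: eqP => [<-|_]; first by rewrite dE mul1r.
rewrite /inner -scalemxAl mxtraceZ mulmxDl mxtraceD -!/(inner _ _) !dE.
have -> : Y (enum_val k).2 (enum_val k).1 = Y (enum_val k).1 (enum_val k).2.
  by rewrite -[in LHS]sY mxE.
by apply: (mulfI s0); rewrite mulrA -expr2 s2 mulVKf //; ring.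
Qed.

Lemma kkt_solutionsE D X y Z : sym_data D ->
  kkt_solutions s D (X, y, Z) <->
  [/\ symm X, Z = slack D y, opA D X = db D & X *m Z + Z *m X = 0].
Proof.
move=> [sA sC].
have sS w : symm (slack D w).
  rewrite /symm /slack linearB /= sC; congr (_ - _).
  by rewrite raddf_sum /=; apply: eq_bigr => i _; rewrite linearZ /= sA.
have E1 : symm X -> Atilde s D *m svec s X = opA D X.
  move=> sX; apply/colP => i; rewrite mxE [RHS]mxE -svec_inner //.
  by apply: eq_bigr => k _; rewrite mxE.
have E2 : (Atilde s D)^T *m y + svec s Z - svec s (dC D) = svec s (Z - slack D y).
  have -> : (Atilde s D)^T *m y = svec s (adjA D y).
    apply/colP => k; rewrite mxE [RHS]mxE /= summxE mulr_sumr; apply: eq_bigr => l _.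
    by rewrite 2!mxE [in LHS]mxE [in RHS]mxE /=; ring.
  apply/colP => k; rewrite /slack opprB addrA [in LHS]mxE [in RHS]mxE /=.
  by rewrite !mxE /=; ring.
split.
  move=> [/= sX sZ]; rewrite /kktF => /eqP.
  rewrite !col_mx_eq0 => /and3P[/eqP e1 /eqP e2 /eqP e3].
  have ZE : Z = slack D y.
    apply/eqP; rewrite -subr_eq0; apply/eqP; apply: svec_eq0; last by rewrite -E2.
    by rewrite /symm linearB /= sZ sS.
  split=> //; first by apply/eqP; rewrite -subr_eq0 -E1 // e1.
  apply: svec_eq0; first by rewrite /symm linearD /= !trmx_mul sX sZ addrC.
  by move/eqP: e3; rewrite scaler_eq0 invr_eq0 (negPf two0) => /eqP.
move=> [sX ZE AX XZ]; split=> //=; first by rewrite ZE.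
have v0 : svec s (0 : 'M[K]_n) = 0.
  by apply/colP => k; rewrite mxE [RHS]mxE /= [X in _ * X]mxE mulr0.
by rewrite /kktF E1 // AX subrr E2 XZ ZE subrr v0 scaler0 !col_mx0.
Qed.

Definition row_X (z : 'rV[K]_(n * n + m)) : 'M[K]_n := vec_mx (lsubmx z).
Definition row_y (z : 'rV[K]_(n * n + m)) : 'cV[K]_m := (rsubmx z)^T.
Definition to_row X y : 'rV[K]_(n * n + m) := row_mx (mxvec X) y^T.

Lemma to_rowK X y : row_X (to_row X y) = X /\ row_y (to_row X y) = y.
Proof. by rewrite /row_X /row_y row_mxKl row_mxKr mxvecK trmxK. Qed.

Lemma row_XyK z : to_row (row_X z) (row_y z) = z.
Proof. by rewrite /to_row /row_X /row_y vec_mxK trmxK hsubmxK. Qed.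

(* The symmetric and the antisymmetric part of the first component are the complementarity
   equation and the symmetry of X; this makes the system square on all n x n matrices X. *)
Definition system D (z : 'rV[K]_(n * n + m)) : 'rV[K]_(n * n + m) :=
  let X := row_X z in let Z := slack D (row_y z) in
  to_row ((X + X^T) *m Z + Z *m (X + X^T) + (X - X^T)) (opA D X - db D).

Lemma to_row_eq0 X y : to_row X y = 0 <-> X = 0 /\ y = 0.
Proof.
split=> [/eqP|[-> ->]]; last by rewrite /to_row linear0 trmx0 row_mx0.
rewrite row_mx_eq0 => /andP[/eqP h1 /eqP h2].
split; first by apply: (can_inj mxvecK); rewrite h1 linear0.
by rewrite -[y]trmxK h2 trmx0.
Qed.

Lemma system_eq0 D z : sym_data D -> system D z = 0 <->
  kkt_solutions s D (row_X z, row_y z, slack D (row_y z)).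
Proof.
move=> sD; have [sA sC] := sD.
apply: iff_trans (iff_sym (kkt_solutionsE _ _ _ sD)).
rewrite /system; set X := row_X z; set y := row_y z; set Z := slack D y.
have sZ : Z^T = Z.
  rewrite /Z /slack linearB /= sC; congr (_ - _).
  by rewrite raddf_sum /=; apply: eq_bigr => i _; rewrite linearZ /= sA.
apply: (iff_trans (to_row_eq0 _ _)); clearbody X Z.
split=> [[h1 h2]|[sX _ AX XZ]]; last first.
  by rewrite sX AX !subrr mulmxDl mulmxDr addrACA XZ !addr0.
have AX : opA D X = db D by apply/eqP; rewrite -subr_eq0 h2.
(* The first equation reads S + (X - X^T) = 0 with [S] symmetric; adding its transpose gives 2 S =
   0. *)
pose S := (X + X^T) *m Z + Z *m (X + X^T).
have sS : S^T = S by rewrite /S linearD /= !trmx_mul linearD /= trmxK sZ addrC [X^T + X]addrC.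
have h1T : S - (X - X^T) = 0.
  have tX : (X - X^T)^T = X^T - X by apply/matrixP => i j; rewrite !mxE.
  by have := congr1 trmx h1; rewrite -/S linearD /= sS tX trmx0 opprB.
have S0 : S = 0.
  apply/eqP; have : S *+ 2 == 0.
    by rewrite mulr2n -[X in _ + X](subrK (X - X^T)) h1T add0r; apply/eqP.
  by rewrite -scaler_nat scaler_eq0 (negPf two0).
have sX : symm X.
  by move: h1; rewrite -/S S0 add0r => /eqP; rewrite subr_eq0 eq_sym => /eqP.
split=> //; apply/eqP; move: S0; rewrite /S sX -mulr2n => /eqP.
have -> : X *+ 2 *m Z + Z *m (X *+ 2) = 2 *: (X *m Z + Z *m X).
  by rewrite mulr2n mulmxDl mulmxDr addrACA -mulr2n scaler_nat.
by rewrite scaler_eq0 (negPf two0).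
Qed.

End KktSystem.

Lemma linear_rowE (K : fieldType) (p q : nat) (f : 'rV[K]_p -> 'rV[K]_q) :
  (forall u v, f (u + v) = f u + f v) -> (forall a v, f (a *: v) = a *: f v) ->
  exists M, forall v, f v = v *m M.
Proof.
move=> fD fZ; exists (\matrix_j f (delta_mx 0 j)) => v.
have f0 : f 0 = 0 by rewrite -(scale0r 0) fZ scale0r.
rewrite {1}[v]row_sum_delta mulmx_sum_row (big_morph f fD f0).
by apply: eq_bigr => j _; rewrite fZ rowK.
Qed.

(** * The exact second-order expansion of the system *)

Section Expansion.
Variables (K : fieldType) (n m : nat) (D : sdp_data K n m).
Local Notation row := 'rV[K]_(n * n + m).

Lemma to_rowD (X X' : 'M[K]_n) (y y' : 'cV[K]_m) :
  to_row (X + X') (y + y') = to_row X y + to_row X' y'.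
Proof. by rewrite /to_row linearD /= [(y + y')^T]linearD /= add_row_mx. Qed.

Lemma to_rowZ a (X : 'M[K]_n) (y : 'cV[K]_m) : to_row (a *: X) (a *: y) = a *: to_row X y.
Proof. by rewrite /to_row linearZ /= [(a *: y)^T]linearZ /= scale_row_mx. Qed.

Lemma row_XD (u v : row) : row_X (u + v) = row_X u + row_X v.
Proof. by rewrite /row_X !linearD. Qed.

Lemma row_XZ a (v : row) : row_X (a *: v) = a *: row_X v.
Proof. by rewrite /row_X !linearZ. Qed.

Lemma row_yD (u v : row) : row_y (u + v) = row_y u + row_y v.
Proof. by rewrite /row_y !linearD. Qed.

Lemma row_yZ a (v : row) : row_y (a *: v) = a *: row_y v.
Proof. by rewrite /row_y !linearZ. Qed.

Let anti (P Z : 'M[K]_n) : 'M[K]_n := P *m Z + Z *m P.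

Definition dsystem (z v : row) : row :=
  let P := row_X z + (row_X z)^T in let Q := row_X v + (row_X v)^T in
  let Z := slack D (row_y z) in let B := adjA D (row_y v) in
  to_row (anti Q Z - anti P B + (row_X v - (row_X v)^T)) (opA D (row_X v)).

(** The second-order term is bilinear in the X-part and the y-part of [v]; it vanishes when only one
    of the two moves. *)
Definition system2 (v : row) : row :=
  let Q := row_X v + (row_X v)^T in to_row (- anti Q (adjA D (row_y v))) 0.

Lemma system_expansion z v x :
  system D (z + x *: v) = system D z + x *: dsystem z v + x ^+ 2 *: system2 v.
Proof.
rewrite /system /dsystem /system2 row_XD row_XZ row_yD row_yZ.
have -> : slack D (row_y z + x *: row_y v) = slack D (row_y z) - x *: adjA D (row_y v).
  by rewrite /slack adjAD adjAZ opprD addrA.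
rewrite -!to_rowZ -!to_rowD; congr (to_row _ _); last first.
  by rewrite opAD opAZ scaler0 addr0 addrAC.
move: (row_X z) (row_X v) (slack D _) (adjA D _) => X V Z B.
have -> : (X + x *: V)^T = X^T + x *: V^T by rewrite linearD linearZ.
have -> : X + x *: V + (X^T + x *: V^T) = (X + X^T) + x *: (V + V^T).
  by rewrite scalerDr addrACA.
have -> : X + x *: V - (X^T + x *: V^T) = (X - X^T) + x *: (V - V^T).
  by rewrite scalerBr opprD addrACA.
move: (X + X^T) (V + V^T) (X - X^T) (V - V^T) => P Q S T.
rewrite /anti !mulmxBr !mulmxBl !mulmxDl !mulmxDr -!scalemxAl -!scalemxAr.
move: (P *m Z) (Q *m Z) (Z *m P) (Z *m Q) (P *m B) (Q *m B) (B *m P) (B *m Q) => a b c e f g h k.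
by apply/matrixP => i j; rewrite !mxE; ring.
Qed.

Lemma dsystem_matrix z : exists M, forall v, dsystem z v = v *m M.
Proof.
apply: linear_rowE => [u v|a v]; rewrite /dsystem.
  rewrite row_XD row_yD adjAD opAD -to_rowD; congr (to_row _ _).
  move: (row_X u) (row_X v) (adjA D (row_y u)) (adjA D (row_y v)) => V W B B'.
  move: (row_X z + _) (slack D _) => P Z.
  have -> : (V + W)^T = V^T + W^T by rewrite linearD.
  have -> : V + W + (V^T + W^T) = (V + V^T) + (W + W^T) by rewrite addrACA.
  move: (V + V^T) (W + W^T) => Q Q'; rewrite /anti !mulmxDl !mulmxDr.
  move: (P *m B) (P *m B') (B *m P) (B' *m P) (Q *m Z) (Q' *m Z) (Z *m Q) (Z *m Q') => *.
  by apply/matrixP => i j; rewrite !mxE; ring.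
rewrite row_XZ row_yZ adjAZ opAZ -to_rowZ; congr (to_row _ _).
move: (row_X v) (adjA D (row_y v)) => V B; move: (row_X z + _) (slack D _) => P Z.
have -> : (a *: V)^T = a *: V^T by rewrite linearZ.
have -> : a *: V + a *: V^T = a *: (V + V^T) by rewrite scalerDr.
move: (V + V^T) => Q; rewrite /anti -!scalemxAl -!scalemxAr.
move: (P *m B) (B *m P) (Q *m Z) (Z *m Q) => *.
by apply/matrixP => i j; rewrite !mxE; ring.
Qed.

End Expansion.

Section MatrixPolyfun.
Variable F : closedFieldType.

Definition mpolyfun a b (M : seq F -> 'M[F]_(a, b)) : Prop :=
  forall i j, polyfun (fun e => M e i j).

Lemma mpolyfunD a b (M N : seq F -> 'M[F]_(a, b)) :
  mpolyfun M -> mpolyfun N -> mpolyfun (fun e => M e + N e).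
Proof. by move=> pM pN i j; apply: polyfun_ext (polyfunD (pM i j) (pN i j)) => e; rewrite mxE. Qed.

Lemma mpolyfunB a b (M N : seq F -> 'M[F]_(a, b)) :
  mpolyfun M -> mpolyfun N -> mpolyfun (fun e => M e - N e).
Proof.
move=> pM pN i j; apply: polyfun_ext (polyfunB (pM i j) (pN i j)) => e.
by rewrite mxE [(- N e) _ _]mxE.
Qed.

Lemma mpolyfunM a b c (M : seq F -> 'M[F]_(a, b)) (N : seq F -> 'M[F]_(b, c)) :
  mpolyfun M -> mpolyfun N -> mpolyfun (fun e => M e *m N e).
Proof.
move=> pM pN i j.
apply: polyfun_ext (polyfun_sum (index_enum _) (fun l => polyfunM (pM i l) (pN l j))) => e.
by rewrite mxE.
Qed.

Lemma mpolyfun_tr a b (M : seq F -> 'M[F]_(a, b)) : mpolyfun M -> mpolyfun (fun e => (M e)^T).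
Proof. by move=> pM i j; apply: polyfun_ext (pM j i) => e; rewrite mxE. Qed.

Lemma polyfun_system n m (D : seq F -> sdp_data F n m) (z : seq F -> 'rV[F]_(n * n + m)) :
  (forall i, mpolyfun (fun e => dA (D e) i)) -> mpolyfun (fun e => db (D e)) ->
  mpolyfun (fun e => dC (D e)) -> mpolyfun z -> mpolyfun (fun e => system (D e) (z e)).
Proof.
move=> pA pb pC pz.
have pX : mpolyfun (fun e => row_X (z e)).
  by move=> i j; apply: polyfun_ext (pz 0 (lshift m (mxvec_index i j))) => e; rewrite /row_X !mxE.
have py : mpolyfun (fun e => row_y (z e)).
  move=> i j; rewrite [j]ord1.
  by apply: polyfun_ext (pz 0 (rshift (n * n) i)) => e; rewrite /row_y !mxE.
have pS : mpolyfun (fun e => slack (D e) (row_y (z e))).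
  apply: mpolyfunB => //.
  move=> i j.
  apply: polyfun_ext (polyfun_sum (index_enum _) (fun l => polyfunM (py l 0) (pA l i j))) => e.
  by rewrite /adjA summxE; apply: eq_bigr => l _; rewrite [RHS]mxE.
have pO : mpolyfun (fun e => opA (D e) (row_X (z e))).
  move=> i j.
  apply: polyfun_ext (polyfun_sum (index_enum _) (fun l => mpolyfunM (pA i) pX l l)) => e.
  by rewrite mxE.
have pT := mpolyfun_tr pX.
have pP := mpolyfunD pX pT.
have pE := mpolyfunD (mpolyfunD (mpolyfunM pP pS) (mpolyfunM pS pP)) (mpolyfunB pX pT).
have pF := mpolyfunB pO pb.
move=> i j; rewrite (ord1 i); case: (split_ordP j) => k ->.
  case/mxvec_indexP: k => a b; apply: polyfun_ext (pE a b) => e.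
  by rewrite /system /to_row row_mxEl mxvecE.
by apply: polyfun_ext (pF k 0) => e; rewrite /system /to_row row_mxEr [RHS]mxE.
Qed.

End MatrixPolyfun.

Section Complexification.
Variables (R : realType) (n m : nat).
Local Notation C := R[i].
Local Notation rc := (real_complex R).
Implicit Types D : sdp_data R n m.

Lemma sym_map_data D : sym_data D -> sym_data (map_data rc D).
Proof.
move=> [sA sC]; split=> [i|]; apply/matrixP => a b; rewrite !mxE /=; congr (_%:C)%C.
  by rewrite -[in RHS](sA i) mxE.
by rewrite -[in RHS]sC mxE.
Qed.

(** Since Z is the slack of y, a solution is determined by (X, y), so the cardinality of the
    solution set carries over to the zeros of [system]. *)
Lemma zeros_enum D N : sym_data D -> (complex_solutions D #= `I_N)%card ->
  exists r, [/\ uniq r, size r = N & forall z, system (map_data rc D) z = 0 <-> z \in r].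
Proof.
move=> sD /card_set_bijP[f [fN fI fS]].
have sqC : (rc (sqrt2 R)) ^+ 2 = 2.
  by rewrite -rmorphXn /= /sqrt2 sqr_sqrtr ?ler0n // rmorph_nat.
have two0 : (2 : C) != 0 by rewrite pnatr_eq0.
have sDC := sym_map_data sD.
have zE z := system_eq0 sqC two0 z sDC.
have H (k : 'I_N) : exists x, complex_solutions D x /\ f x = k.
  by have [x Sx <-] := fS k (ltn_ord k); exists x.
have [g gP] := choice H.
have slackg X y Z : complex_solutions D (X, y, Z) -> Z = slack (map_data rc D) y.
  by move=> /(kkt_solutionsE sqC two0 _ _ _ sDC)[].
exists [seq to_row (g k).1.1 (g k).1.2 | k <- enum 'I_N]; split.
- rewrite map_inj_uniq ?enum_uniq // => k l E; apply: val_inj => /=.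
  have := congr1 (@row_X _ _ _) E; have := congr1 (@row_y _ _ _) E.
  have [Sk fk] := gP k; have [Sl fl] := gP l; rewrite -fk -fl.
  move: Sk Sl; case: (g k) (g l) => [[X y] Z] [[X' y'] Z'] /= /slackg-> /slackg->.
  by rewrite !(to_rowK _ _).1 !(to_rowK _ _).2 => -> ->.
- by rewrite size_map size_enum_ord.
- move=> z; split=> [/zE Sz|/mapP[k _ ->]].
    have Nz := fN _ Sz; have [Sk fk] := gP (Ordinal Nz).
    apply/mapP; exists (Ordinal Nz); first by rewrite mem_enum.
    have gE : (row_X z, row_y z, slack (map_data rc D) (row_y z)) = g (Ordinal Nz).
      have fE : f (row_X z, row_y z, slack (map_data rc D) (row_y z)) = f (g (Ordinal Nz)).
        by rewrite fk.
      exact: (fI _ _ (mem_set Sz) (mem_set Sk) fE).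
    by rewrite -gE /=; exact: (esym (row_XyK z)).
  have [Sk _] := gP k; apply/zE; rewrite (to_rowK _ _).1 (to_rowK _ _).2.
  by move: Sk; case: (g k) => [[X y] Z] /= Sk; rewrite -(slackg _ _ _ Sk).
Qed.

End Complexification.

Section Bipoly.
Variable R : comNzRingType.

Definition bipoly (f : R -> R -> R) : Prop :=
  exists q : {poly {poly R}}, forall t s, f t s = q.[s%:P].[t].

End Bipoly.

(** * The perturbed data as a two-parameter polynomial family *)

Section Family.
Variables (R : realType) (n m : nat).
Local Notation C := R[i].
Local Notation rc := (real_complex R).
Variables (PA : 'I_m -> 'I_n -> 'I_n -> {poly R}) (Pb : 'I_m -> {poly R}).
Variables (PC : 'I_n -> 'I_n -> {poly R}) (E : sdp_data R n m).

Definition rdata (t s : R) : sdp_data R n m :=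
  SdpData (fun i => \matrix_(a, b) ((PA i a b).[t] + s * dA E i a b))
          (\col_i ((Pb i).[t] + s * db E i 0))
          (\matrix_(a, b) ((PC a b).[t] + s * dC E a b)).

Definition cdata (t s : C) : sdp_data C n m :=
  SdpData (fun i => \matrix_(a, b) ((map_poly rc (PA i a b)).[t] + s * rc (dA E i a b)))
          (\col_i ((map_poly rc (Pb i)).[t] + s * rc (db E i 0)))
          (\matrix_(a, b) ((map_poly rc (PC a b)).[t] + s * rc (dC E a b))).

Lemma cdata_real t s : cdata (rc t) (rc s) = map_data rc (rdata t s).
Proof.
rewrite /cdata /map_data /rdata /=; congr SdpData.
- by apply/funext => i; apply/matrixP => a b; rewrite !mxE horner_map rmorphD rmorphM.
- by apply/matrixP => a b; rewrite !mxE horner_map rmorphD rmorphM.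
- by apply/matrixP => a b; rewrite !mxE horner_map rmorphD rmorphM.
Qed.

Definition family (t s : C) (z : 'rV[C]_(n * n + m)) : 'rV[C]_(n * n + m) :=
  system (cdata t s) z.

Definition familyJ (t s : C) (z : 'rV[C]_(n * n + m)) : 'M[C]_(n * n + m) :=
  sval (cid (dsystem_matrix (cdata t s) z)).

Lemma family_expansion t s z v x : family t s (z + x *: v) =
  family t s z + x *: (v *m familyJ t s z) + x ^+ 2 *: system2 (cdata t s) v.
Proof.
by rewrite /family system_expansion /familyJ; case: cid => M /= ->.
Qed.

Lemma polyfun_family (f g : seq C -> C) (h : seq C -> 'rV[C]_(n * n + m)) :
  polyfun f -> polyfun g -> (forall j, polyfun (fun e => h e 0 j)) ->
  forall i, polyfun (fun e => family (f e) (g e) (h e) 0 i).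
Proof.
move=> pf pg ph i.
have H (P : {poly R}) c : polyfun (fun e => (map_poly rc P).[f e] + g e * rc c).
  by apply: polyfunD; [exact: polyfun_horner | apply: polyfunM => //; exact: polyfun_cst].
apply: (polyfun_system (D := fun e => cdata (f e) (g e)) (z := h)) => [k||| a j].
- by move=> a b; apply: polyfun_ext (H (PA k a b) (dA E k a b)) => e; rewrite mxE.
- by move=> a b; apply: polyfun_ext (H (Pb a) (db E a 0)) => e; rewrite mxE.
- by move=> a b; apply: polyfun_ext (H (PC a b) (dC E a b)) => e; rewrite mxE.
- by rewrite (ord1 a).
Qed.

Lemma bipoly_entry (P : {poly R}) c : bipoly (fun t s => P.[t] + s * c).
Proof.
exists (P%:P + 'X * c%:P%:P) => t s; by rewrite !hornerE.
Qed.

Lemma bipoly_coords k : bipoly (fun t s => data_coords (rdata t s) k).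
Proof.
have svecP (M : R -> R -> 'M[R]_n) l : (forall a b, bipoly (fun t s => M t s a b)) ->
    bipoly (fun t s => svec (sqrt2 R) (M t s) l 0).
  move=> pM; have [q qE] := pM (enum_val l).1 (enum_val l).2.
  exists ((if (enum_val l).1 == (enum_val l).2 then 1 else sqrt2 R)%:P%:P * q) => t s.
  by rewrite mxE !hornerE -qE.
have ext f g : (forall t s, f t s = g t s) -> bipoly g -> bipoly f.
  by move=> fg [q qE]; exists q => t s; rewrite fg.
have pA i a b : bipoly (fun t s => dA (rdata t s) i a b).
  by apply: ext (bipoly_entry (PA i a b) (dA E i a b)) => t s; rewrite mxE.
have pb i : bipoly (fun t s => db (rdata t s) i 0).
  by apply: ext (bipoly_entry (Pb i) (db E i 0)) => t s; rewrite mxE.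
have pC a b : bipoly (fun t s => dC (rdata t s) a b).
  by apply: ext (bipoly_entry (PC a b) (dC E a b)) => t s; rewrite mxE.
case: (split_ordP k) => l ->.
  case/mxvec_indexP: l => i j; apply: ext (svecP _ j (pA i)) => t s.
  by rewrite /data_coords row_mxEl mxvecE mxE.
case: (split_ordP l) => j ->.
  by apply: ext (pb j) => t s; rewrite /data_coords row_mxEr row_mxEl mxE.
by apply: ext (svecP _ j pC) => t s; rewrite /data_coords !row_mxEr mxE.
Qed.

(** This pulls an equation on data space back to a polynomial in (t, s), so that genericity of the
    perturbed data holds off a curve. *)
Lemma bipoly_meval (p : mpoly.mpoly (data_dim n m) R) :
  bipoly (fun t s => mpoly.meval (data_coords (rdata t s)) p).
Proof.
have [q qE] := choice bipoly_coords.
exists (\sum_(a <- mpoly.msupp p)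
  (mpoly.mcoeff a p)%:P%:P * \prod_i q i ^+ mpoly.fun_of_multinom a i).
move=> t s; rewrite mpoly.mevalE !horner_sum; apply: eq_bigr => a _.
rewrite !hornerM !hornerC !horner_prod; congr (_ * _); apply: eq_bigr => i _.
by rewrite !horner_exp -qE.
Qed.

End Family.

(** * Lines of complex zeros and uniqueness of KKT points *)

Section SystemZeros.
Variables (R : realType) (n m : nat).
Local Notation C := R[i].
Local Notation rc := (real_complex R).
Implicit Types D : sdp_data R n m.

Lemma system_map D (z : 'rV[R]_(n * n + m)) :
  system (map_data rc D) (map_mx rc z) = map_mx rc (system D z).
Proof.
have eX : row_X (map_mx rc z) = map_mx rc (row_X z).
  by rewrite /row_X map_vec_mx map_lsubmx.
have ey : row_y (map_mx rc z) = map_mx rc (row_y z).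
  by rewrite /row_y -map_trmx map_rsubmx.
have eZ : slack (map_data rc D) (map_mx rc (row_y z)) = map_mx rc (slack D (row_y z)).
  rewrite /slack map_mxB; congr (_ - _); rewrite /adjA raddf_sum /=.
  by apply: eq_bigr => i _; rewrite map_mxZ mxE.
rewrite /system eX ey eZ; move: (row_X z) (slack D _) => X Z.
rewrite /to_row map_row_mx map_mxvec -map_trmx; congr (row_mx (mxvec _) _^T).
  by rewrite !(map_mxD, map_mxM, map_mxN) !map_trmx.
rewrite map_mxB; congr (_ - _).
by apply/colP => i; rewrite !mxE /inner -map_mxM trace_map_mx.
Qed.

Lemma kkt_system D X y : kkt D X y -> system D (to_row X y) = 0.
Proof.
move=> [AX pX pZ XZ]; rewrite /system (to_rowK _ _).1 (to_rowK _ _).2.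
have [sX _] := pX; have [sZ _] := pZ.
have E : X *m slack D y = 0 by exact: psd_inner_eq0.
have E' : slack D y *m X = 0 by rewrite -[LHS]trmxK trmx_mul sX sZ E trmx0.
apply/to_row_eq0; split; last by rewrite AX subrr.
by move: (slack D y) E E' => Z E E'; rewrite sX subrr mulmxDl mulmxDr E E' !addr0.
Qed.

(** Without second-order term the system is affine along [v], and an affine function with zeros at x
    = 0 and x = 1 vanishes for all x. *)
Lemma line_of_zeros (K : fieldType) (D : sdp_data K n m) z v : system2 D v = 0 ->
  system D z = 0 -> system D (z + v) = 0 -> forall x, system D (z + x *: v) = 0.
Proof.
move=> v2 z0 zv x; have := system_expansion D z v 1.
rewrite scale1r zv z0 v2 scaler0 addr0 add0r scale1r => E.
by rewrite system_expansion z0 v2 -E !scaler0 !addr0.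
Qed.

Lemma system2_X (K : fieldType) (D : sdp_data K n m) X : system2 D (to_row X 0) = 0.
Proof.
rewrite /system2 (to_rowK _ _).1 (to_rowK _ _).2; apply/to_row_eq0; split=> //.
suff -> : adjA D 0 = 0 by rewrite mul0mx mulmx0 addr0 oppr0.
by rewrite /adjA big1 // => i _; rewrite mxE scale0r.
Qed.

Lemma system2_y (K : fieldType) (D : sdp_data K n m) y : system2 D (to_row 0 y) = 0.
Proof.
rewrite /system2 (to_rowK _ _).1 (to_rowK _ _).2; apply/to_row_eq0; split=> //.
by rewrite trmx0 addr0 mul0mx mulmx0 addr0 oppr0.
Qed.

(** A second solution that differs in X alone or in y alone spans a line, because [system2] vanishes
    on the difference. A simultaneous change of both is not covered, hence the two separate
    conclusions. *)
Lemma kkt_unique D X y : kkt D X y ->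
  (forall v, v != 0 -> ~ (forall x : C, system (map_data rc D)
     (map_mx rc (to_row X y) + x *: v) = 0)) ->
  forall X' y', (kkt D X' y -> X' = X) /\ (kkt D X y' -> y' = y).
Proof.
move=> kXy line X' y'.
have z0 : system (map_data rc D) (map_mx rc (to_row X y)) = 0.
  by rewrite system_map kkt_system // map_mx0.
have H (v : 'rV[R]_(n * n + m)) : v != 0 -> system2 (map_data rc D) (map_mx rc v) = 0 ->
    system D (to_row X y + v) = 0 -> False.
  move=> v0 v2 zv; apply: (line (map_mx rc v)); first by rewrite (map_mx_eq0 rc).
  apply: line_of_zeros; [exact: v2 | exact: z0 | rewrite -(map_mxD rc)].
  by rewrite system_map zv map_mx0.
split=> k'; apply/eqP/negPn/negP => ne.
- apply: (H (to_row (X' - X) 0)).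
  + apply: contraNneq ne => /to_row_eq0[/eqP]; by rewrite subr_eq0.
  + have -> : map_mx rc (to_row (X' - X) 0 : 'rV_(n * n + m)) = to_row (map_mx rc (X' - X)) 0.
      by rewrite /to_row map_row_mx map_mxvec -map_trmx map_mx0.
    exact: system2_X.
  + by rewrite -to_rowD addr0 addrC subrK; exact: kkt_system.
- apply: (H (to_row 0 (y' - y))).
  + apply: contraNneq ne => /to_row_eq0[_ /eqP]; by rewrite subr_eq0.
  + have -> : map_mx rc (to_row 0 (y' - y) : 'rV_(n * n + m)) = to_row 0 (map_mx rc (y' - y)).
      by rewrite /to_row map_row_mx map_mxvec -map_trmx map_mx0.
    exact: system2_y.
  + by rewrite -to_rowD addr0 addrC subrK; exact: kkt_system.
Qed.

End SystemZeros.

Section Algebraic.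
Variables (R : realType) (n m : nat).
Local Notation C := R[i].
Local Notation rc := (real_complex R).
Implicit Types D : sdp_data R n m.

(** A complex point off the zeros of [q] would not do: the data are real and t must lie in [T].
    First t is chosen close to [t0], then s, along sequences that avoid the roots of nonzero
    polynomials. *)
Lemma bivariate_real_near (q : {poly {poly C}}) (T : set R) (t0 : R) : q != 0 ->
  (\forall t \near t0, T t) -> exists2 t, T t & exists s : R, ev2 (rc t) (rc s) q != 0.
Proof.
move=> q0 Tt0.
have l0 : lead_coef q != 0 by rewrite lead_coef_eq0.
have cvg_h : (fun k => t0 + k.+1%:R^-1) @ \oo --> t0.
  by rewrite -[X in _ --> X]addr0; apply: cvgD; [exact: cvg_cst | exact: (@cvg_harmonic R)].
have H1 : \forall k \near \oo, T (t0 + k.+1%:R^-1) by exact: (cvg_h _ Tt0).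
have H2 := poly_shift_near (rc t0) l0.
have [k [Tk lk]] : exists k, T (t0 + k.+1%:R^-1) /\ (lead_coef q).[rc t0 + hseq R k] != 0.
  by have := filter_ex (filterI H1 H2) => -[k []]; exists k.
exists (t0 + k.+1%:R^-1) => //.
have qk : map_poly (horner_eval (rc (t0 + k.+1%:R^-1))) q != 0.
  by apply: map_poly_lead_neq0; rewrite /horner_eval rmorphD.
have [j jP] := filter_ex (poly_hseq_near qk).
by exists j.+1%:R^-1; rewrite ev2_swap.
Qed.

Lemma sdp_dataE (K : Type) (D D' : sdp_data K n m) :
  (forall i, dA D i = dA D' i) -> db D = db D' -> dC D = dC D' -> D = D'.
Proof. by case: D D' => A b c [A' b' c'] /= /funext-> -> ->. Qed.

Lemma kkt_algebraic (d : R -> sdp_data R n m) (T : set R) :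
  (forall t, T t -> \forall u \near t, T u) -> (forall t, T t -> sym_data (d t)) ->
  (exists2 t, T t & generic_nonsingular_time d t) -> data_polynomial T d ->
  exists P : 'I_(n * n + m) -> {poly {poly C}}, exists g : {poly C},
  [/\ g != 0, forall i, P i != 0 & forall t, T t -> g.[rc t] != 0 ->
    (forall w, adjA (d t) w = 0 -> w = 0) -> strictly_feasible (d t) ->
    exists X y, [/\ kkt (d t) X y,
      forall i, root (map_poly (horner_eval (rc t)) (P i)) (rc (to_row X y 0 i)) &
      forall v, v != 0 -> ~ (forall x : C,
        system (map_data rc (d t)) (map_mx rc (to_row X y) + x *: v) = 0)]].
Proof.
move=> oT symT [t0 Tt0 [_ [N [V [[S SE] [D1 VD1] VN]] dN]]] [pA pb pC].
have [PA PAE] : exists PA : 'I_m -> 'I_n -> 'I_n -> {poly R},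
    forall i a b t, T t -> dA (d t) i a b = (PA i a b).[t].
  have H (x : 'I_m * 'I_n * 'I_n) := pA x.1.1 x.1.2 x.2.
  have [f fP] := choice H.
  by exists (fun i a b => f (i, a, b)) => i a b t Tt; rewrite (fP (i, a, b)).
have [Pb PbE] : exists Pb : 'I_m -> {poly R}, forall i t, T t -> db (d t) i 0 = (Pb i).[t].
  have [f fP] := choice (fun i => pb i 0).
  by exists f => i t Tt; rewrite (fP i).
have [PC PCE] : exists PC : 'I_n -> 'I_n -> {poly R},
    forall a b t, T t -> dC (d t) a b = (PC a b).[t].
  have H (x : 'I_n * 'I_n) := pC x.1 x.2.
  have [f fP] := choice H.
  by exists (fun a b => f (a, b)) => a b t Tt; rewrite (fP (a, b)).
pose E : sdp_data R n m := SdpData (fun i => dA D1 i - dA (d t0) i) (db D1 - db (d t0))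
  (dC D1 - dC (d t0)).
have [sD1 pD1] : sym_data D1 /\
    exists2 p, S p & mpoly.meval (data_coords D1) p != 0 by move: VD1; rewrite SE.
have rd0 t : T t -> rdata PA Pb PC E t 0 = d t.
  move=> Tt; apply: sdp_dataE => [i||]; apply/matrixP => a b; rewrite [LHS]mxE mul0r addr0.
  - by rewrite PAE.
  - by rewrite (ord1 b) PbE.
  - by rewrite PCE.
have rd1 : rdata PA Pb PC E t0 1 = D1.
  apply: sdp_dataE => [i||]; apply/matrixP => a b; rewrite [LHS]mxE mul1r.
  - by rewrite -PAE // [dA E i a b]mxE [(- dA _ _) _ _]mxE addrCA subrr addr0.
  - by rewrite (ord1 b) -PbE // [db E a 0]mxE [(- db _) _ _]mxE addrCA subrr addr0.
  - by rewrite -PCE // [dC E a b]mxE [(- dC _) _ _]mxE addrCA subrr addr0.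
have rds t s : T t -> sym_data (rdata PA Pb PC E t s).
  move=> Tt; have [sA sC] := symT t Tt; have [sA0 sC0] := symT t0 Tt0; have [sA1 sC1] := sD1.
  split=> [i|]; apply/matrixP => a b; rewrite !mxE.
    rewrite -!PAE // -[in LHS](sA i) -[in LHS](sA0 i) -[in LHS](sA1 i).
    by rewrite [(dA (d t) i)^T _ _]mxE [(dA (d t0) i)^T _ _]mxE [(dA D1 i)^T _ _]mxE.
  rewrite -!PCE // -[in LHS]sC -[in LHS]sC0 -[in LHS]sC1.
  by rewrite [(dC (d t))^T _ _]mxE [(dC (d t0))^T _ _]mxE [(dC D1)^T _ _]mxE.
pose F := family PA Pb PC E.
have FE t s z : F (rc t) (rc s) z = system (map_data rc (rdata PA Pb PC E t s)) z.
  by rewrite /F /family cdata_real.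
have [r [rU rN rZ]] := zeros_enum (symT _ Tt0) dN.
have rZ' z : F (rc t0) 0 z = 0 <-> z \in r by rewrite -(rmorph0 rc) FE rd0.
(* The polynomial [p], nonzero at [D1], restricts to a polynomial in (t, s) that is nonzero at (t0,
   1); off its zeros and those of [q] the data are generic and have [N] zeros. *)
have gen (q : {poly {poly C}}) : q != 0 ->
    exists t s, ev2 t s q != 0 /\ at_most F (size r) t s.
  move=> q0; have [p Sp pD] := pD1.
  have [pi piE] := bipoly_meval PA Pb PC E p.
  pose piC := map_poly (map_poly rc) pi.
  have piCE t s : ev2 (rc t) (rc s) piC = rc (pi.[s%:P].[t]).
    by rewrite ev2E /piC -(map_polyC rc) horner_map horner_map.
  have piC0 : piC != 0.
    apply: contraNneq pD => piC0.
    have := piCE t0 1; rewrite piC0 rmorph0 -piE rd1 => /esym/eqP.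
    by rewrite fmorph_eq0.
  have [t Tt [s]] := bivariate_real_near (mulf_neq0 q0 piC0) (oT _ Tt0).
  have -> : ev2 (rc t) (rc s) (q * piC) = ev2 (rc t) (rc s) q * rc (pi.[s%:P].[t]).
    by rewrite -piCE rmorphM.
  rewrite mulf_eq0 negb_or fmorph_eq0 -piE => /andP[qts pts].
  exists (rc t), (rc s); split=> // w wZ.
  have VD : V (rdata PA Pb PC E t s) by rewrite SE; split; [exact: rds | exists p].
  have [r' [r'U r'N r'Z]] := zeros_enum (rds t s Tt) (VN _ VD).
  apply: contrapT => H.
  have winj : injective w.
    move=> j l jl; apply/eqP/negPn/negP => ne; apply: H; exists j, l; by split.
  have wr : {subset [seq w j | j <- enum 'I_(size r).+1] <= r'}.
    by move=> x /mapP[j _ ->]; apply/r'Z; rewrite -FE.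
  have wU : uniq [seq w j | j <- enum 'I_(size r).+1] by rewrite map_inj_uniq // enum_uniq.
  by have := uniq_leq_size wU wr; rewrite size_map size_enum_ord r'N -rN ltnn.
have [P [g [g0 P0 PP]]] := limits_of_zeros (family_expansion PA Pb PC E)
  (polyfun_family PA Pb PC E) rU rZ' gen.
exists P, g; split=> // t Tt gt inj sf.
have [U UU sU] := nat_ultrafilter.
(* The limit s -> 0+ is taken along s = 1 / (k + 1), the sequence for which [limits_of_zeros] is
   stated. *)
pose Ds k := rdata PA Pb PC E t k.+1%:R^-1.
have harm := @ultra_harmonic R _ sU.
have affc (a b : R) : (fun k => a + k.+1%:R^-1 * b) @ U --> a + 0 * b.
  by apply: cvgD; [exact: cvg_cst | apply: cvgM; [exact: harm | exact: cvg_cst]].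
have DD : dcvg U Ds (d t).
  rewrite -(rd0 t Tt); split=> [i||] a b; rewrite [in X in _ --> X]mxE;
  by under eq_fun do rewrite mxE; apply: affc.
have K : \forall k \near U, exists X y, kkt (Ds k) X y.
  by apply: (kkt_near sU _ DD inj sf) => k; exact: rds.
have [Z ZP] : exists Z : nat -> 'M[R]_n * 'cV[R]_m, forall k,
    (exists X y, kkt (Ds k) X y) -> kkt (Ds k) (Z k).1 (Z k).2.
  have H k : exists Z : 'M[R]_n * 'cV[R]_m,
      (exists X y, kkt (Ds k) X y) -> kkt (Ds k) Z.1 Z.2.
    have [[X [y kXy]]|no] := pselect (exists X y, kkt (Ds k) X y); first by exists (X, y).
    by exists (0, 0) => /no.
  by have [Z ZP] := choice H; exists Z.
have {}K : \forall k \near U, kkt (Ds k) (Z k).1 (Z k).2.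
  by move: K; apply: filterS => k; exact: ZP.
have m0 : (fun _ : nat => 0 : R) @ U --> (0 : R) by exact: cvg_cst.
have [|X [y [XX yy kXy]]] := kkt_compact (mu := fun=> 0) (X := fun k => (Z k).1)
  (y := fun k => (Z k).2) DD inj sf m0.
  by move: K; apply: filterS => k /kkt_perturbed.
pose z := map_mx rc (to_row X y); pose u k := map_mx rc (to_row (Z k).1 (Z k).2).
have uZ : \forall k \near U, F (rc t) (hseq R k) (u k) = 0.
  move: K; apply: filterS => k kk.
  by rewrite /hseq -/(rc _) FE system_map kkt_system // map_mx0.
have uz : vcvg U u z.
  move=> i; split; last by rewrite /u /z /= mxE; under eq_fun do rewrite mxE; exact: cvg_cst.
  have -> : complex.Re (z 0 i) = to_row X y 0 i by rewrite mxE.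
  have -> : (fun k => complex.Re (u k 0 i)) = (fun k => to_row (Z k).1 (Z k).2 0 i).
    by apply/funext => k; rewrite mxE.
  case: (split_ordP i) => l ->.
    case/mxvec_indexP: l => a b; rewrite /to_row row_mxEl mxvecE.
    by under eq_fun do rewrite row_mxEl mxvecE; exact: XX.
  rewrite /to_row row_mxEr mxE.
  by under eq_fun do rewrite row_mxEr mxE; exact: yy.
have [rt line] := PP _ gt U UU sU u z uZ uz.
exists X, y; split=> // [i|v v0 H].
  by have := rt i; rewrite /z mxE.
apply: (line v v0) => x; have := H x.
by rewrite -(rd0 t Tt) -FE (rmorph0 rc).
Qed.

End Algebraic.

(** * Algebraic functions of one real variable *)

(* In characteristic zero dividing [q] by a common divisor of [q] and [q'] does not
   lose roots. *)
Lemma root_cofactor (R : realType) (q g h r : {poly R}) (a b x : R) : q != 0 -> a != 0 ->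
  b != 0 -> a *: q = h * g -> b *: q^`() = r * g -> root q x -> root h x.
Proof.
move=> q0 a0 b0 qE q'E qx; apply/negPn/negP => hx.
have [k [q1 q1x kE]] := multiplicity_XsubC q x; rewrite q0 /= in q1x.
case: k => [|k] in kE.
  by move: qx; rewrite kE expr0 mulr1 (negPf q1x).
have d1 : ('X - x%:P) ^+ k.+1 %| g.
  have cop : coprimep (('X - x%:P) ^+ k.+1) h.
    by rewrite coprimep_expl // coprimep_sym coprimep_XsubC.
  rewrite -(Gauss_dvdpr _ cop) -qE kE.
  by rewrite -mul_polyC mulrA dvdp_mulIr.
have d2 : ('X - x%:P) ^+ k.+1 %| q^`().
  by rewrite -(dvdpZr _ _ b0) q'E dvdp_mull.
have : ('X - x%:P) ^+ k.+1 %| q1 *+ k.+1 * ('X - x%:P) ^+ k.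
  move: d2; rewrite kE derivM deriv_exp derivXsubC mul1r dvdp_addr ?dvdp_mulIr //.
  by rewrite mulrnAr mulrnAl.
rewrite exprSr [_ * ('X - x%:P) ^+ k]mulrC dvdp_mul2l ?expf_neq0 ?polyXsubC_eq0 //.
by rewrite dvdp_XsubCl rootE hornerMn mulrn_eq0 /= -rootE (negPf q1x).
Qed.

(** * The implicit function theorem for polynomial relations *)

Section ImplicitFunction.
Variable R : realType.
Local Notation ev t x Q := (map_poly (horner_eval t) Q).[x].

Lemma cvg_horner (I : Type) (F : set_system I) {FF : Filter F} (p : {poly R}) (u : I -> R) (a : R) :
  u @ F --> a -> (fun j => p.[u j]) @ F --> p.[a].
Proof.
move=> ua; exact: (cvg_comp _ _ ua (@continuous_horner _ p a)).
Qed.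

Lemma cvg_ev (I : Type) (F : set_system I) {FF : Filter F} (Q : {poly {poly R}})
    (u v : I -> R) (a b : R) : u @ F --> a -> v @ F --> b ->
  (fun j => ev (u j) (v j) Q) @ F --> ev a b Q.
Proof.
move=> ua vb; elim/poly_ind: Q => [|Q c IH].
  by rewrite rmorph0 horner0; under eq_fun do rewrite rmorph0 horner0; exact: cvg_cst.
have E t x : ev t x (Q * 'X + c%:P) = ev t x Q * x + c.[t].
  by rewrite rmorphD rmorphM /= map_polyX map_polyC !hornerE.
rewrite E; under eq_fun do rewrite E.
by apply: cvgD; [exact: cvgM | exact: cvg_horner].
Qed.

(** Difference quotients of polynomials are polynomials: this factorization and the one in t below
    reduce the differentiability of an implicit function to its continuity. *)
Lemma ev_diff_x (Q : {poly {poly R}}) t x : exists B : {poly R},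
  (forall x', ev t x' Q - ev t x Q = (x' - x) * B.[x']) /\ B.[x] = ev t x Q^`().
Proof.
set q := map_poly (horner_eval t) Q.
have [B BE] : exists B, q - q.[x]%:P = B * ('X - x%:P).
  by apply/factor_theorem; rewrite rootE !hornerE subrr.
exists B; split=> [x'|].
  by have := congr1 (fun p => p.[x']) BE; rewrite /= !hornerE mulrC.
have := congr1 (fun p => (deriv p).[x]) BE; rewrite /= derivB derivC subr0 derivM derivXsubC.
by rewrite !hornerE subrr mulr0 add0r ?mulr1 => <-; rewrite deriv_map.
Qed.

Lemma ev_diff_t (Q : {poly {poly R}}) t : exists A : {poly {poly R}},
  (forall t' x, ev t' x Q - ev t x Q = (t' - t) * ev t' x A) /\
  forall x, ev t x A = ev t x (map_poly deriv Q).
Proof.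
have H (q : {poly R}) : exists a : {poly R},
    (forall t', q.[t'] - q.[t] = (t' - t) * a.[t']) /\ a.[t] = q^`().[t].
  have [a aE] : exists a, q - q.[t]%:P = a * ('X - t%:P).
    by apply/factor_theorem; rewrite rootE !hornerE subrr.
  exists a; split=> [t'|].
    by have := congr1 (fun p => p.[t']) aE; rewrite /= !hornerE mulrC.
  have := congr1 (fun p => (deriv p).[t]) aE; rewrite /= derivB derivC subr0 derivM derivXsubC.
  by rewrite !hornerE subrr mulr0 add0r ?mulr1 => <-.
elim/poly_ind: Q => [|Q c [A [A1 A2]]].
  by exists 0; split=> [t' x|x]; rewrite ?map_poly0 ?rmorph0 !horner0 ?subrr ?mulr0.
have E s x (P : {poly {poly R}}) e : ev s x (P * 'X + e%:P) = ev s x P * x + e.[s].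
  by rewrite rmorphD rmorphM /= map_polyX map_polyC !hornerE.
have [a [a1 a2]] := H c; exists (A * 'X + a%:P); split=> [t' x|x].
  by rewrite !E mulrDr mulrA -A1 -a1; ring.
have -> : map_poly deriv (Q * 'X + c%:P) = map_poly deriv Q * 'X + (deriv c)%:P.
  apply/polyP => i; rewrite coef_map_id0 ?deriv0 // !coefD !coefMX !coefC derivD.
  by rewrite coef_map_id0 ?deriv0 //; case: eqP => _; rewrite ?deriv0.
by rewrite !E A2 a2.
Qed.

Lemma implicit_derivative (Q : {poly {poly R}}) (f : R -> R) t :
  {for t, continuous f} -> (\forall u \near t, ev u (f u) Q = 0) ->
  ev t (f t) Q^`() != 0 ->
  is_derive t 1 f (- ev t (f t) (map_poly deriv Q) / ev t (f t) Q^`()).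
Proof.
move=> ct f0 Bn.
have [B [B1 B2]] := ev_diff_x Q t (f t).
have [A [A1 A2]] := ev_diff_t Q t.
have sh : (fun h : R => h *: (1 : R) + t) @ 0^' --> t.
  have : (fun h : R => h *: (1 : R) + t) @ (0 : R) --> (0 : R) *: (1 : R) + t.
    by apply: cvgD; [apply: cvgZr_tmp; exact: cvg_id | exact: cvg_cst].
  by rewrite scale0r add0r => c; apply: cvg_trans c; apply: cvg_app; exact: nbhs_dnbhs.
have fs : (fun h : R => f (h *: 1 + t)) @ 0^' --> f t by exact: (cvg_comp _ _ sh ct).
have cA : (fun h : R => ev (h *: 1 + t) (f (h *: 1 + t)) A) @ 0^' -->
    ev t (f t) (map_poly deriv Q) by rewrite -A2; exact: cvg_ev.
have cB : (fun h : R => B.[f (h *: 1 + t)]) @ 0^' --> ev t (f t) Q^`().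
  by rewrite -B2; exact: cvg_horner.
have L : (fun h : R => h^-1 *: (f (h *: 1 + t) - f t)) @ 0^' -->
    - ev t (f t) (map_poly deriv Q) / ev t (f t) Q^`().
  have cc : (fun h : R => - ev (h *: 1 + t) (f (h *: 1 + t)) A * (B.[f (h *: 1 + t)])^-1) @ 0^' -->
      - ev t (f t) (map_poly deriv Q) / ev t (f t) Q^`().
    by apply: cvgM; [exact: cvgN | exact: cvgV].
  apply: cvg_trans cc; apply: near_eq_cvg.
  have Bnear : \forall h \near 0^', B.[f (h *: 1 + t)] != 0.
    have := cB _ (open_nbhs_nbhs (conj (@open_neq R 0) Bn)); exact.
  have Qnear : \forall h \near 0^', ev (h *: 1 + t) (f (h *: 1 + t)) Q = 0 by exact: (sh _ f0).
  have hn : \forall h \near (0:R)^', h != 0 by exact: nbhs_dnbhs_neq.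
  near=> h.
  have Bh : B.[f (h *: 1 + t)] != 0 by near: h.
  have Qh : ev (h *: 1 + t) (f (h *: 1 + t)) Q = 0 by near: h.
  have h0 : h != 0 by near: h.
  have Qt : ev t (f t) Q = 0 by exact: (nbhs_singleton f0).
  (* The intermediate point (t, f (t + h)) splits Q(t + h, f (t + h)) - Q(t, f t) = 0 into the two
     factorizations. *)
  have := A1 (h *: 1 + t) (f (h *: 1 + t)); have := B1 (f (h *: 1 + t)).
  rewrite Qh Qt subr0 sub0r addrK [h *: 1]mulr1 => e1 e2.
  rewrite /GRing.scale /= ; move: e1 e2 Bh; rewrite [h *: 1]mulr1.
  move: (ev t (f (h + t)) Q) (ev (h + t) (f (h + t)) A) B.[f (h + t)] (f (h + t) - f t).
  move=> w a b y -> e2 b0; have -> : a = - (y * b) / h by rewrite e2 mulrC mulKf.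
  by field; rewrite b0 h0.
by split; [apply/cvg_ex; eexists; exact: L | exact: cvg_lim L].
Unshelve. all: by end_near. Qed.

(** If [Q] is coprime to its derivative, Bezout shows that the derivative does not vanish on the
    graph off the zeros of [g], and [implicit_derivative] applies. Otherwise [Q] is replaced by its
    cofactor to the gcd, which keeps the roots by [root_cofactor]. The exceptional [g] depends on
    [Q] only, not on [f]. *)
Lemma algebraic_smooth (Q : {poly {poly R}}) : Q != 0 -> exists g : {poly R}, g != 0 /\
  forall (O : set R) (f : R -> R), (forall t, O t -> \forall u \near t, O u) ->
    (forall t, O t -> {for t, continuous f}) -> (forall t, O t -> ev t (f t) Q = 0) ->
    (forall t, O t -> g.[t] != 0) ->
    forall t, O t -> derivable f t 1 /\ {for t, continuous (derive1 f)}.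
Proof.
have [k] := ubnP (size Q); elim: k Q => // k IH Q; rewrite ltnS => sQ Q0.
have [cop|ncop] := boolP (coprimep Q Q^`()).
  have [c cE] : exists c, gcdp Q Q^`() = c%:P.
    by exists (gcdp Q Q^`())`_0; apply/size1_polyC; move: cop; rewrite /coprimep => /eqP->.
  have c0 : c != 0 by rewrite -(polyC_eq0 c) -cE gcdp_eq0 (negPf Q0).
  have [[q1 q2] /= /Pdiv.Idomain.eqpP[[c1 c2] /= /andP[c10 c20] E]] := Bezoutp Q Q^`().
  exists (c2 * c); split; first exact: mulf_neq0.
  move=> O f oO cf Qf gO.
  have D t : O t -> ev t (f t) Q^`() != 0.
    move=> Ot; apply: contraNneq (gO t Ot) => D0.
    have := congr1 (fun p => ev t (f t) p) E.
    rewrite /= cE -!mul_polyC !rmorphM /= !rmorphD !rmorphM /= !map_polyC !hornerE /=.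
    by rewrite Qf // D0 !mulr0 addr0 mulr0 /horner_eval -hornerM => <-.
  have dP t : O t -> is_derive t 1 f (- ev t (f t) (map_poly deriv Q) / ev t (f t) Q^`()).
    move=> Ot; apply: implicit_derivative; [exact: cf | | exact: D].
    by apply: filterS (oO t Ot) => w; apply: Qf.
  move=> t Ot; split; first by have [] := dP t Ot.
  have cc : (fun u => - ev u (f u) (map_poly deriv Q) / ev u (f u) Q^`()) @ t -->
      - ev t (f t) (map_poly deriv Q) / ev t (f t) Q^`().
    apply: cvgM; first by apply: cvgN; apply: cvg_ev; [exact: cvg_id | exact: cf].
    by apply: cvgV; [exact: D | apply: cvg_ev; [exact: cvg_id | exact: cf]].
  have dE u : O u -> derive1 f u = - ev u (f u) (map_poly deriv Q) / ev u (f u) Q^`().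
    by move=> Ou; rewrite derive1E; have := dP u Ou => -[_ ->].
  rewrite /prop_for /continuous_at dE //; apply: cvg_trans cc; apply: near_eq_cvg.
  by apply: filterS (oO t Ot) => u Ou; rewrite /= dE.
have [[l r] /= l0 E] := Pdiv.Idomain.dvdpP _ _ (dvdp_gcdl Q Q^`()).
have [[l' r'] /= l'0 E'] := Pdiv.Idomain.dvdpP _ _ (dvdp_gcdr Q Q^`()).
have lQ0 : l *: Q != 0 by rewrite scale_poly_eq0 negb_or l0.
have r0 : r != 0 by apply: contraNneq lQ0 => r0; rewrite E r0 mul0r.
have G0 : gcdp Q Q^`() != 0 by rewrite gcdp_eq0 (negPf Q0).
have [|//|g [g0 gP]] := IH r.
  apply: leq_trans sQ; rewrite -(size_scale Q l0) E size_mul //.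
  have : (1 < size (gcdp Q Q^`()))%N.
    rewrite ltn_neqAle lt0n size_poly_eq0 G0 andbT eq_sym.
    by move: ncop; rewrite /coprimep.
  by case: (size (gcdp Q Q^`())) => [|[|j]] // _; rewrite !addnS /= ltnS leq_addr.
(* The scalars of the two divisions and the leading coefficient must survive at t for
   [root_cofactor] to apply to the specialized polynomials. *)
exists (g * l * l' * lead_coef Q); split; first by rewrite !mulf_neq0 // lead_coef_eq0.
move=> O f oO cf Qf gO.
have gO' t : O t -> [/\ g.[t] != 0, l.[t] != 0, l'.[t] != 0 & (lead_coef Q).[t] != 0].
  by move=> /gO; rewrite !hornerM !mulf_eq0 !negb_or => /andP[/andP[/andP[]]].
apply: gP oO cf _ _ => t Ot; last by have [] := gO' t Ot.
have [_ lt l't Qt] := gO' t Ot.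
apply/eqP; rewrite -/(root _ _).
apply: (@root_cofactor _ (map_poly (horner_eval t) Q) (map_poly (horner_eval t) (gcdp Q Q^`()))
  _ (map_poly (horner_eval t) r') l.[t] l'.[t]).
- by apply: map_poly_lead_neq0; exact: Qt.
- exact: lt.
- exact: l't.
- by rewrite -rmorphM /= -E map_polyZ.
- by rewrite deriv_map -rmorphM /= -E' map_polyZ.
- by rewrite rootE Qf.
Qed.

Lemma complex_coefficients (A B : comNzRingType) (h : {rmorphism B -> A}) (c : A) :
  (forall a, exists b1 b2, a = h b1 + c * h b2) ->
  forall p : {poly A}, exists p1 p2, p = map_poly h p1 + c%:P * map_poly h p2.
Proof.
move=> H; elim/poly_ind=> [|p a [p1 [p2 ->]]].
  by exists 0, 0; rewrite !rmorph0 mulr0 addr0.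
have [b1 [b2 ->]] := H a; exists (p1 * 'X + b1%:P), (p2 * 'X + b2%:P).
rewrite !rmorphD !rmorphM /= !map_polyX !map_polyC /=; ring.
Qed.

(** A complex relation at a real point splits into two real ones, and at least one of the two parts
    is a nonzero polynomial. [complex_coefficients] is applied to the inner and then to the outer
    coefficients. *)
Lemma real_relation (P : {poly {poly R[i]}}) : P != 0 ->
  exists Q : {poly {poly R}}, Q != 0 /\ forall t x : R,
    root (map_poly (horner_eval t%:C%C) P) x%:C%C -> ev t x Q = 0.
Proof.
move=> P0.
have H0 (a : R[i]) : exists b1 b2, a = real_complex R b1 + 'i%C * real_complex R b2.
  by case: a => a b; exists a, b; simpc.
have [Q1 [Q2 PE]] := complex_coefficients (h := map_poly (real_complex R))
  (complex_coefficients H0) P.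
have evE t x Q : (map_poly (horner_eval t%:C%C)
    (map_poly (map_poly (real_complex R)) Q)).[x%:C%C] = (ev t x Q)%:C%C.
  rewrite -map_poly_comp /= -horner_map -map_poly_comp; congr _.[_].
  by apply: eq_map_poly => q /=; rewrite /horner_eval horner_map.
have PQ t x : root (map_poly (horner_eval t%:C%C) P) x%:C%C -> ev t x Q1 = 0 /\ ev t x Q2 = 0.
  rewrite PE rmorphD rmorphM rootE /= map_polyC /= hornerD hornerM !evE !hornerC.
  rewrite /horner_eval hornerC; move: (ev t x Q1) (ev t x Q2) => a b.
  by simpc => /eqP[-> ->].
have [Q10|Q10] := eqVneq Q1 0; last by exists Q1; split=> // t x /PQ[].
exists Q2; split; last by move=> t x /PQ[].
by apply: contraNneq P0 => Q20; rewrite PE Q10 Q20 !rmorph0 mulr0 addr0.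
Qed.

End ImplicitFunction.

(** * Types of points *)

Lemma near_setD_finite (R : realType) (T B : set R) :
  (forall t, T t -> \forall u \near t, T u) -> finite_set B ->
  forall t, (T `\` B) t -> \forall u \near t, (T `\` B) u.
Proof.
move=> oT finB t [Tt Bt]; have cB : closed B.
  exact: (accessible_finite_set_closed.1 (hausdorff_accessible (@Rhausdorff R))).
have nB : \forall u \near t, (~` B) u by apply: open_nbhs_nbhs; split; first exact: closed_openC.
by have := oT t Tt; move: nB; apply: filterS2 => u; split.
Qed.

Section PointTypes.
Variables (R : realType) (V : normedModType R) (T B : set R) (F : R -> set V).
Hypotheses (oT : forall t, T t -> \forall u \near t, T u) (finB : finite_set B).
Hypothesis F_nonempty : forall t, T t -> F t !=set0.
Hypothesis F_osc : forall t, T t -> outer_semicontinuous_at T F t.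
Hypothesis F_isc : forall t, T t -> single_valued_at F t -> inner_semicontinuous_at T F t.
Hypothesis F_C1 : forall t, T t -> ~ B t -> continuously_differentiable_at F t.

Lemma isolated t : T t ->
  exists2 e, 0 < e & forall u, `|u - t| < e -> u != t -> T u /\ ~ B u.
Proof.
move=> Tt; have [||e /= e0 eP] := near_setD_finite oT (B := B `\ t) _ (t := t).
- exact: finite_setD.
- by split=> // -[_]; apply.
exists e => // u ue ut; have [|Tu nB] := eP u; first by rewrite /= distrC.
by split=> // Bu; apply: nB; split=> // /eqP; rewrite (negPf ut).
Qed.

Lemma C1_single t : continuously_differentiable_at F t -> single_valued_at F t.
Proof. by move=> [f /nbhs_singleton[Ft _ _]]; exists (f t). Qed.

Lemma C1_differentiable t : continuously_differentiable_at F t -> differentiable_at F t.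
Proof.
move=> [f H]; exists f; split; last by have /nbhs_singleton[_ df _] := H.
by apply: filterS H => u [].
Qed.

Lemma single_sv_continuous t : T t -> single_valued_at F t ->
  [/\ T t, single_valued_at F t & pk_continuous_at T F t].
Proof. by move=> Tt sF; split=> //; split; [exact: F_isc | exact: F_osc]. Qed.

Lemma sv_continuous_near t : T t -> exists2 e, 0 < e & forall u, t - e < u < t + e ->
  u = t \/ [/\ T u, single_valued_at F u & pk_continuous_at T F u].
Proof.
move=> Tt; have [e e0 eP] := isolated Tt; exists e => // u /andP[u1 u2].
have [->|ut] := eqVneq u t; [by left | right].
have [|Tu Bu] := eP u _ ut; first by rewrite ltr_norml; apply/andP; split; lra.
by apply: single_sv_continuous => //; apply/C1_single/F_C1.
Qed.

Lemma single_point_type t x : T t -> F t = [set x] ->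
  exists2 e, 0 < e & sv_continuous_on T F `]t - e, t + e[.
Proof.
move=> Tt Ft; have [e e0 eP] := sv_continuous_near Tt; exists e => // u /=.
rewrite in_itv /= => /eP[->|//]; apply: single_sv_continuous => //; by exists x.
Qed.

Lemma multiple_point_type t : T t ->
  exists2 e, 0 < e & sv_continuous_on T F (`]t - e, t[ `|` `]t, t + e[).
Proof.
move=> Tt; have [e e0 eP] := sv_continuous_near Tt; exists e => // u /= H.
have [] // := eP u; first by apply/andP; case: H; rewrite in_itv /= => /andP[]; split; lra.
by move=> E; case: H; rewrite in_itv /= E ltxx ?andbF.
Qed.

Lemma irregular_sub : [set t | exists x, irregular_point T F x t] `<=` B.
Proof.
move=> t /= [x irr]; apply: contrapT => Bt.
have Tt : T t by case: irr => -[].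
have C := F_C1 Tt Bt; case: irr => -[_ Ftx _].
  by apply; exact: C1_differentiable.
move=> [y [z [Fy Fz /eqP yz]]]; have [w Ft] := C1_single C.
by apply: yz; move: Fy Fz; rewrite Ft /= => -> ->.
Qed.

Lemma regular_or_irregular t x : T t -> F t x -> ~ irregular_point T F x t ->
  regular_point T F x t.
Proof.
move=> Tt Fx nirr; have [Ft|nFt] := pselect (F t = [set x]).
  have H := single_point_type Tt Ft; split=> //.
  by apply: contrapT => nd; apply: nirr; left; split.
exfalso; apply: nirr; right; split=> //; first exact: multiple_point_type.
apply: contrapT => nm; apply: nFt; apply/seteqP; split=> y /=; last by move=> ->.
by move=> Fy; apply/eqP/negPn/negP => yx; apply: nm; exists y, x.
Qed.

(** At a regular point F(t) is a singleton, so a pair is determined by its time, which lies in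
    [B]. *)
Lemma non_C1_finite : finite_set [set p : V * R | regular_point T F p.1 p.2 /\
  ~ continuously_differentiable_at F p.2].
Proof.
apply: (@sub_finite_set _ _ ((fun t => (xget 0 (F t), t)) @` B)); last exact: finite_image.
move=> [x t] /= [[Tt Ft _ _] nC]; exists t.
  by apply: contrapT => Bt; apply: nC; exact: F_C1.
by rewrite Ft; congr (_, _); apply: xget_unique => // y ->.
Qed.

End PointTypes.

(** Were [A] not in [F], the trace of [F] on the complement of [A] would be proper, and an
    ultrafilter refining it would contain both sets. This turns limits along ultrafilters into
    limits along [\oo]. *)
Lemma ultra_filter_all (I : Type) (F : set_system I) {FF : ProperFilter F} (A : set I) :
  (forall U, UltraFilter U -> F `<=` U -> U A) -> F A.
Proof.
move=> H; apply: contrapT => nFA.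
pose G := within (~` A) F.
have GF : ProperFilter G.
  apply: Build_ProperFilter_ex => B GB; apply: contrapT => nB; apply: nFA.
  have : F (fun x => (~` A) x -> B x) by exact: GB.
  by apply: filterS => x /= xB; apply: contrapT => /xB Bx; apply: nB; exists x.
have [U [UU sU]] := ultraFilterLemma GF.
have UA : U A by apply: H => // B FB; apply: sU; apply: filterS FB => x.
have UnA : U (~` A) by apply: sU; exact: withinT.
have : U (A `&` ~` A) by exact: filterI.
by rewrite setICr; exact: filter_not_empty.
Qed.

Lemma cvg_matrix (R : realType) (I : Type) (F : set_system I) {FF : Filter F} n p
    (X : I -> 'M[R]_(n, p)) (L : 'M[R]_(n, p)) :
  (forall i j, (fun k => X k i j) @ F --> L i j) -> X @ F --> L.
Proof.
move=> H; apply/cvgrPdist_le => /= e e0; near=> x.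
rewrite /Num.Def.normr /= mx_normrE (bigmax_le _ (ltW e0)) //= => i _.
rewrite !mxE /=; move: i; near: x; apply: filter_forall => /= i.
exact: ((cvgrPdist_le _ _).1 (H i.1 i.2)).
Unshelve. all: by end_near. Qed.

(** * Continuously differentiable functions on an open set *)

Section C1.
Variables (R : realType) (O : set R).
Hypothesis oO : forall t, O t -> \forall u \near t, O u.

Definition C1on (f : R -> R) : Prop :=
  forall t, O t -> derivable f t 1 /\ {for t, continuous (derive1 f)}.

Lemma derivable_cvg (f : R -> R) (t : R) : derivable f t 1 -> f @ t --> f t.
Proof. by move=> df; apply/differentiable_continuous/derivable1_diffP. Qed.

Lemma C1on_derive (f f' : R -> R) : (forall t, O t -> is_derive t 1 f (f' t)) ->
  (forall t, O t -> f' @ t --> f' t) -> C1on f.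
Proof.
move=> df cf' t Ot; split; first by have [] := df t Ot.
have E u : O u -> derive1 f u = f' u by move=> Ou; rewrite derive1E; have [_ ->] := df u Ou.
rewrite /prop_for /continuous_at E //; apply: cvg_trans (cf' t Ot); apply: near_eq_cvg.
by apply: filterS (oO Ot) => u Ou; rewrite E.
Qed.

Lemma C1on_is_derive f t : C1on f -> O t ->
  is_derive t 1 f (derive1 f t) /\ derive1 f @ t --> derive1 f t.
Proof.
move=> cf Ot; have [df cdf] := cf t Ot; split=> //.
by split=> //; rewrite derive1E.
Qed.

Lemma C1on_ext (f g : R -> R) : (forall t, O t -> f t = g t) -> C1on f -> C1on g.
Proof.
move=> fg cf; apply: (@C1on_derive _ (derive1 f)) => t Ot; last first.
  by have [] := C1on_is_derive cf Ot.
have [df _] := cf t Ot.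
have nfg : \forall u \near t, f u = g u by apply: filterS (oO Ot) => u; exact: fg.
split; first exact: near_eq_derivable nfg df.
by rewrite derive1E; apply/esym/near_eq_derive.
Qed.

Lemma C1onD (f g : R -> R) : C1on f -> C1on g -> C1on (fun t => f t + g t).
Proof.
move=> cf cg; apply: (@C1on_derive _ (fun t => derive1 f t + derive1 g t)) => t Ot.
  have [df _] := C1on_is_derive cf Ot; have [dg _] := C1on_is_derive cg Ot.
  exact: is_deriveD.
have [_ df] := C1on_is_derive cf Ot; have [_ dg] := C1on_is_derive cg Ot.
exact: cvgD.
Qed.

Lemma C1onM (f g : R -> R) : C1on f -> C1on g -> C1on (fun t => f t * g t).
Proof.
move=> cf cg.
apply: (@C1on_derive _ (fun t => f t * derive1 g t + g t * derive1 f t)) => t Ot.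
  have [df _] := C1on_is_derive cf Ot; have [dg _] := C1on_is_derive cg Ot.
  exact: is_deriveM.
have [_ df] := C1on_is_derive cf Ot; have [_ dg] := C1on_is_derive cg Ot.
have [/derivable_cvg cft _] := cf t Ot; have [/derivable_cvg cgt _] := cg t Ot.
by apply: cvgD; apply: cvgM.
Qed.

Lemma C1on_poly (p : {poly R}) : C1on (horner p).
Proof.
apply: (@C1on_derive _ (horner p^`())) => t _.
exact: continuous_horner.
Qed.

Lemma C1on_sum (I : Type) (r : seq I) (f : I -> R -> R) :
  (forall i, C1on (f i)) -> C1on (fun t => \sum_(i <- r) f i t).
Proof.
move=> cf; elim: r => [|i r IH].
  apply: (@C1on_ext (horner 0)); last exact: C1on_poly.
  by move=> t _; rewrite horner0 big_nil.
apply: (C1on_ext (f := fun t => f i t + \sum_(j <- r) f j t)); last exact: C1onD.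
by move=> t _; rewrite big_cons.
Qed.

Lemma C1on_matrix n p (f : R -> 'M[R]_(n, p)) : (forall i j, C1on (fun t => f t i j)) ->
  forall t, O t -> derivable f t 1 /\ {for t, continuous (derive1 f)}.
Proof.
move=> cf t Ot.
have df u : O u -> derivable f u 1.
  by move=> Ou; apply/derivable_mxP => i j; have [] := cf i j u Ou.
split; first exact: df.
apply: cvg_matrix => i j.
have E u : O u -> derive1 f u i j = derive1 (fun t => f t i j) u.
  by move=> Ou; rewrite !derive1E derive_mx ?mxE //; exact: df.
rewrite E //; have [_] := cf i j t Ot; apply: cvg_trans; apply: near_eq_cvg.
by apply: filterS (oO Ot) => u Ou; rewrite E.
Qed.

End C1.

(** * Optimal solutions as functions of time *)

Lemma finite_real_roots (R : realType) (p : {poly R[i]}) : p != 0 ->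
  finite_set [set t : R | p.[(t%:C)%C] = 0].
Proof.
move=> p0; have [r pE] := closed_field_poly_normal p.
apply: (@sub_finite_set _ _ [set` [seq complex.Re z | z <- r]]); last by apply/finite_seqP; eexists.
move=> t /= /eqP; rewrite -/(root p _) pE rootZ ?lead_coef_eq0 // root_prod_XsubC => tr.
by apply/mapP; exists (t%:C)%C.
Qed.

Section Solutions.
Variables (R : realType) (n m : nat) (d : R -> sdp_data R n m) (T : set R).
Local Notation C := R[i].
Local Notation rc := (real_complex R).
Hypothesis oT : forall t, T t -> \forall u \near t, T u.
Hypothesis symT : forall t, T t -> sym_data (d t).
Hypothesis injT : forall t, T t -> forall w, adjA (d t) w = 0 -> w = 0.
Hypothesis sfT : forall t, T t -> strictly_feasible (d t).
Hypothesis contT : forall t, T t -> data_continuous_at d t.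

Lemma dcvg_data (U : set_system nat) {FU : Filter U} (u : nat -> R) t : T t -> u @ U --> t ->
  dcvg U (d \o u) (d t).
Proof.
move=> Tt ut; have [cA cb cC] := contT Tt; split=> [i||] a b.
- exact: (cvg_comp _ _ (cvg_comp _ _ ut (cA i)) (@coord_continuous _ _ _ a b _)).
- exact: (cvg_comp _ _ (cvg_comp _ _ ut cb) (@coord_continuous _ _ _ a b _)).
- exact: (cvg_comp _ _ (cvg_comp _ _ ut cC) (@coord_continuous _ _ _ a b _)).
Qed.

Lemma kkt_limit (U : set_system nat) (UU : UltraFilter U) (u : nat -> R) t X y : T t ->
  u @ U --> t -> (\forall k \near U, kkt (d (u k)) (X k) (y k)) ->
  exists X' y', [/\ mcvg U X X', mcvg U y y' & kkt (d t) X' y'].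
Proof.
move=> Tt ut K; have m0 : (fun _ : nat => 0 : R) @ U --> (0 : R) by exact: cvg_cst.
apply: kkt_compact (dcvg_data Tt ut) (injT Tt) (sfT Tt) m0 _.
by move: K; apply: filterS => k /kkt_perturbed.
Qed.

Lemma kkt_choice : exists xy : R -> 'M[R]_n * 'cV[R]_m,
  forall t, T t -> kkt (d t) (xy t).1 (xy t).2.
Proof.
have H t : exists z : 'M[R]_n * 'cV[R]_m, T t -> kkt (d t) z.1 z.2.
  have [Tt|nT] := pselect (T t); last by exists (0, 0).
  by have [X [y K]] := kkt_exists (symT Tt) (injT Tt) (sfT Tt); exists (X, y).
by have [xy xyP] := choice H; exists xy.
Qed.

Lemma smooth_solutions : (exists2 t, T t & generic_nonsingular_time d t) ->
  data_polynomial T d -> exists B : set R, exists X : R -> 'M[R]_n, exists y : R -> 'cV[R]_m,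
  [/\ finite_set B,
    forall t, T t -> ~ B t -> forall X' y', kkt (d t) X' y' <-> X' = X t /\ y' = y t,
    forall i j, C1on (T `\` B) (fun t => X t i j) & forall i, C1on (T `\` B) (fun t => y t i 0)].
Proof.
move=> gen poly; have [P [g [g0 P0 PP]]] := kkt_algebraic oT symT gen poly.
have [xy xyP] := kkt_choice.
have [Q QP] := choice (fun i => real_relation (P0 i)).
have [h hP] := choice (fun i => algebraic_smooth (QP i).1).
(* The real zeros of [G] are the exceptional times, where uniqueness or smoothness may fail. *)
pose G := g * \prod_i map_poly rc (h i).
have G0 : G != 0.
  rewrite mulf_neq0 //; apply/prodf_neq0 => i _; rewrite map_poly_eq0.
  exact: (hP i).1.
pose B := [set t : R | G.[rc t] = 0].
have BP t : ~ B t -> g.[rc t] != 0 /\ forall i, (h i).[t] != 0.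
  move=> /eqP; rewrite /G hornerM mulf_eq0 negb_or horner_prod => /andP[gt].
  move=> /prodf_neq0 ht; split=> // i; have := ht i isT.
  by rewrite horner_map fmorph_eq0.
have finB : finite_set B by exact: finite_real_roots.
have oB := near_setD_finite oT finB.
(* Two KKT points are compared through (X', y0), a KKT point by the product structure, so that X and
   y are identified one at a time. *)
have uniq t : T t -> ~ B t -> forall X' y', kkt (d t) X' y' <-> X' = (xy t).1 /\ y' = (xy t).2.
  move=> Tt /BP[gt _].
  have [X0 [y0 [K0 _ line]]] := PP t Tt gt (injT Tt) (sfT Tt).
  have U X' y' : kkt (d t) X' y' -> X' = X0 /\ y' = y0.
    move=> K; have K1 := Pstar_kkt K0 (kkt_Pstar K).
    have XE : X' = X0 by have [h1 _] := kkt_unique K0 line X' y0; exact: h1.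
    by split=> //; have [_ h2] := kkt_unique K0 line X' y'; apply: h2; rewrite -XE.
  have [E1 E2] := U _ _ (xyP t Tt).
  by move=> X' y'; rewrite E1 E2; split=> [/U|[-> ->]].
have roots t : T t -> ~ B t -> forall i,
    (map_poly (horner_eval t) (Q i)).[to_row (xy t).1 (xy t).2 0 i] = 0.
  move=> Tt Bt i; have [gt _] := BP t Bt.
  have [X0 [y0 [K0 rt _]]] := PP t Tt gt (injT Tt) (sfT Tt).
  have [<- <-] := (uniq t Tt Bt X0 y0).1 K0.
  exact: ((QP i).2 _ _ (rt i)).
(* Continuity comes from compactness: along every ultrafilter finer than [\oo], KKT points at times
   tending to t converge to a KKT point at t, and there is only one. *)
have cont t : (T `\` B) t -> forall i,
    {for t, continuous (fun u => to_row (xy u).1 (xy u).2 0 i)}.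
  move=> [Tt Bt] i; apply/(@cvg_nbhsP _ R^o) => u ut A nA.
  have FE : ProperFilter (\oo : set_system nat) by exact: eventually_filter.
  change (\oo (fun k => A (to_row (xy (u k)).1 (xy (u k)).2 0 i))).
  apply: ultra_filter_all => U UU sU.
  have utU : u @ U --> t by move=> W /ut; apply: sU.
  have TU : \forall k \near U, T (u k) by exact: utU (oT Tt).
  have K : \forall k \near U, kkt (d (u k)) (xy (u k)).1 (xy (u k)).2.
    by move: TU; apply: filterS => k; exact: xyP.
  have [X' [y' [XX yy /(uniq t Tt Bt)[X'E y'E]]]] :=
    kkt_limit UU (X := fun k => (xy (u k)).1) (y := fun k => (xy (u k)).2) Tt utU K.
  rewrite X'E in XX; rewrite y'E in yy.
  suff c : (fun k => to_row (xy (u k)).1 (xy (u k)).2 0 i) @ U --> to_row (xy t).1 (xy t).2 0 i.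
    exact: (c A nA).
  case: (split_ordP i) => l ->.
    case/mxvec_indexP: l => a b; rewrite /to_row row_mxEl mxvecE.
    by under eq_fun do rewrite row_mxEl mxvecE; exact: XX.
  rewrite /to_row row_mxEr mxE.
  by under eq_fun do rewrite row_mxEr mxE; exact: yy.
have C1 i : C1on (T `\` B) (fun t => to_row (xy t).1 (xy t).2 0 i).
  move=> t Ot; apply: ((hP i).2 (T `\` B) _ oB _ _ _ t Ot).
  - by move=> u Ou; exact: cont.
  - by move=> u [Tu Bu]; exact: roots.
  - by move=> u [Tu Bu]; have [_] := BP u Bu.
exists B, (fun t => (xy t).1), (fun t => (xy t).2); split=> // [i j|i].
  apply: (C1on_ext oB _ (C1 (lshift m (mxvec_index i j)))) => t _.
  by rewrite /to_row row_mxEl mxvecE.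
apply: (C1on_ext oB _ (C1 (rshift (n * n) i))) => t _.
by rewrite /to_row row_mxEr mxE.
Qed.

(** * Primal and dual solution maps at once, as images of KKT points *)

Section Component.
Variables (F : R -> set 'M[R]_n) (phi : sdp_data R n m -> 'M[R]_n -> 'cV[R]_m -> 'M[R]_n).
Hypothesis FE : forall t Z, T t -> F t Z <-> exists X y, kkt (d t) X y /\ Z = phi (d t) X y.
Hypothesis phi_cvg : forall (U : set_system nat), UltraFilter U -> forall Ds D X X' y y',
  dcvg U Ds D -> mcvg U X X' -> mcvg U y y' ->
  mcvg U (fun k => phi (Ds k) (X k) (y k)) (phi D X' y').

Lemma component_nonempty t : T t -> F t !=set0.
Proof.
move=> Tt; have [xy xyP] := kkt_choice; exists (phi (d t) (xy t).1 (xy t).2).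
by apply/FE => //; exists (xy t).1, (xy t).2; split=> //; exact: xyP.
Qed.

Lemma component_limit t (u : nat -> R) Z : T t -> (forall k, T (u k)) -> u @ \oo --> t ->
  (forall k, F (u k) (Z k)) -> forall U, UltraFilter U -> \oo `<=` U ->
  exists2 Z', mcvg U Z Z' & F t Z'.
Proof.
move=> Tt Tu ut FZ U UU sU.
have [X XP] := choice (fun k => (FE (Z k) (Tu k)).1 (FZ k)).
have [y K] := choice XP.
have utU : u @ U --> t by move=> W /ut; apply: sU.
have [|X' [y' [XX yy K']]] := kkt_limit UU (X := X) (y := y) Tt utU.
  by apply: nearW => k; have [] := K k.
exists (phi (d t) X' y'); last by apply/FE => //; exists X', y'.
have -> : Z = (fun k => phi ((d \o u) k) (X k) (y k)).
  by apply/funext => k; have [_ ->] := K k.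
by apply: phi_cvg => //; exact: dcvg_data.
Qed.

Lemma component_osc t : T t -> outer_semicontinuous_at T F t.
Proof.
move=> Tt Z u Z_ Tu ut FZ ZZ; have [U UU sU] := nat_ultrafilter.
have [Z' ZZ' FZ'] := component_limit Tt Tu ut FZ UU sU.
suff -> : Z = Z' by [].
apply: (mcvg_unique (U := U) (X := Z_)) => // i j.
have c : Z_ @ U --> Z by move=> W /ZZ; apply: sU.
exact: (cvg_comp _ _ c (@coord_continuous _ _ _ i j _)).
Qed.

(** Any selection works: along each ultrafilter its values converge to the single element of F(t),
    hence they converge along [\oo]. *)
Lemma component_isc t : T t -> single_valued_at F t -> inner_semicontinuous_at T F t.
Proof.
move=> Tt [Z0 FZ0] Z FZ u Tu ut.
have [Z_ Z_P] := choice (fun k => component_nonempty (Tu k)).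
exists Z_; split=> // A nA.
have FE' : ProperFilter (\oo : set_system nat) by exact: eventually_filter.
change (\oo (fun k => A (Z_ k))).
apply: ultra_filter_all => U UU sU.
have [Z' ZZ' FZ'] := component_limit Tt Tu ut Z_P UU sU.
have c : Z_ @ U --> Z'  by exact: cvg_matrix.
by apply: c; move: FZ FZ'; rewrite FZ0 => <- ->.
Qed.

Lemma component_types B X y : finite_set B ->
  (forall t, T t -> ~ B t -> forall X' y', kkt (d t) X' y' <-> X' = X t /\ y' = y t) ->
  (forall i j, C1on (T `\` B) (fun t => phi (d t) (X t) (y t) i j)) ->
  [/\ finite_set [set t | exists Z, irregular_point T F Z t],
    forall t Z, T t -> F t Z -> ~ irregular_point T F Z t -> regular_point T F Z t &
    finite_set [set p : 'M[R]_n * R | regular_point T F p.1 p.2 /\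
      ~ continuously_differentiable_at F p.2]].
Proof.
move=> finB uniq C1.
have oB := near_setD_finite oT finB.
have FC1 t : T t -> ~ B t -> continuously_differentiable_at F t.
  move=> Tt Bt; exists (fun t => phi (d t) (X t) (y t)).
  apply: filterS (oB t (conj Tt Bt)) => u Ou.
  have [df cf] := C1on_matrix oB C1 Ou; split=> //; case: Ou => Tu Bu.
  apply/seteqP; split=> Z /=; first by move=> /(FE _ Tu)[X' [y' [/(uniq u Tu Bu)[-> ->]]]].
  move=> ->; apply/FE => //; exists (X u), (y u); split=> //.
  by apply/uniq.
split; first exact: sub_finite_set (irregular_sub FC1) finB.
- move=> t Z; apply: (regular_or_irregular oT finB) => //.
  + exact: component_osc.
  + exact: component_isc.
- exact: non_C1_finite finB FC1.
Qed.

End Component.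
End Solutions.

Lemma open_interval_near (R : realType) (a b : \bar R) t : open_interval a b t ->
  \forall u \near t, open_interval a b u.
Proof.
move=> [at_ tb]; have H1 : \forall u \near t, (a < u%:E)%E.
  case: a at_ => [a| |] //; last by move=> _; exists 1 => [|u _]; [exact: ltr01|]; exact: ltNyr.
  by rewrite lte_fin => h; apply: filterS (lt_nbhsr h) => u; rewrite lte_fin.
have H2 : \forall u \near t, (u%:E < b)%E.
  case: b tb => [b| |] //; last by move=> _; exists 1 => [|u _]; [exact: ltr01|]; exact: ltry.
  by rewrite lte_fin => h; apply: filterS (lt_nbhsl h) => u; rewrite lte_fin.
by move: H1 H2; apply: filterS2 => u; split.
Qed.

Theorem theorem3p16 (R : realType) (n m : nat) (ti tf : \bar R)
    (d : R -> sdp_data R n m) (T : set R) (defT : T = open_interval ti tf)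
    (data_sym : forall t, T t -> sym_data (d t))
    (data_licq : forall t, T t -> licq (d t))
    (data_bounded : exists M : R, forall t, T t -> op_norms_le M (d t))
    (data_strict : forall t, T t ->
      primal_strictly_feasible (d t) /\ dual_strictly_feasible (d t))
    (data_cont : forall t, T t -> data_continuous_at d t)
    (data_generic : exists2 t, T t & generic_nonsingular_time d t)
    (data_poly : data_polynomial T d) :
  [/\ finite_set [set t | (exists X, irregular_point T (Pstar d) X t) \/
                          (exists Z, irregular_point T (Dstar d) Z t)],
      forall t, T t ->
        (forall X, Pstar d t X -> ~ irregular_point T (Pstar d) X t ->
           regular_point T (Pstar d) X t) /\
        (forall Z, Dstar d t Z -> ~ irregular_point T (Dstar d) Z t ->
           regular_point T (Dstar d) Z t) &
      finite_set [set p : 'M[R]_n * R | regular_point T (Pstar d) p.1 p.2 /\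
                    ~ continuously_differentiable_at (Pstar d) p.2] /\
      finite_set [set p : 'M[R]_n * R | regular_point T (Dstar d) p.1 p.2 /\
                    ~ continuously_differentiable_at (Dstar d) p.2]].
Proof.
have oT t : T t -> \forall u \near t, T u by rewrite defT; exact: open_interval_near.
have inj t : T t -> forall w, adjA (d t) w = 0 -> w = 0.
  by move=> Tt w; apply: licq_adjA_inj; exact: data_licq.
have sf t : T t -> strictly_feasible (d t).
  move=> Tt; have [sp [y [Z [pZ /dual_feasible_slack ZE]]]] := data_strict t Tt.
  by split=> //; exists y; rewrite -ZE.
have [B [X [y [finB uniq CX Cy]]]] :=
  smooth_solutions oT data_sym inj sf data_cont data_generic data_poly.
(* [phi] returns X in the primal case and the slack of y in the dual one. *)
have PE t Z : T t -> Pstar d t Z <->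
    exists X y, kkt (d t) X y /\ Z = (fun _ X _ => X) (d t) X y.
  move=> Tt; have [X0 [y0 K0]] := kkt_exists (data_sym t Tt) (inj t Tt) (sf t Tt).
  split=> [/(Pstar_kkt K0) K|[X' [y' [/kkt_Pstar K ->]]]] //.
  by exists Z, y0.
have DE t Z : T t -> Dstar d t Z <->
    exists X y, kkt (d t) X y /\ Z = (fun D _ y => slack D y) (d t) X y.
  move=> Tt; have [X0 [y0 K0]] := kkt_exists (data_sym t Tt) (inj t Tt) (sf t Tt).
  split=> [/(Dstar_kkt K0)[y' ZE K]|[X' [y' [/kkt_Dstar K ->]]]] //.
  by exists X0, y'.
have oB := near_setD_finite oT finB.
(* The slack combines the C^1 multipliers y with data that are polynomial in t on [T]. *)
have CZ i j : C1on (T `\` B) (fun t => slack (d t) (y t) i j).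
  have [pA _ pC] := data_poly; have [c cE] := pC i j.
  have [a aE] := choice (fun l => pA l i j).
  apply: (C1on_ext oB (f := fun t => c.[t] + \sum_l y t l 0 * (- a l).[t])).
    move=> t [Tt _]; rewrite mxE -cE // [(- adjA _ _) _ _]mxE summxE -sumrN; congr (_ + _).
    by apply: eq_bigr => l _; rewrite hornerN mulrN -aE // [in RHS]mxE.
  apply: (C1onD oB); first exact: C1on_poly.
  by apply: (C1on_sum oB) => l; apply: (C1onM oB); [exact: Cy | exact: C1on_poly].
have [P1 P2 P3] := component_types oT data_sym inj sf data_cont PE
  (fun U UU Ds D X X' y y' DD XX yy => XX) finB uniq CX.
have [U UU Ds D X' X0 y' y0 DD _ yy|D1 D2 D3] :=
  component_types (phi := fun D _ y => slack D y) oT data_sym inj sf data_cont DE _ finB uniq CZ.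
  exact: mcvg_slack.
split=> [|t Tt|//]; last by split=> Z; [exact: P2 | exact: D2].
apply: (@sub_finite_set _ _ ([set t | exists Z, irregular_point T (Pstar d) Z t] `|`
  [set t | exists Z, irregular_point T (Dstar d) Z t])) => //.
by rewrite finite_setU.
Qed.
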